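(* Let $-\pi<a<b<\pi$, $E=[-\pi,a]\cup[b,\pi]$, $I=[a,b]$. Let $\Lambda\subset\mathbb{C}$, let $F$ be a generating function for $\Lambda$ in $PW_E$, and let $\mathrm{T}$ be the set of the other zeros of $F$ (the zeros of $F$ not in $\Lambda$). Suppose that: (i) $\Lambda\cup \mathrm{T}$ is a complete interpolating sequence for $PW_\pi$; (ii) $\mathrm{T}$ is a complete interpolating sequence for $PW_I$; (iii) $$\inf_{t\in \mathrm{T}}\left|\frac{F^+(t)}{F'(t)}\right|\,\|\kappa^{\pi}_{t}\|_2\,\|\kappa^{I}_{\bar t}\|_2>0 .$$ Then $\Lambda$ is a complete interpolating sequence for $PW_E$.
   Context: For a compact set $S\subset\mathbb{R}$, the Paley-Wiener space $PW_S$ is the space of entire functions $f(z)=\int_S \varphi(t)e^{izt}\,dt$ with $\varphi\in L^2(S)$, with inner product $(f,g)=\frac1{2\pi}\int_{\mathbb{R}} f(x)\overline{g(x)}\,dx$. It is a reproducing kernel Hilbert space with reproducing kernel $\kappa^S_\lambda(z)=\int_S e^{i(z-\bar\lambda)t}\,dt$, so $f(\lambda)=(f,\kappa^S_\lambda)$. We write $PW_c$ for $PW_{[-c,c]}$ and $\kappa^{c}_\lambda$ for $\kappa^{[-c,c]}_\lambda$. A set $\Lambda\subset\mathbb{C}$ is a complete interpolating sequence for $PW_S$ if for every $\{a_\lambda\}\in\ell^2(\Lambda)$ there is a unique $f\in PW_S$ with $f(\lambda)/\|\kappa^S_\lambda\|=a_\lambda$ for all $\lambda\in\Lambda$; equivalently,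 the normalized kernels $\{\kappa^S_\lambda/\|\kappa^S_\lambda\|\}_{\lambda\in\Lambda}$ form a Riesz basis of $PW_S$. Put $E^-=[-\pi,a]$, $E^+=[b,\pi]$. A generating function for $\Lambda$ in $PW_E$ is an entire function $F\not\equiv 0$ in $PW_E+z\,PW_E=\{f+zg: f,g\in PW_E\}$ with $F(\lambda)=0$ for all $\lambda\in\Lambda$. Such $F$ decomposes uniquely as $F=F^-+F^+$ with $F^\pm\in PW_{E^\pm}+z\,PW_{E^\pm}$. Standing assumption: all zeros of $F$ are simple. *)

(* Defs.v *)
From HB Require Import structures.
From mathcomp Require Export all_boot all_order all_algebra.
From mathcomp Require Export complex.
From mathcomp Require Export all_classical all_reals all_analysis.

Set Implicit Arguments.
Unset Strict Implicit.
Unset Printing Implicit Defensive.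

Import Order.TTheory GRing.Theory Num.Theory.
Import numFieldNormedType.Exports.
Import ComplexField.Normc.

Local Open Scope classical_set_scope.
Local Open Scope ring_scope.
Local Open Scope complex_scope.

Local Notation Re := complex.Re.
Local Notation Im := complex.Im.

Section PaleyWiener.
Context {R : realType}.
Local Notation C := R[i].
Local Notation mu := (@lebesgue_measure R).
Implicit Types (S : set R) (f g F : C -> C) (L : set C) (z l : C).

Definition cexp z : C :=
  (expR (Re z) * cos (Im z)) +i* (expR (Re z) * sin (Im z)).

Definition cintegral S (h : R -> C) : C :=
  (\int[mu]_(x in S) Re (h x))%R +i* (\int[mu]_(x in S) Im (h x))%R.

Definition square_integrable S (phi : R -> C) : Prop :=
  [/\ measurable_fun S (fun t => Re (phi t)),
      measurable_fun S (fun t => Im (phi t)) &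
      mu.-integrable S (fun t => (normc (phi t) ^+ 2)%:E)].

(* The sets S below are meant to be compact.  Members of PW S are then
   automatically entire. *)
Definition PW S f : Prop :=
  exists2 phi : R -> C, square_integrable S phi &
    forall z, f z = cintegral S (fun t => phi t * cexp ('i * z * t%:C)).

Definition pw_inner f g : C :=
  ((2 * pi)^-1)%:C * cintegral setT (fun x => f x%:C * (g x%:C)^*).

Definition pw_norm f : R := Num.sqrt (Re (pw_inner f f)).

Definition kappa S l : C -> C :=
  fun z => cintegral S (fun t => cexp ('i * (z - l^*) * t%:C)).

(* A family indexed by L is represented by a function on all of C, of which only
   the values on L matter. *)
Definition ell2 L (a : C -> C) : Prop :=
  (\esum_(l in L) (normc (a l) ^+ 2)%:E < +oo)%E.

Definition complete_interpolating S L : Prop :=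
  forall a : C -> C, ell2 L a ->
    exists! f, PW S f /\
      forall l, L l -> f l / (pw_norm (kappa S l))%:C = a l.

Definition PW_plus_zPW S F : Prop :=
  exists f g, [/\ PW S f, PW S g & forall z, F z = f z + z * g z].

Definition entire F : Prop := forall z, @derivable C C^o C^o F z 1.

(* Complex derivative: the difference quotient is taken over the field C. *)
Definition cderiv F z : C := @derive1 C C^o F z.

Definition generating_function S L F : Prop :=
  [/\ entire F, exists z, F z <> 0, PW_plus_zPW S F &
      forall l, L l -> F l = 0].

End PaleyWiener.

(* Main.v *)
(* Members of [PW_S] are handled through their spectra: [phi] on [S] stands for
   [f z = \int_S phi(s) e^{izs} ds].  For [t] in [T] the quotient
   [g_t z = F z / (F'(t) (z - t))] is in [PW_pi], is 1 at [t] and 0 at the other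
   zeros of [F], and on the gap [I = (a, b)] its spectrum is the exponential
   [i (F^+(t) / F'(t)) e^{-its}], since [F^-] and [F^+] have no spectrum there.
   By (ii), after the reflection [s -> a + b - s], the functions [e^{-its}] are a
   Riesz basis of [L^2(I)], and (iii) says that the passage from the spectrum on
   [I] of a finite sum of the [g_t] to this sum is bounded.  Hence a solution in
   [PW_pi] of an interpolation problem can be given zero spectrum on [I] without
   changing it on [L]: this is existence in [PW_E].  Conversely, if [f] in [PW_E]
   vanishes on [L], then [f = \sum_t f(t) g_t] has spectrum zero on [I], so all
   [f(t)] vanish by the Riesz basis property, and [f = 0] by (i).

   Passing from complete interpolation to norm bounds uses a gliding hump, and
   the upper (Bessel) bound for the system of (i) comes from the lower one because
   the inverse of a Cauchy matrix is again, up to diagonal factors, a Cauchy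
   matrix. *)
Require Import Defs.
From mathcomp Require Import ring lra measurable_realfun.
Set Implicit Arguments.
Unset Strict Implicit.
Unset Printing Implicit Defensive.
Import Order.TTheory GRing.Theory Num.Theory.
Import numFieldNormedType.Exports.
Import ComplexField.Normc.
Local Open Scope classical_set_scope.
Local Open Scope ring_scope.
Local Open Scope complex_scope.
Local Notation Re := complex.Re.
Local Notation Im := complex.Im.

(** Every norm inequality is proved for finite sums, with a constant that does not depend on the
    sum; limits enter only through the completeness of L^2 and through suprema over finite sets.

    The points of L and T may lie anywhere in the plane, so all estimates carry the kernel norms as
    weights. These norms are integrals over the real line of explicit functions and are estimated
    directly, by multiples of e^{2 pi |Im l|} / (1 + |Im l|), from below for [-pi, pi] and from
    above for E. Two things depend on this: data normalised for PW_E stay square summable when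
    normalised for PW_pi, and the weights of (i) are large enough for the Cauchy matrix argument.

    The Bessel bound serves the uniqueness half: it makes the values f(t) square summable, so that f
    = \sum_t f(t) g_t can be truncated with a small remainder.

    The conjugate in the last norm of (iii) is the trace of the reflection of I: that norm is
    e^{(a+b) Im t} times the norm of the kernel at t, which is the weight that the reflected system
    inherits. *)

Section ComplexNumbers.
Context {R : realType}.
Local Notation C := R[i].
Implicit Types z w : C.

Lemma normc2E z : normc z ^+ 2 = Re z ^+ 2 + Im z ^+ 2.
Proof. by case: z => x y /=; rewrite sqr_sqrtr // addr_ge0 ?sqr_ge0. Qed.

Lemma normc_ge0 z : 0 <= normc z.
Proof. by case: z => x y; rewrite sqrtr_ge0. Qed.

Lemma normc_eq0 z : (normc z == 0) = (z == 0).
Proof. by apply/eqP/eqP => [/eq0_normc //|->]; rewrite normc0. Qed.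

Lemma normc_conj z : normc (conjc z) = normc z.
Proof. by case: z => x y /=; rewrite sqrrN. Qed.

Lemma Re_le_normc z : `|Re z| <= normc z.
Proof.
by case: z => x y /=; rewrite -sqrtr_sqr ler_wsqrtr // lerDl sqr_ge0.
Qed.

Lemma Im_le_normc z : `|Im z| <= normc z.
Proof.
by case: z => x y /=; rewrite -sqrtr_sqr ler_wsqrtr // lerDr sqr_ge0.
Qed.

Lemma normcD z w : normc (z + w) <= normc z + normc w.
Proof. exact: le_normcD. Qed.

Lemma normc_real (x : R) : normc x%:C = `|x|.
Proof. by rewrite /= expr0n addr0 sqrtr_sqr. Qed.

Lemma ReM z w : Re (z * w) = Re z * Re w - Im z * Im w.
Proof. by case: z w => [x y] [x' y']. Qed.

Lemma ImM z w : Im (z * w) = Re z * Im w + Im z * Re w.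
Proof. by case: z w => [x y] [x' y']. Qed.

Lemma ReD z w : Re (z + w) = Re z + Re w. Proof. by case: z w => [x y] []. Qed.
Lemma ImD z w : Im (z + w) = Im z + Im w. Proof. by case: z w => [x y] []. Qed.
Lemma ReN z : Re (- z) = - Re z. Proof. by case: z. Qed.
Lemma ImN z : Im (- z) = - Im z. Proof. by case: z. Qed.
Lemma ReB z w : Re (z - w) = Re z - Re w. Proof. by case: z w => [x y] []. Qed.
Lemma ImB z w : Im (z - w) = Im z - Im w. Proof. by case: z w => [x y] []. Qed.
Lemma Re_conj z : Re (conjc z) = Re z. Proof. by case: z. Qed.
Lemma Im_conj z : Im (conjc z) = - Im z. Proof. by case: z. Qed.

Lemma complexP z w : Re z = Re w -> Im z = Im w -> z = w.
Proof. by case: z w => [x y] [x' y'] /= -> ->. Qed.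

Lemma conjM z w : conjc (z * w) = conjc z * conjc w.
Proof. exact: rmorphM. Qed.
Lemma conjD z w : conjc (z + w) = conjc z + conjc w.
Proof. exact: rmorphD. Qed.
Lemma conjN z : conjc (- z) = - conjc z.
Proof. exact: rmorphN. Qed.
Lemma conjB z w : conjc (z - w) = conjc z - conjc w.
Proof. exact: rmorphB. Qed.

Lemma mulzJ z : z * conjc z = (normc z ^+ 2)%:C.
Proof.
by apply: complexP; rewrite ?ReM ?ImM ?Re_conj ?Im_conj ?normc2E /=; ring.
Qed.

Lemma cexpD z w : cexp (z + w) = cexp z * cexp w.
Proof.
case: z w => [x y] [x' y']; rewrite /cexp /= expRD cosD sinD.
by apply: complexP => /=; ring.
Qed.

Lemma cexp0 : cexp (0 : C) = 1.
Proof. by rewrite /cexp /= expR0 cos0 sin0 mulr1 mulr0. Qed.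

Lemma normc_cexp z : normc (cexp z) = expR (Re z).
Proof.
case: z => x y /=; rewrite !exprMn -mulrDr cos2Dsin2 mulr1 sqrtr_sqr.
by rewrite ger0_norm // expR_ge0.
Qed.

Lemma cexp_neq0 z : cexp z != 0.
Proof. by rewrite -normc_eq0 normc_cexp gt_eqF // expR_gt0. Qed.

Lemma cexp_conj z : cexp (conjc z) = conjc (cexp z).
Proof. by case: z => x y; rewrite /cexp /= cosN sinN mulrN. Qed.

End ComplexNumbers.

(** A discriminant inequality in the shape taken by the squared norm of u - x p v when p is itself
    the pairing of u and v, so that n = |p|^2 occurs twice. It serves the Cauchy-Schwarz
    inequalities and the near-orthogonality of minimizing sequences. *)
Lemma quadratic_ge0_le (R : realFieldType) (A B n : R) : 0 <= n -> 0 <= B ->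
  (forall x, 0 <= A - 2 * x * n + x ^+ 2 * n * B) -> n <= A * B.
Proof.
move=> n0 B0 key; have [Be|Bn] := eqVneq B 0.
  rewrite Be mulr0 leNgt; apply/negP => np.
  (* For B = 0 the expression is affine in x, and this x gives it the value -1. *)
  have := key ((A + 1) / (2 * n)); rewrite Be mulr0 addr0.
  rewrite (_ : 2 * _ * _ = A + 1); first by lra.
  by field; rewrite gt_eqF.
have Bp : 0 < B by rewrite lt0r Bn.
have := key B^-1.
rewrite (_ : _ + _ = A - n / B); last by field.
by rewrite subr_ge0 ler_pdivrMr.
Qed.

(** * Complex integrals and the seminorm of L^2(S) *)

Section ComplexIntegral.
Context {R : realType}.
Local Notation C := R[i].
Local Notation mu := (@lebesgue_measure R).
Variable S : set R.
Hypothesis mS : measurable (S : set (measurableTypeR R)).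
Implicit Types (h k phi psi : R -> C) (c : C).

Definition cintegrable h : Prop :=
  mu.-integrable S (EFin \o (fun t => Re (h t))) /\ mu.-integrable S (EFin \o (fun t => Im (h t))).

(** Functions are not identified almost everywhere, so this is the square of a seminorm; being zero
    in L^2 is expressed by [sqn S phi = 0]. *)
Definition sqn phi : R := (\int[mu]_(t in S) (normc (phi t) ^+ 2))%R.

Lemma eq_cintegral h k : (forall t, S t -> h t = k t) ->
  cintegral S h = cintegral S k.
Proof.
move=> hk; rewrite /cintegral; congr (_ +i* _);
  by apply: eq_Rintegral => t /set_mem /hk ->.
Qed.

Lemma eq_sqn h k : (forall t, S t -> h t = k t) -> sqn h = sqn k.
Proof. by move=> hk; apply: eq_Rintegral => t /set_mem /hk ->. Qed.

Lemma cintegrableD h k : cintegrable h -> cintegrable k ->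
  cintegrable (fun t => h t + k t).
Proof.
move=> [h1 h2] [k1 k2]; split.
- have := integrableD mS h1 k1; apply: eq_integrable => // t _ /=.
  by rewrite ReD.
- have := integrableD mS h2 k2; apply: eq_integrable => // t _ /=.
  by rewrite ImD.
Qed.

Lemma cintegrableZ c h : cintegrable h -> cintegrable (fun t => c * h t).
Proof.
move=> [h1 h2]; split.
- have := integrableB mS (integrableZl mS (Re c) h1) (integrableZl mS (Im c) h2).
  by apply: eq_integrable => // t _ /=; rewrite ReM EFinB !EFinM.
- have := integrableD mS (integrableZl mS (Re c) h2) (integrableZl mS (Im c) h1).
  by apply: eq_integrable => // t _ /=; rewrite ImM EFinD !EFinM.
Qed.

Lemma cintegralD h k : cintegrable h -> cintegrable k ->
  cintegral S (fun t => h t + k t) = cintegral S h + cintegral S k.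
Proof.
move=> [h1 h2] [k1 k2]; apply: complexP => /=.
- by rewrite -RintegralD //; apply: eq_Rintegral => t _; rewrite ReD.
- by rewrite -RintegralD //; apply: eq_Rintegral => t _; rewrite ImD.
Qed.

Lemma cintegralZ c h : cintegrable h ->
  cintegral S (fun t => c * h t) = c * cintegral S h.
Proof.
move=> [h1 h2].
have hZ (r : R) (f : R -> R) : mu.-integrable S (EFin \o f) ->
    mu.-integrable S (EFin \o (fun t => r * f t)).
  by move=> /(integrableZl mS r); apply: eq_integrable => // t _ /=.
apply: complexP; rewrite ?ReM ?ImM /=.
- rewrite -!RintegralZl // -RintegralB //; try exact: hZ.
  by apply: eq_Rintegral => t _; rewrite ReM.
- rewrite -!RintegralZl // -RintegralD //; try exact: hZ.
  by apply: eq_Rintegral => t _; rewrite ImM.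
Qed.

Lemma cintegral_conj h : cintegrable h ->
  cintegral S (fun t => conjc (h t)) = conjc (cintegral S h).
Proof.
move=> [h1 h2]; apply: complexP => /=.
- by apply: eq_Rintegral => t _; rewrite Re_conj.
- rewrite -mulN1r -RintegralZl //.
  by apply: eq_Rintegral => t _; rewrite Im_conj mulN1r.
Qed.

Lemma cintegrable0 : cintegrable (fun=> 0).
Proof.
by split; apply: (eq_integrable mS (cst 0%E)) => //; exact: integrable0.
Qed.

Lemma cintegral0 : cintegral S (fun=> 0) = 0.
Proof.
by apply: complexP => /=; rewrite /Rintegral integral0.
Qed.

Lemma cintegrable_sum (I : Type) (s : seq I) (h : I -> R -> C) :
  (forall j, cintegrable (h j)) -> cintegrable (fun t => \sum_(j <- s) h j t).
Proof.
move=> hh; elim: s => [|j s IH].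
  by under eq_fun do rewrite big_nil; exact: cintegrable0.
by under eq_fun do rewrite big_cons; exact: cintegrableD.
Qed.

Lemma cintegral_sum (I : Type) (s : seq I) (h : I -> R -> C) :
  (forall j, cintegrable (h j)) ->
  cintegral S (fun t => \sum_(j <- s) h j t) = \sum_(j <- s) cintegral S (h j).
Proof.
move=> hh; elim: s => [|j s IH].
  by under eq_fun do rewrite big_nil; rewrite cintegral0 big_nil.
under eq_fun do rewrite big_cons.
by rewrite cintegralD // ?IH ?big_cons //; exact: cintegrable_sum.
Qed.

Lemma square_integrable0 : square_integrable S (fun=> 0 : C).
Proof.
split; [exact: measurable_cst..|].
by under eq_fun do rewrite normc0 expr0n; exact: integrable0.
Qed.

Lemma square_integrable_le phi (g : R -> R) :
  measurable_fun S (fun t => Re (phi t)) -> measurable_fun S (fun t => Im (phi t)) ->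
  mu.-integrable S (EFin \o g) ->
  (forall t, S t -> normc (phi t) ^+ 2 <= g t) -> square_integrable S phi.
Proof.
move=> m1 m2 ig le; split => //.
apply: (le_integrable mS _ _ ig).
  apply/measurable_EFinP; under eq_fun do rewrite normc2E.
  by apply: measurable_funD; exact: measurable_funX.
move=> t St /=; rewrite lee_fin ger0_norm ?exprn_ge0 ?normc_ge0 //.
by apply: le_trans (le t St) _; exact: ler_norm.
Qed.

Lemma square_integrableD phi psi : square_integrable S phi ->
  square_integrable S psi -> square_integrable S (fun t => phi t + psi t).
Proof.
move=> [p1 p2 p3] [q1 q2 q3].
apply: (@square_integrable_le _
  (fun t => 2 * normc (phi t) ^+ 2 + 2 * normc (psi t) ^+ 2)).
- by under eq_fun do rewrite ReD; exact: measurable_funD.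
- by under eq_fun do rewrite ImD; exact: measurable_funD.
- have := integrableD mS (integrableZl mS 2 p3) (integrableZl mS 2 q3).
  by apply: eq_integrable => // t _ /=.
- move=> t _; rewrite !normc2E ReD ImD.
  have := sqr_ge0 (Re (phi t) - Re (psi t)).
  have := sqr_ge0 (Im (phi t) - Im (psi t)); rewrite !expr2; lra.
Qed.

Lemma square_integrableZ c phi : square_integrable S phi ->
  square_integrable S (fun t => c * phi t).
Proof.
move=> [p1 p2 p3].
apply: (@square_integrable_le _ (fun t => normc c ^+ 2 * normc (phi t) ^+ 2)).
- under eq_fun do rewrite ReM.
  by apply: measurable_funB; apply: measurable_funM => //; exact: measurable_cst.
- under eq_fun do rewrite ImM.
  by apply: measurable_funD; apply: measurable_funM => //; exact: measurable_cst.
- have := integrableZl mS (normc c ^+ 2) p3.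
  by apply: eq_integrable => // t _ /=.
- by move=> t _; rewrite normcM exprMn.
Qed.

Lemma square_integrable_conj phi : square_integrable S phi ->
  square_integrable S (fun t => conjc (phi t)).
Proof.
move=> [p1 p2 p3].
apply: (@square_integrable_le _ (fun t => normc (phi t) ^+ 2)) => //.
- by under eq_fun do rewrite Re_conj.
- under eq_fun do rewrite Im_conj.
  exact: measurableT_comp.
- by move=> t _; rewrite normc_conj.
Qed.

Lemma square_integrableB phi psi : square_integrable S phi ->
  square_integrable S psi -> square_integrable S (fun t => phi t - psi t).
Proof.
move=> p q; under eq_fun do rewrite -[- psi _]mulN1r.
by apply: square_integrableD => //; exact: square_integrableZ.
Qed.

Lemma square_integrable_sum (I : Type) (s : seq I) (h : I -> R -> C) :
  (forall j, square_integrable S (h j)) ->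
  square_integrable S (fun t => \sum_(j <- s) h j t).
Proof.
move=> hh; elim: s => [|j s IH].
  by under eq_fun do rewrite big_nil; exact: square_integrable0.
by under eq_fun do rewrite big_cons; exact: square_integrableD.
Qed.

Lemma cintegrableM phi psi : square_integrable S phi ->
  square_integrable S psi -> cintegrable (fun t => phi t * psi t).
Proof.
move=> [p1 p2 p3] [q1 q2 q3].
have ig : mu.-integrable S
    (EFin \o (fun t => normc (phi t) ^+ 2 + normc (psi t) ^+ 2)).
  have := integrableD mS p3 q3.
  by apply: eq_integrable => // t _ /=.
have le t : normc (phi t * psi t) <= normc (phi t) ^+ 2 + normc (psi t) ^+ 2.
  rewrite normcM.
  have := sqr_ge0 (normc (phi t) - normc (psi t)); rewrite !expr2.
  have := normc_ge0 (phi t); have := normc_ge0 (psi t); nra.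
split; apply: (le_integrable mS _ _ ig) => /=.
- apply/measurable_EFinP => /=; under eq_fun do rewrite ReM.
  by apply: measurable_funB; exact: measurable_funM.
- move=> t _ /=; rewrite lee_fin (le_trans (Re_le_normc _)) //.
  by rewrite (le_trans (le t)) // ler_norm.
- apply/measurable_EFinP => /=; under eq_fun do rewrite ImM.
  by apply: measurable_funD; exact: measurable_funM.
- move=> t _ /=; rewrite lee_fin (le_trans (Im_le_normc _)) //.
  by rewrite (le_trans (le t)) // ler_norm.
Qed.

Lemma sqn_ge0 phi : 0 <= sqn phi.
Proof. by apply: Rintegral_ge0 => t _; rewrite exprn_ge0 ?normc_ge0. Qed.

Lemma sqnE phi : cintegral S (fun t => phi t * conjc (phi t)) = (sqn phi)%:C.
Proof.
under eq_fun do rewrite mulzJ.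
by apply: complexP => //=; rewrite /Rintegral integral0.
Qed.

Lemma sqnZ c phi : square_integrable S phi ->
  sqn (fun t => c * phi t) = normc c ^+ 2 * sqn phi.
Proof.
move=> [_ _ p]; rewrite /sqn -RintegralZl //.
by apply: eq_Rintegral => t _; rewrite normcM exprMn.
Qed.

Lemma sqn_conj phi : sqn (fun t => conjc (phi t)) = sqn phi.
Proof. by apply: eq_Rintegral => t _; rewrite normc_conj. Qed.

Lemma sqnD phi psi : square_integrable S phi -> square_integrable S psi ->
  sqn (fun t => phi t + psi t) =
  sqn phi + sqn psi + 2 * Re (cintegral S (fun t => phi t * conjc (psi t))).
Proof.
move=> p q; have q' := square_integrable_conj q.
have [i1 _] := cintegrableM p q'.
have [_ _ p3] := p; have [_ _ q3] := q.
rewrite /= -RintegralZl // -!RintegralD //.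
- apply: eq_Rintegral => t _.
  by rewrite !normc2E ReD ImD ReM Re_conj Im_conj; ring.
- by have := integrableD mS p3 q3; apply: eq_integrable => // t _ /=.
- have := integrableZl mS 2 i1.
  by apply: eq_integrable => // t _ /=.
Qed.

(** Expands the squared norm of [phi - x al conj(psi)], with [al] the pairing and x real. The
    pairing is bilinear because a Paley-Wiener function takes its values by pairing the spectrum
    with an exponential, without conjugation. *)
Lemma cauchy_schwarz phi psi : square_integrable S phi ->
  square_integrable S psi ->
  normc (cintegral S (fun t => phi t * psi t)) ^+ 2 <= sqn phi * sqn psi.
Proof.
move=> p q; set al := cintegral _ _.
have key (x : R) :
    0 <= sqn phi - 2 * x * normc al ^+ 2 + x ^+ 2 * normc al ^+ 2 * sqn psi.
  have q' := square_integrable_conj q.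
  have qz := square_integrableZ (- (x%:C * al)) q'.
  have := sqn_ge0 (fun t => phi t + - (x%:C * al) * conjc (psi t)).
  rewrite sqnD // sqnZ // sqn_conj normcN normcM normc_real exprMn real_normK ?num_real //.
  rewrite (_ : cintegral S _ = - conjc (x%:C * al) * al); last first.
    transitivity (cintegral S (fun t => - conjc (x%:C * al) * (phi t * psi t))).
      2: exact: (cintegralZ _ (cintegrableM p q)).
    by apply: eq_cintegral => t _; rewrite !conjM !conjN !conjM !conjcK; ring.
  rewrite (_ : Re _ = - x * normc al ^+ 2); last first.
    by rewrite normc2E; case: (al) => u v /=; ring.
  by congr (_ <= _); ring.
by apply: quadratic_ge0_le => //; rewrite ?sqr_ge0 ?sqn_ge0.
Qed.

Definition nrm phi : R := Num.sqrt (sqn phi).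

Lemma nrm_ge0 phi : 0 <= nrm phi. Proof. exact: sqrtr_ge0. Qed.

Lemma nrm2 phi : nrm phi ^+ 2 = sqn phi.
Proof. by rewrite sqr_sqrtr // sqn_ge0. Qed.

Lemma nrm_conj phi : nrm (fun t => conjc (phi t)) = nrm phi.
Proof. by rewrite /nrm sqn_conj. Qed.

Lemma normc_pairing_le phi psi : square_integrable S phi ->
  square_integrable S psi ->
  normc (cintegral S (fun t => phi t * psi t)) <= nrm phi * nrm psi.
Proof.
move=> p q; have := cauchy_schwarz p q.
by rewrite -ler_sqrt ?mulr_ge0 ?sqn_ge0 // sqrtr_sqr ger0_norm ?normc_ge0 //
  sqrtrM // sqn_ge0.
Qed.

Lemma nrmD phi psi : square_integrable S phi -> square_integrable S psi ->
  nrm (fun t => phi t + psi t) <= nrm phi + nrm psi.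
Proof.
move=> p q; rewrite -ler_sqr ?nnegrE ?addr_ge0 ?nrm_ge0 // nrm2 sqnD // sqrrD !nrm2.
have := normc_pairing_le p (square_integrable_conj q).
rewrite nrm_conj => le.
have := le_trans (ler_norm _) (le_trans (Re_le_normc _) le).
lra.
Qed.

Lemma nrmZ c phi : square_integrable S phi ->
  nrm (fun t => c * phi t) = normc c * nrm phi.
Proof.
move=> p; rewrite /nrm sqnZ // sqrtrM ?sqr_ge0 // sqrtr_sqr.
by rewrite ger0_norm // normc_ge0.
Qed.

Lemma nrmB phi psi : square_integrable S phi -> square_integrable S psi ->
  nrm (fun t => phi t - psi t) <= nrm phi + nrm psi.
Proof.
move=> p q; under eq_fun do rewrite -[- psi _]mulN1r.
apply: le_trans (nrmD p (square_integrableZ _ q)) _.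
by rewrite nrmZ // normcN normc1 mul1r.
Qed.

Lemma nrmBC phi psi : nrm (fun t => phi t - psi t) = nrm (fun t => psi t - phi t).
Proof.
by congr Num.sqrt; apply: eq_Rintegral => t _; rewrite -normcN opprB.
Qed.

Lemma nrm_triangle phi psi chi : square_integrable S phi ->
  square_integrable S psi -> square_integrable S chi ->
  nrm (fun t => phi t - psi t) <=
  nrm (fun t => phi t - chi t) + nrm (fun t => chi t - psi t).
Proof.
move=> p q r.
rewrite (_ : (fun t => phi t - psi t) =
             fun t => (phi t - chi t) + (chi t - psi t)).
  by apply: nrmD; exact: square_integrableB.
by apply: funext => t; rewrite addrA subrK.
Qed.

End ComplexIntegral.

(** * Completeness of L^2(S) *)

Lemma cvgn_of_summable_steps (R : realType) (u h : R^nat) :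
  (forall k, 0 <= h k) ->
  (forall k, `|u k.+1 - u k| <= h k + (2 ^+ k)^-1) ->
  (\sum_(0 <= k <oo) (h k)%:E < +oo)%E -> cvgn u.
Proof.
move=> h0 le fin.
have c1 : cvgn (series h).
  apply: nondecreasing_is_cvgn.
    by apply/nondecreasing_seqP => n; rewrite /series /= big_nat_recr //= lerDl.
  exists (fine (\sum_(0 <= k <oo) (h k)%:E)%E) => _ [n _ <-].
  rewrite -lee_fin fineK; last first.
    by rewrite ge0_fin_numE // nneseries_ge0 // => k _ _; rewrite lee_fin.
  rewrite /series /= -sumEFin.
  by apply: nneseries_lim_ge => k _ _; rewrite lee_fin.
have c2 : cvgn (series (fun k => h k + (2 ^+ k)^-1)).
  have c3 : cvgn (series (geometric 1 (2^-1 : R))).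
    by apply: is_cvg_geometric_series; rewrite ger0_norm ?invr_ge0 // invf_lt1 // ltr1n.
  have -> : series (fun k => h k + (2 ^+ k)^-1) =
            series h \+ series (geometric 1 (2^-1 : R)).
    apply: funext => n; rewrite /series /= -big_split /=.
    by apply: eq_bigr => k _; rewrite mul1r exprVn.
  exact: is_cvgD.
have c4 : cvgn (series (telescope u)).
  apply: (@normed_cvg R R^o).
  apply: (series_le_cvg _ _ _ c2) => // k.
  - by rewrite /=.
  - by rewrite addr_ge0 ?h0 // invr_ge0 exprn_ge0.
have -> : u = cst (u 0%N) \+ series (telescope u).
  by apply: funext => n /=; exact: eq_sum_telescope.
by apply: is_cvgD => //; exact: is_cvg_cst.
Qed.

Section Completeness.
Context {R : realType}.
Local Notation C := R[i].
Local Notation mu := (@lebesgue_measure R).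
Variable S : set R.
Hypothesis mS : measurable (S : set (measurableTypeR R)).

(** The Riesz-Fischer argument: a weighted sum of squared increments has finite integral, hence is
    finite almost everywhere, which gives pointwise convergence; Fatou's lemma then gives the
    rate. *)
Lemma L2_fast_cauchy_cvg (phi : nat -> R -> C) :
  (forall n, square_integrable S (phi n)) ->
  (forall n, nrm S (fun t => phi n.+1 t - phi n t) <= (2 ^+ n)^-1) ->
  exists2 phi0, square_integrable S phi0 &
    forall n, nrm S (fun t => phi n t - phi0 t) <= 2 * (2 ^+ n)^-1.
Proof.
move=> sq fast.
have sqB m n : square_integrable S (fun t => phi m t - phi n t).
  exact: square_integrableB.
(* The weight 2^k keeps the k-th integral below 2^k 4^-k = 2^-k, and x <= 2^k x^2 + 2^-k turns
   summability of the weighted squares into summability of the increments. *)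
pose h k t := 2 ^+ k * normc (phi k.+1 t - phi k t) ^+ 2 : R.
have h0 k t : 0 <= h k t by rewrite mulr_ge0 ?exprn_ge0 ?normc_ge0.
have mn (f : R -> C) : square_integrable S f ->
    measurable_fun S (fun t => normc (f t) ^+ 2).
  by case=> _ _ /(measurable_int mu)/measurable_EFinP.
have mh k : measurable_fun S (fun t => (h k t)%:E).
  apply/measurable_EFinP; apply: measurable_funM; first exact: measurable_cst.
  exact: mn.
have inth : (\int[mu]_(t in S) (\sum_(0 <= k <oo) (h k t)%:E) < +oo)%E.
  rewrite (integral_nneseries mu mS) => [|//|k t _]; last by rewrite lee_fin.
  apply: le_lt_trans (_ : (\sum_(0 <= k <oo) ((1 / (2 ^ (k + 1))%:R : R) * 2)%:E < +oo)%E).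
    apply: lee_nneseries => [k _ _|k _].
      by apply: integral_ge0 => t _; rewrite lee_fin.
    have [_ _ i3] := sqB k.+1 k.
    under eq_integral do rewrite EFinM.
    rewrite integralZl // -(fineK (integrable_fin_num mS i3)) -EFinM lee_fin.
    rewrite -[fine _]/(sqn S _) -nrm2.
    have := fast k; have := nrm_ge0 S (fun t => phi k.+1 t - phi k t).
    set x := nrm _ _ => x0 xle.
    rewrite addn1 expnS natrM natrX.
    have p0 : (0 : R) < 2 ^+ k by rewrite exprn_gt0.
    have -> : 1 / (2 * 2 ^+ k) * 2 = 2 ^+ k * ((2 ^+ k)^-1) ^+ 2 :> R.
      by field; rewrite gt_eqF.
    by rewrite ler_pM2l // ler_sqr // nnegrE invr_ge0 ltW.
  under eq_eseriesr do rewrite mulrC EFinM.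
  rewrite nneseriesZl; last by move=> k _; rewrite lee_fin divr_ge0.
  have /cvg_lim -> // := @cvg_geometric_eseries_half R 1 0.
  by rewrite expr0 -EFinM ltry.
have msum : measurable_fun S (fun t => (\sum_(0 <= k <oo) (h k t)%:E)%E).
  by apply: ge0_emeasurable_sum => // k t _ _; rewrite lee_fin.
have ae_fin : \forall t \ae mu, S t -> (\sum_(0 <= k <oo) (h k t)%:E < +oo)%E.
  have ih : mu.-integrable S (fun t => (\sum_(0 <= k <oo) (h k t)%:E)%E).
    apply/integrableP; split => //.
    under eq_integral => t _.
      rewrite gee0_abs; last by rewrite nneseries_ge0 // => k _ _; rewrite lee_fin.
      over.
    exact: inth.
  have := integrable_ae mS ih.
  by apply: filterS => t f St; rewrite ltey_eq f.
(* A limsup is measurable whether or not the sequence converges; where it converges, it is the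
   limit. *)
pose L (f : nat -> R -> R) t := fine (limn_esup (fun n => (f n t)%:E)).
have mL (f : nat -> R -> R) : (forall n, measurable_fun S (f n)) ->
    measurable_fun S (L f).
  move=> mf; apply: (measurableT_comp (fine_measurable measurableT)).
  by apply: measurable_fun_limn_esup => n; exact/measurable_EFinP.
have cvgL (f : nat -> R -> R) t : cvgn (f ^~ t) -> f n t @[n --> \oo] --> L f t.
  move=> c; rewrite /L (_ : limn_esup _ = (limn (f ^~ t))%:E) //.
  have cE : (fun n => (f n t)%:E) @ \oo --> (limn (f ^~ t))%:E.
    by apply: cvg_EFin => //; exact: nearW.
  rewrite is_cvg_limn_esupE; first exact: cvg_lim cE.
  by apply/cvg_ex; exists (limn (f ^~ t))%:E.
pose phi0 t := L (fun n t => Re (phi n t)) t +i* L (fun n t => Im (phi n t)) t.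
have m1 : measurable_fun S (fun t => Re (phi0 t)).
  by apply: (mL (fun n t => Re (phi n t))) => n; case: (sq n).
have m2 : measurable_fun S (fun t => Im (phi0 t)).
  by apply: (mL (fun n t => Im (phi n t))) => n; case: (sq n).
have ae_cvg n : \forall t \ae mu, S t ->
    (fun m => (normc (phi n t - phi (n + m)%N t) ^+ 2)%:E) @ \oo -->
    (normc (phi n t - phi0 t) ^+ 2)%:E.
  apply: (@filterS _ _ (ae_filter_ringOfSetsType mu) _ _ _ ae_fin) => t fin' St.
  have {fin'}fin := fin' St.
  have step (g : C -> R) : (forall z, `|g z| <= normc z) ->
      (forall z w, g (z - w) = g z - g w) -> cvgn (fun k => g (phi k t)).
    move=> gle gB.
    apply: (@cvgn_of_summable_steps R _ (fun k => h k t)) => // k.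
    rewrite -gB; apply: le_trans (gle _) _; rewrite /h.
    set x := normc _; have p0 : (0 : R) < 2 ^+ k by rewrite exprn_gt0.
    rewrite -(ler_pM2l p0) mulrDr divff ?gt_eqF // mulrA -expr2 -exprMn.
    have := sqr_ge0 (2 ^+ k * x - 1 / 2); rewrite sqrrB; nra.
  have cR := cvgL (fun n t => Re (phi n t)) t
    (step (@complex.Re R) (@Re_le_normc R) (@ReB R)).
  have cI := cvgL (fun n t => Im (phi n t)) t
    (step (@complex.Im R) (@Im_le_normc R) (@ImB R)).
  apply: cvg_EFin; first exact: nearW.
  have sh (u : R^nat) (l : R) : u @ \oo --> l -> (fun m => u (n + m)%N) @ \oo --> l.
    move=> c; rewrite -(cvg_shiftn n) in c.
    by under eq_fun do rewrite addnC.
  rewrite /comp /=; under eq_fun do rewrite normc2E ReB ImB.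
  rewrite normc2E ReB ImB.
  apply: cvgD; rewrite !expr2; under eq_fun do rewrite expr2.
  - by apply: cvgM; (apply: cvgB; [exact: cvg_cst|exact: sh cR]).
  - by apply: cvgM; (apply: cvgB; [exact: cvg_cst|exact: sh cI]).
(* The subtracted term makes the induction exact: with j = n + m, adding 2^-j turns -2 * 2^-j into
   -2 * 2^-(j+1). *)
have near n m : nrm S (fun t => phi n t - phi (n + m)%N t) <=
    2 * (2 ^+ n)^-1 - 2 * (2 ^+ (n + m))^-1.
  elim: m => [|m IH].
    rewrite addn0 subrr (_ : (fun t => _) = fun=> 0).
      by rewrite /nrm /sqn; under eq_Rintegral do rewrite normc0 expr0n;
         rewrite /Rintegral integral0 sqrtr0.
    by apply: funext => t; rewrite subrr.
  apply: le_trans (nrm_triangle mS (sq n) (sq (n + m.+1)%N) (sq (n + m)%N)) _.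
  apply: le_trans (lerD IH _) _; first by rewrite nrmBC addnS; exact: fast.
  rewrite addnS exprS invfM -addrA lerD2l; lra.
(* Fatou's lemma in m, since |phi n - phi0|^2 is almost everywhere the limit of |phi n - phi
   (n+m)|^2. *)
have sqle n : (\int[mu]_(t in S) (normc (phi n t - phi0 t) ^+ 2)%:E <=
    ((2 * (2 ^+ n)^-1) ^+ 2)%:E)%E.
  have mphi0 : measurable_fun S (fun t => (normc (phi n t - phi0 t) ^+ 2)%:E).
    apply/measurable_EFinP; under eq_fun do rewrite normc2E ReB ImB.
    have [q1 q2 _] := sq n.
    by apply: measurable_funD; apply: measurable_funX; exact: measurable_funB.
  have mm m : measurable_fun S (fun t => (normc (phi n t - phi (n + m)%N t) ^+ 2)%:E).
    by apply/measurable_EFinP; exact: mn.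
  have -> : (\int[mu]_(t in S) (normc (phi n t - phi0 t) ^+ 2)%:E =
    \int[mu]_(t in S)
      limn_einf (fun m => (normc (phi n t - phi (n + m)%N t) ^+ 2)%:E))%E.
    apply: ge0_ae_eq_integral => //.
    - have -> : (fun t => limn_einf (fun m => (normc (phi n t - phi (n + m)%N t) ^+ 2)%:E)) =
        (fun t => - limn_esup (fun m => - (normc (phi n t - phi (n + m)%N t) ^+ 2)%:E))%E.
        apply: funext => t; rewrite -limn_einfN; congr limn_einf.
        by apply: funext => m; rewrite /comp oppeK.
      apply: measurableT_comp => //; apply: measurable_fun_limn_esup => m.
      by apply: (measurableT_comp _ (mm m)).
    - by move=> t _; rewrite lee_fin sqr_ge0.
    - move=> t _; rewrite limn_einf_lim; apply: lime_ge; first exact: is_cvg_einfs.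
      apply: nearW => m; apply: le_ereal_inf_tmp => _ [k _ <-].
      by rewrite lee_fin sqr_ge0.
    - apply: (@filterS _ _ (ae_filter_ringOfSetsType mu) _ _ _ (ae_cvg n)) => t c St.
      by have [-> _] := cvg_limn_einf_sup (c St).
  apply: le_trans (fatou mu mS mm _) _ => [m t _|].
    by rewrite lee_fin sqr_ge0.
  rewrite limn_einf_lim; apply: lime_le; first exact: is_cvg_einfs.
  apply: nearW => m.
  apply: le_trans (ereal_inf_lbound _) (_ : (\int[mu]_(t in S)
    (normc (phi n t - phi (n + m)%N t) ^+ 2)%:E <= _)%E).
    by exists m => /=.
  have [_ _ i3] := sqB n (n + m)%N.
  rewrite -(fineK (integrable_fin_num mS i3)) lee_fin.
  rewrite -[fine _]/(sqn S _) -nrm2 ler_sqr ?nnegrE ?nrm_ge0 //.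
  apply: le_trans (near n m) _; rewrite gerBl.
  by rewrite mulr_ge0 // invr_ge0 exprn_ge0.
have sqd n : square_integrable S (fun t => phi n t - phi0 t).
  have [q1 q2 _] := sq n; split.
  - by under eq_fun do rewrite ReB; exact: measurable_funB.
  - by under eq_fun do rewrite ImB; exact: measurable_funB.
  - apply/integrableP; split.
      apply/measurable_EFinP; under eq_fun do rewrite normc2E ReB ImB.
      by apply: measurable_funD; apply: measurable_funX; exact: measurable_funB.
    under eq_integral do rewrite /= ger0_norm ?exprn_ge0 ?normc_ge0 //.
    by apply: le_lt_trans (sqle n) _; rewrite ltry.
exists phi0.
  have -> : phi0 = fun t => phi 0%N t - (phi 0%N t - phi0 t).
    by apply: funext => t; rewrite opprB addrC subrK.
  exact: square_integrableB.
move=> n; rewrite -ler_sqr ?nnegrE ?nrm_ge0 ?mulr_ge0 ?invr_ge0 ?exprn_ge0 //.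
have [_ _ i3] := sqd n.
by rewrite nrm2 -lee_fin /sqn fineK ?(integrable_fin_num mS i3) //; exact: sqle.
Qed.

Lemma L2_complete (phi : nat -> R -> C) :
  (forall n, square_integrable S (phi n)) ->
  (forall e, 0 < e -> exists N, forall m n, (N <= m)%N -> (N <= n)%N ->
    nrm S (fun t => phi m t - phi n t) <= e) ->
  exists2 phi0, square_integrable S phi0 &
    forall e, 0 < e -> exists N, forall n, (N <= n)%N ->
      nrm S (fun t => phi n t - phi0 t) <= e.
Proof.
move=> sq cau.
have /choice[N NP] : forall k, exists N, forall m n, (N <= m)%N -> (N <= n)%N ->
    nrm S (fun t => phi m t - phi n t) <= (2 ^+ k)^-1.
  by move=> k; apply: cau; rewrite invr_gt0 exprn_gt0.
(* Partial sums of [N] give a nondecreasing choice of indices with [N k <= s k]. *)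
pose s k := (\sum_(0 <= i < k.+1) N i)%N.
have Ns k : (N k <= s k)%N by rewrite /s big_nat_recr //= leq_addl.
have sS k : (s k <= s k.+1)%N by rewrite /s [X in (_ <= X)%N]big_nat_recr //= leq_addr.
have [phi0 sq0 lim0] := @L2_fast_cauchy_cvg (fun k => phi (s k)) (fun k => sq (s k))
  (fun k => NP k _ _ (leq_trans (Ns k) (sS k)) (Ns k)).
exists phi0 => // e e0.
have [k ke] : exists k, 3 * (2 ^+ k)^-1 <= e.
  pose k := (Num.truncn (3 / e)).+1; exists k.
  have lt1 : 3 / e < k%:R by exact: truncnS_gt.
  have lt2 : k%:R <= 2 ^+ k :> R by rewrite -natrX ler_nat ltnW // ltn_expl.
  rewrite ler_pdivrMr ?exprn_gt0 // mulrC -ler_pdivrMr //.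
  by rewrite ltW // (lt_le_trans lt1).
exists (N k) => n nN.
apply: le_trans (nrm_triangle mS (sq n) sq0 (sq (s k))) _.
apply: le_trans (lerD (NP k _ _ nN (Ns k)) (lim0 k)) _; lra.
Qed.

End Completeness.

(** * Exponentials, and injectivity of the Fourier transform on bounded sets *)

Section Exponentials.
Context {R : realType}.
Local Notation C := R[i].
Local Notation mu := (@lebesgue_measure R).

Definition cexpi (z : C) (t : R) : C := cexp ('i * z * t%:C).

Lemma cexpi0 t : cexpi 0 t = 1.
Proof. by rewrite /cexpi mulr0 mul0r cexp0. Qed.

Lemma cexpiE z t : cexpi z t =
  (expR (- Im z * t) * cos (Re z * t)) +i* (expR (- Im z * t) * sin (Re z * t)).
Proof.
rewrite /cexpi /cexp; case: z => x y.
have -> : 'i * (x +i* y) * t%:C = (- y * t) +i* (x * t).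
  by apply: complexP; rewrite ?ReM ?ImM /=; ring.
by [].
Qed.

Lemma normc_cexpi z t : normc (cexpi z t) = expR (- Im z * t).
Proof.
rewrite normc_cexp; congr expR.
by case: z => x y; rewrite !ReM !ImM /=; ring.
Qed.

Lemma cexpiD z w t : cexpi (z + w) t = cexpi z t * cexpi w t.
Proof. by rewrite /cexpi -cexpD; congr cexp; ring. Qed.

Lemma measurable_Re_cexpi z (S : set R) :
  measurable_fun S (fun t => Re (cexpi z t)).
Proof.
under eq_fun do rewrite cexpiE /=.
apply: measurable_funM; apply: (@measurable_funTS _ _ _ _ _ _ _).
- by apply: measurableT_comp => //; exact: measurable_funM.
- apply: measurableT_comp; last exact: measurable_funM.
  by apply: continuous_measurable_fun; exact: continuous_cos.
Qed.

Lemma measurable_Im_cexpi z (S : set R) :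
  measurable_fun S (fun t => Im (cexpi z t)).
Proof.
under eq_fun do rewrite cexpiE /=.
apply: measurable_funM; apply: (@measurable_funTS _ _ _ _ _ _ _).
- by apply: measurableT_comp => //; exact: measurable_funM.
- apply: measurableT_comp; last exact: measurable_funM.
  by apply: continuous_measurable_fun; exact: continuous_sin.
Qed.

End Exponentials.

Section Injectivity.
Context {R : realType}.
Local Notation C := R[i].
Local Notation mu := (@lebesgue_measure R).
Variable S : set R.
Hypothesis mS : measurable (S : set (measurableTypeR R)).

Lemma dominated_Rintegral_cvg (f_ : nat -> R -> R) (f g : R -> R) :
  (forall n, measurable_fun S (f_ n)) ->
  (forall t, S t -> f_ n t @[n --> \oo] --> f t) ->
  mu.-integrable S (EFin \o g) ->
  (forall n t, S t -> `|f_ n t| <= g t) ->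
  (\int[mu]_(t in S) f_ n t)%R @[n --> \oo] --> (\int[mu]_(t in S) f t)%R.
Proof.
move=> mf cf ig fg.
have mf_ : forall n, measurable_fun S (EFin \o f_ n).
  by move=> n; exact/measurable_EFinP.
have mf0 : measurable_fun S f by exact: measurable_fun_cvg cf.
have cf' : forall t, S t -> (EFin \o f_ n) t @[n --> \oo] --> (EFin \o f) t.
  by move=> t St; apply: cvg_EFin; [exact: nearW|exact: cf].
have fg' : forall n t, S t -> (`|(EFin \o f_ n) t| <= (EFin \o g) t)%E.
  by move=> n t St /=; rewrite lee_fin fg.
have fin : (\int[mu]_(t in S) (EFin \o f) t)%E \is a fin_num.
  apply: integrable_fin_num => //.
  apply: (le_integrable mS _ _ ig) => [|t St]; first exact/measurable_EFinP.
  rewrite /= lee_fin (le_trans _ (ler_norm _)) //.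
  have cn : (fun n => `|f_ n t|) @ \oo --> `|f t| by exact: cvg_norm (cf t St).
  have <- : limn (fun n => `|f_ n t|) = `|f t| by exact/cvg_lim.
  apply: limr_le.
    by apply/cvg_ex; exists `|f t|.
  by apply: nearW => n; exact: fg.
apply: fine_cvg; rewrite /Rintegral fineK //.
exact: (dominated_cvg mS mf_ cf' _ ig fg').
Qed.

Variable M : R.
Hypothesis SM : forall t, S t -> `|t| <= M.

Lemma integrable_expM (p : R -> R) (x : R) : mu.-integrable S (EFin \o p) ->
  mu.-integrable S (EFin \o (fun t => p t * expR (x * t))).
Proof.
move=> ip; have ip' := integrable_norm ip.
have := integrableZl mS (expR (`|x| * M)) ip'; apply: le_integrable => //.
  apply/measurable_EFinP; apply: measurable_funM.
    by have /measurable_int/measurable_EFinP := ip.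
  apply: measurableT_comp => //; apply: measurable_funM => //.
move=> t St /=; rewrite lee_fin normrM mulrC ger0_norm ?expR_ge0 //.
rewrite normrM normr_id (ger0_norm (expR_ge0 (`|x| * M))).
rewrite ler_wpM2r // ler_expR (le_trans (ler_norm _)) // normrM.
by rewrite ler_wpM2l // SM.
Qed.

(* [exp (- exp (n (t - x)))], a power series in [exp (n t)], tends to the indicator
   of [t < x]: moments against [exp (m t)] determine the primitive of [p]. *)
Lemma expexp_orthogonal (p : R -> R) : mu.-integrable S (EFin \o p) ->
  (forall m : nat, (\int[mu]_(t in S) (p t * expR (m%:R * t)))%R = 0) ->
  forall (n : nat) (x : R),
  (\int[mu]_(t in S) (p t * expR (- expR (n%:R * (t - x)))))%R = 0.
Proof.
move=> ip p0 n x.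
have mp : measurable_fun S p by have /measurable_int/measurable_EFinP := ip.
pose q (N : nat) t := p t * series (exp_coeff (- expR (n%:R * (t - x)))) N.
have qE N t : q N t = \sum_(0 <= k < N)
    ((-1) ^+ k * expR (- (n%:R * x)) ^+ k / k`!%:R) * (p t * expR ((k * n)%:R * t)).
  rewrite /q /series /= mulr_sumr; apply: eq_bigr => k _.
  have -> : expR ((k * n)%:R * t) = expR (n%:R * t) ^+ k.
    by rewrite natrM -mulrA expRM_natl.
  have -> : expR (n%:R * (t - x)) = expR (- (n%:R * x)) * expR (n%:R * t).
    by rewrite -expRD; congr expR; ring.
  by rewrite /exp_coeff /= [in LHS]exprNn [in LHS]exprMn; ring.
have q0 N : mu.-integrable S (EFin \o q N) /\ (\int[mu]_(t in S) q N t)%R = 0.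
  rewrite /comp; under eq_fun do rewrite qE; under eq_Rintegral do rewrite qE.
  elim: N => [|N [IH1 IH2]].
    under eq_Rintegral do rewrite big_nil; rewrite /Rintegral integral0.
    by split => //; under eq_fun do rewrite big_nil; exact: integrable0.
  have iN := integrable_expM (N * n)%:R ip.
  have iZ : mu.-integrable S (EFin \o (fun t => ((-1) ^+ N * expR (- (n%:R * x)) ^+ N / N`!%:R) *
      (p t * expR ((N * n)%:R * t)))).
    have := integrableZl mS ((-1) ^+ N * expR (- (n%:R * x)) ^+ N / N`!%:R) iN.
    by apply: eq_integrable => // t _ /=.
  under eq_Rintegral do rewrite big_nat_recr //=.
  rewrite RintegralD // IH2 RintegralZl // p0 mulr0 addr0; split => //.
  have := integrableD mS IH1 iZ; apply: eq_integrable => // t _ /=.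
  by rewrite big_nat_recr.
have : (\int[mu]_(t in S) q N t)%R @[N --> \oo] -->
    (\int[mu]_(t in S) (p t * expR (- expR (n%:R * (t - x)))))%R.
  apply: (@dominated_Rintegral_cvg _ _
    (fun t => `|p t| * expR (expR (n%:R * (M + `|x|))))).
  - by move=> N; have [/measurable_int/measurable_EFinP] := q0 N.
  - move=> t St; rewrite /q; apply: cvgM; first exact: cvg_cst.
    exact: is_cvg_series_exp_coeff.
  - have := integrableZr mS (expR (expR (n%:R * (M + `|x|)))) (integrable_norm ip).
    by apply: eq_integrable => // t _ /=.
  - move=> N t St; rewrite normrM ler_wpM2l //.
    set X := expR _; have X0 : 0 <= X by exact: expR_ge0.
    apply: (@le_trans _ _ (series (exp_coeff X) N)).
      rewrite /series /= (le_trans (ler_norm_sum _ _ _)) //.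
      apply: ler_sum => k _; rewrite /exp_coeff /= normrM normrX normrN.
      by rewrite !ger0_norm.
    apply: (@le_trans _ _ (expR X)).
      apply: nondecreasing_cvgn_le; last exact: is_cvg_series_exp_coeff.
      by apply/nondecreasing_seqP => k; rewrite /series /= big_nat_recr //= lerDl exp_coeff_ge0.
    rewrite ler_expR ler_expR ler_wpM2l // lerD //.
      by rewrite (le_trans (ler_norm _)) // SM.
    by rewrite -normrN ler_norm.
under eq_fun do rewrite (q0 _).2.
by move=> /cvg_lim <- //; rewrite lim_cst.
Qed.

(** As n grows, exp (- exp (n (t - x))) tends to 1, e^-1 or 0 according as t is below, at or above
    x, and it stays in [0, 1], so that |p| dominates. *)
Lemma step_orthogonal (p : R -> R) : mu.-integrable S (EFin \o p) ->
  (forall m : nat, (\int[mu]_(t in S) (p t * expR (m%:R * t)))%R = 0) ->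
  forall x : R, (\int[mu]_(t in S)
    (p t * (if t < x then 1 else if t == x then expR (- 1) else 0)))%R = 0.
Proof.
move=> ip p0 x.
have mp : measurable_fun S p by have /measurable_int/measurable_EFinP := ip.
have : (\int[mu]_(t in S) (p t * expR (- expR (n%:R * (t - x)))))%R @[n --> \oo] -->
    (\int[mu]_(t in S)
    (p t * (if t < x then 1 else if t == x then expR (- 1) else 0)))%R.
  apply: (@dominated_Rintegral_cvg _ _ (fun t => `|p t|)).
  - move=> n; apply: measurable_funM => //; apply: measurableT_comp => //.
    apply: measurableT_comp => //; apply: measurableT_comp => //.
    by apply: measurable_funM => //; exact: measurable_funB.
  - move=> t St; apply: cvgM; first exact: cvg_cst.
    case: ltgtP => tx.
    + have -> : (fun n => expR (- expR (n%:R * (t - x)))) =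
          (fun n => expR (- (expR (t - x) ^+ n))).
        by apply: funext => n; rewrite expRM_natl.
      rewrite -[X in _ --> X]expR0 -oppr0.
      apply: continuous_cvg; first exact: continuous_expR.
      apply: cvgN; apply: cvg_expr.
      by rewrite ger0_norm ?expR_ge0 // expR_lt1 subr_lt0.
    + have c0 : (fun n => expR (x - t) ^+ n) @ \oo --> (0 : R).
        by apply: cvg_expr; rewrite ger0_norm ?expR_ge0 // expR_lt1 subr_lt0.
      apply: (squeeze_cvgr _ (cvg_cst 0) c0).
      apply: nearW => n; rewrite expR_ge0 /= -expRM_natl ler_expR.
      rewrite lerNl (le_trans _ (expR_ge1Dx _)) // -mulrN opprB.
      by rewrite lerDr.
    + rewrite tx subrr; under eq_fun do rewrite mulr0 expR0; exact: cvg_cst.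
  - exact: integrable_norm.
  - move=> n t St; rewrite normrM -[leRHS]mulr1 ler_wpM2l //.
    by rewrite ger0_norm ?expR_ge0 // expR_le1 oppr_le0 expR_ge0.
under eq_fun do rewrite expexp_orthogonal //.
by move=> /cvg_lim <- //; rewrite lim_cst.
Qed.

(** Up to the null set t = x, the preceding lemma says that the integral of [p] up to every x is
    zero; Lebesgue's differentiation theorem then recovers [p] almost everywhere. *)
Lemma ae_eq0_of_exp_orthogonal (p : R -> R) : mu.-integrable S (EFin \o p) ->
  (forall m : nat, (\int[mu]_(t in S) (p t * expR (m%:R * t)))%R = 0) ->
  {ae mu, forall t, S t -> p t = 0}.
Proof.
move=> ip p0; set q := p \_ S.
have iq : mu.-integrable setT (EFin \o q).
  by rewrite /q -restrict_EFin; apply/(integrable_mkcond _ mS).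
have iqy y : mu.-integrable `]-oo, y] (EFin \o q).
  by apply: integrableS iq.
have F0 x : (\int[mu]_(t in [set` `]-oo, x]]) (q t))%R = 0.
  rewrite Rintegral_mkcond /q.
  transitivity (\int[mu]_(t in S) (p t * (if t <= x then 1 else 0)))%R.
    rewrite [RHS]Rintegral_mkcond; apply: eq_Rintegral => t _.
    rewrite !patchE; case: ifPn => [/set_mem /=|/negP tx].
      by rewrite in_itv /= => ->; rewrite mulr1.
    case: ifPn => // _; case: ifPn => [tx'|]; last by rewrite mulr0.
    by case: tx; rewrite mem_set //= in_itv.
  rewrite -[RHS](step_orthogonal ip p0 x); congr fine.
  have mp : measurable_fun S p by have /measurable_int/measurable_EFinP := ip.
  apply: ae_eq_integral => //.
  - apply/measurable_EFinP; apply: measurable_funM => //.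
    have -> : (fun t => if t <= x then 1 else 0) = \1_`]-oo, x] :> (R -> R).
      by apply: funext => t; rewrite indicE mem_setE in_itv /=; case: ifP.
    exact: measurable_indic.
  - apply/measurable_EFinP; apply: measurable_funM => //.
    have -> : (fun t => if t < x then 1 else if t == x then expR (- 1) else 0) =
        (fun t => \1_`]-oo, x[ t + expR (-1) * \1_[set x] t) :> (R -> R).
      apply: funext => t; rewrite !indicE mem_setE in_itv /=.
      case: ltgtP => [tx|tx|->].
      + by rewrite memNset ?mulr0 ?addr0 // => /= tx'; rewrite tx' ltxx in tx.
      + by rewrite memNset ?mulr0 ?addr0 // => /= tx'; rewrite tx' ltxx in tx.
      + by rewrite mem_set // mulr1 add0r.
    apply: measurable_funD; first exact: measurable_indic.
    by apply: measurable_funM => //; exact: measurable_indic.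
  - exists [set x]; split => //; first exact: lebesgue_measure_set1.
    move=> t /= nt; apply: contrapT => tx; apply: nt => _.
    by have [//|//|/tx] := ltgtP t x.
have locq : locally_integrable setT q by apply: integrable_locally => //; exact: openT.
have := FTC1Ny iqy locq.
apply: filterS; first exact: (ae_filter_ringOfSetsType mu).
move=> t [_]; rewrite (_ : (fun x => _) = cst 0); last exact: funext.
by rewrite derive1_cst /q patchE => -> St; rewrite mem_set.
Qed.

Lemma integrable_cst_bounded (k : R) : mu.-integrable S (EFin \o cst k).
Proof.
have i : mu.-integrable `[- M, M] (EFin \o cst k).
  apply: continuous_compact_integrable; first exact: segment_compact.
  by apply: continuous_subspaceT => t; exact: cvg_cst.
apply: (integrableS _ mS _ i) => //.
by move=> t /SM; rewrite /= in_itv /= ler_norml.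
Qed.

Lemma square_integrable_bounded (phi : R -> C) (k : R) :
  measurable_fun S (fun t => Re (phi t)) ->
  measurable_fun S (fun t => Im (phi t)) ->
  (forall t, S t -> normc (phi t) <= k) -> square_integrable S phi.
Proof.
move=> m1 m2 le.
apply: (square_integrable_le mS m1 m2 (integrable_cst_bounded (k ^+ 2))).
move=> t St; rewrite ler_sqr ?nnegrE ?normc_ge0 ?le //.
exact: le_trans (normc_ge0 _) (le t St).
Qed.

Lemma square_integrable_cexpi z : square_integrable S (cexpi z).
Proof.
apply: (@square_integrable_bounded _ (expR (`|Im z| * M))).
- exact: measurable_Re_cexpi.
- exact: measurable_Im_cexpi.
move=> t St; rewrite normc_cexpi ler_expR.
apply: le_trans (ler_norm _) _; rewrite normrM normrN.
by apply: ler_wpM2l => //; exact: SM.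
Qed.

(** Only the points z = -im with m a natural number are used: there e^{izt} = e^{mt} is real, so the
    real and imaginary parts of [phi] can be treated separately. *)
Lemma fourier_injective (phi : R -> C) : square_integrable S phi ->
  (forall z, cintegral S (fun t => phi t * cexpi z t) = 0) -> sqn S phi = 0.
Proof.
move=> sq phi0.
have [iR iI] : cintegrable S phi.
  have := cintegrableM mS sq (square_integrable_cexpi 0).
  by under eq_fun do rewrite cexpi0 mulr1.
have E m t : phi t * cexpi (- 'i * m%:R) t =
    (Re (phi t) * expR (m%:R * t)) +i* (Im (phi t) * expR (m%:R * t)).
  rewrite /cexpi /cexp (_ : 'i * (- 'i * m%:R) * t%:C = (m%:R * t)%:C).
    by apply: complexP; rewrite ?ReM ?ImM /= ?cos0 ?sin0; ring.
  rewrite rmorphM rmorph_nat; congr (_ * _); rewrite mulrA mulrN -expr2 sqr_i.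
  by rewrite opprK mul1r.
have R0 : {ae mu, forall t, S t -> Re (phi t) = 0}.
  apply: ae_eq0_of_exp_orthogonal => // m.
  have := congr1 (@complex.Re R) (phi0 (- 'i * m%:R)).
  by rewrite /=; under eq_Rintegral do rewrite E.
have I0 : {ae mu, forall t, S t -> Im (phi t) = 0}.
  apply: ae_eq0_of_exp_orthogonal => // m.
  have := congr1 (@complex.Im R) (phi0 (- 'i * m%:R)).
  by rewrite /=; under eq_Rintegral do rewrite E.
have [_ _ i3] := sq.
rewrite /sqn /Rintegral (_ : (\int[mu]_(t in S) _)%E = (\int[mu]_(t in S) (cst 0) t)%E).
  by rewrite integral0.
apply: ae_eq_integral => //; first exact: measurable_int i3.
apply: (@filterS2 _ _ (ae_filter_ringOfSetsType mu) _ _ _ _ R0 I0).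
by move=> t r0 i0 St; rewrite normc2E r0 // i0 // expr0n addr0.
Qed.

End Injectivity.

(** * Total families span densely *)

Section Density.
Context {R : realType}.
Local Notation C := R[i].
Variable S : set R.
Hypothesis mS : measurable (S : set (measurableTypeR R)).

Lemma parallelogram (phi psi : R -> C) :
  square_integrable S phi -> square_integrable S psi ->
  sqn S (fun t => phi t - psi t) + sqn S (fun t => phi t + psi t) =
  2 * sqn S phi + 2 * sqn S psi.
Proof.
move=> p q; have q' := square_integrableZ mS (-1) q.
rewrite (_ : (fun t => phi t - psi t) = fun t => phi t + -1 * psi t); last first.
  by apply: funext => t; rewrite mulN1r.
rewrite !sqnD // sqnZ // normcN normc1 expr1n mul1r.
rewrite (_ : cintegral S (fun t => phi t * conjc (-1 * psi t)) =
   -1 * cintegral S (fun t => phi t * conjc (psi t))).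
  by rewrite mulN1r ReN; ring.
rewrite -(cintegralZ mS _ (cintegrableM mS p (square_integrable_conj mS q))).
by apply: eq_cintegral => t _; rewrite !mulN1r conjN mulrN.
Qed.

(** The projection theorem for a subspace [V] that need not be closed: a minimizing sequence is
    Cauchy, its limit leaves a residual orthogonal to [V], and totality makes that residual zero. *)
Lemma dense_of_total (V : (R -> C) -> Prop) :
  (forall v, V v -> square_integrable S v) -> V (fun=> 0) ->
  (forall u v c, V u -> V v -> V (fun t => u t + c * v t)) ->
  (forall psi, square_integrable S psi ->
     (forall v, V v -> cintegral S (fun t => psi t * v t) = 0) ->
     sqn S psi = 0) ->
  forall phi, square_integrable S phi -> forall e, 0 < e ->
  exists2 v, V v & nrm S (fun t => phi t - v t) <= e.
Proof.
move=> Vsq V0 VD tot phi sphi e e0.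
pose D := [set sqn S (fun t => phi t - v t) | v in V].
have D0 : D !=set0 by exists (sqn S (fun t => phi t - 0)), (fun=> 0).
have Dlb : lbound D 0 by move=> _ [v _ <-]; exact: sqn_ge0.
have hD : has_inf D by split => //; exists 0.
have dle v : V v -> inf D <= sqn S (fun t => phi t - v t).
  by move=> Vv; apply: ge_inf; [exists 0|exists v].
have /choice[u uP] : forall n : nat, exists v, V v /\
    sqn S (fun t => phi t - v t) < inf D + (n.+1%:R)^-1.
  move=> n; have [|_ [v Vv <-] lt] := @inf_adherent _ D (n.+1%:R)^-1 _ hD.
    by rewrite invr_gt0.
  by exists v.
have Vu n := (uP n).1; have ult n := (uP n).2.
have su n := Vsq _ (Vu n).
have sd v : V v -> square_integrable S (fun t => phi t - v t).
  by move=> Vv; apply: square_integrableB => //; exact: Vsq.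
(* The midpoint of two elements of [V] is at squared distance at least [inf D] from [phi]; the
   parallelogram law then bounds their mutual distance by the two excesses. *)
have close m n : sqn S (fun t => u m t - u n t) <=
    2 * (m.+1%:R)^-1 + 2 * (n.+1%:R)^-1.
  have := parallelogram (sd _ (Vu n)) (sd _ (Vu m)).
  rewrite (_ : (fun t => _ - _ - _) = fun t => u m t - u n t); last first.
    by apply: funext => t; ring.
  have Vm : V (fun t => 2^-1 * u m t + 2^-1 * u n t).
    have -> : (fun t => 2^-1 * u m t + 2^-1 * u n t) =
              fun t => (0 + 2^-1 * u m t) + 2^-1 * u n t.
      by apply: funext => t; rewrite add0r.
    by apply: (VD (fun t => 0 + 2^-1 * u m t)) => //; exact: (VD (fun=> 0)).
  rewrite (_ : (fun t => phi t - u n t + _) =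
     fun t => 2 * (phi t - (2^-1 * u m t + 2^-1 * u n t))); last first.
    by apply: funext => t; field.
  rewrite sqnZ //; last exact: sd.
  have -> : normc (2 : C) = 2.
    by rewrite -(rmorph_nat (real_complex R)) normc_real ger0_norm.
  have := dle _ Vm; have := ult m; have := ult n.
  move: (n.+1%:R^-1) (m.+1%:R^-1) => x y; rewrite expr2; lra.
have archi (x : R) : 0 < x -> exists N, forall n, (N <= n)%N -> (n.+1%:R)^-1 <= x.
  move=> x0; exists (Num.truncn x^-1) => n nN.
  rewrite -[leRHS]invrK lef_pV2 ?posrE ?invr_gt0 //.
  by rewrite ltW // (lt_le_trans (truncnS_gt _)) // ler_nat ltnS.
have [|u0 su0 lim] := @L2_complete R S mS u su.
  move=> x x0; have [|N NP] := archi (x ^+ 2 / 4); first by rewrite divr_gt0 ?exprn_gt0.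
  exists N => m n /NP + /NP.
  move: (m.+1%:R^-1) (n.+1%:R^-1) (close m n) => A B cl mN nN.
  rewrite -ler_sqr ?nnegrE ?nrm_ge0 ?(ltW x0) // nrm2.
  by apply: le_trans cl _; lra.
have orth v : V v -> cintegral S (fun t => conjc (phi t - u0 t) * v t) = 0.
  move=> Vv; have sv := Vsq v Vv.
  have svc := square_integrable_conj mS sv.
  have s0 : square_integrable S (fun t => phi t - u0 t) by exact: square_integrableB.
  suff z : normc (cintegral S (fun t => (phi t - u0 t) * conjc (v t))) = 0.
    have := congr1 conjc (eq0_normc z); rewrite conjc0.
    rewrite -(cintegral_conj mS (cintegrableM mS s0 svc)) => <-.
    by apply: eq_cintegral => t _; rewrite conjM conjcK.
  (* The limit [u0] need not lie in [V], so minimality is used at [u n]: moving [u n] along [v]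
     cannot gain more than its excess over [inf D]. *)
  have small n : normc (cintegral S (fun t => (phi t - u n t) * conjc (v t))) ^+ 2 <=
      (n.+1%:R)^-1 * sqn S v.
    set al := cintegral _ _; set a := fun t => phi t - u n t.
    have sa : square_integrable S a by exact: sd.
    apply: le_trans (_ : (sqn S a - inf D) * sqn S v <= _); last first.
      by apply: ler_wpM2r; rewrite ?sqn_ge0 // lerBlDl; exact: ltW (ult n).
    apply: quadratic_ge0_le => [||x]; rewrite ?sqr_ge0 ?sqn_ge0 //.
    have := dle _ (VD _ _ (x%:C * al) (Vu n) Vv).
    rewrite (_ : (fun t => _ - _) = fun t => a t + - (x%:C * al) * v t); last first.
      by apply: funext => t; rewrite /a; ring.
    have sz := square_integrableZ mS (- (x%:C * al)) sv.
    rewrite sqnD // sqnZ // normcN normcM normc_real exprMn real_normK ?num_real //.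
    rewrite (_ : cintegral S _ = - conjc (x%:C * al) * al); last first.
      transitivity (cintegral S (fun t => - conjc (x%:C * al) * (a t * conjc (v t)))).
        by apply: eq_cintegral => t _; rewrite !conjM !conjN !conjM; ring.
      exact: (cintegralZ mS _ (cintegrableM mS sa svc)).
    rewrite (_ : Re _ = - x * normc al ^+ 2); last first.
      by rewrite normc2E; case: (al) => p q /=; ring.
    by rewrite -subr_ge0; congr (_ <= _); ring.
  apply/eqP; rewrite eq_le normc_ge0 andbT; apply/ler_addgt0Pl => x x0; rewrite addr0.
  have nv := nrm_ge0 S v.
  have nv1 : 0 < nrm S v + 1 by lra.
  have [y y0 xE] : exists2 y, 0 < y & x = y * (nrm S v + 1) * 2.
    exists (x / 2 / (nrm S v + 1)); first by rewrite !divr_gt0.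
    by field; rewrite gt_eqF.
  have [N1 N1P] := lim y y0.
  have [N2 N2P] := archi (y ^+ 2) (exprn_gt0 2 y0).
  pose n := (N1 + N2)%N.
  have l1 := N1P n (leq_addr _ _); have l2 := N2P n (leq_addl _ _).
  have sdiff : square_integrable S (fun t => u n t - u0 t) by exact: square_integrableB.
  rewrite (_ : cintegral S _ = cintegral S (fun t => (phi t - u n t) * conjc (v t)) +
     cintegral S (fun t => (u n t - u0 t) * conjc (v t))); last first.
    rewrite -cintegralD //; [|exact: cintegrableM (sd _ (Vu n)) svc|exact: cintegrableM].
    by apply: eq_cintegral => t _; ring.
  apply: le_trans (normcD _ _) _.
  have b1 : normc (cintegral S (fun t => (phi t - u n t) * conjc (v t))) <= y * nrm S v.
    rewrite -ler_sqr ?nnegrE ?normc_ge0 ?mulr_ge0 ?(ltW y0) //.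
    apply: le_trans (small n) _; rewrite exprMn nrm2.
    by rewrite ler_wpM2r ?sqn_ge0.
  have b2 := normc_pairing_le mS sdiff svc; rewrite nrm_conj in b2.
  have b3 : nrm S (fun t => u n t - u0 t) * nrm S v <= y * nrm S v by rewrite ler_wpM2r.
  apply: le_trans (lerD b1 (le_trans b2 b3)) _.
  rewrite xE; nra.
have n0 : nrm S (fun t => phi t - u0 t) = 0.
  have := tot _ (square_integrable_conj mS (square_integrableB mS sphi su0)) orth.
  by rewrite sqn_conj /nrm => ->; rewrite sqrtr0.
have [N NP] := lim e e0.
exists (u N) => //.
apply: le_trans (nrm_triangle mS sphi (su N) su0) _.
by rewrite n0 add0r nrmBC NP.
Qed.

End Density.

(** * The change of variable t -> c - t *)

Section Reflection.
Context {R : realType}.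
Local Notation C := R[i].
Local Notation mu := (@lebesgue_measure R).
Variable c : R.
Let refl (t : measurableTypeR R) : measurableTypeR R := c - t.

Let measurable_refl : measurable_fun setT refl.
Proof. exact: measurable_funB. Qed.

Lemma lebesgue_measure_reflect A : measurable (A : set (measurableTypeR R)) ->
  mu A = pushforward mu refl A.
Proof.
apply: lebesgue_measure_unique => X [[x y] /= xy <-].
rewrite /pushforward (_ : refl @^-1` _ = `[c - y, c - x[%classic).
  rewrite !lebesgue_measure_itv /= !lte_fin ltrD2l ltrN2.
  by case: ifP => // _; rewrite -!EFinB; congr _%:E; ring.
apply/seteqP; split => t /=; rewrite !in_itv /= /refl;
  move=> /andP[h1 h2]; apply/andP; split; lra.
Qed.

Lemma integral_reflect D (f : R -> \bar R) :
  measurable (D : set (measurableTypeR R)) -> measurable_fun D f ->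
  (\int[mu]_(t in D) f t = \int[mu]_(t in refl @^-1` D) f (refl t))%E.
Proof.
move=> mD mf.
have pos (g : R -> \bar R) : measurable_fun D g -> (forall t, 0 <= g t)%E ->
    (\int[mu]_(t in D) g t = \int[mu]_(t in refl @^-1` D) g (refl t))%E.
  move=> mg g0; rewrite -(ge0_integral_pushforward measurable_refl) //.
  apply: eq_measure_integral => A mA _; exact: lebesgue_measure_reflect.
rewrite integralE [RHS]integralE; congr (_ - _)%E.
- rewrite (pos (f^\+)%E (measurable_funepos mf) (funepos_ge0 f)).
  by apply: eq_integral => t _; exact: (congr1 (fun g => g t) (esym (funepos_comp f refl))).
- rewrite (pos (f^\-)%E (measurable_funeneg mf) (funeneg_ge0 f)).
  by apply: eq_integral => t _; exact: (congr1 (fun g => g t) (esym (funeneg_comp f refl))).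
Qed.

Lemma Rintegral_reflect D (f : R -> R) :
  measurable (D : set (measurableTypeR R)) -> measurable_fun D f ->
  (\int[mu]_(t in D) f t = \int[mu]_(t in refl @^-1` D) f (refl t))%R.
Proof.
by move=> mD mf; congr fine; apply: integral_reflect => //; exact/measurable_EFinP.
Qed.

Lemma measurable_fun_reflect D (f : R -> R) :
  measurable (D : set (measurableTypeR R)) -> measurable_fun D f ->
  measurable_fun (refl @^-1` D) (fun t => f (c - t)).
Proof.
move=> mD mf.
apply: (measurable_comp mD _ mf) => //; first by move=> _ [t Dt <-].
exact: measurable_funTS.
Qed.

Lemma integrable_reflect D (f : R -> R) :
  measurable (D : set (measurableTypeR R)) -> mu.-integrable D (EFin \o f) ->
  mu.-integrable (refl @^-1` D) (EFin \o (fun t => f (c - t))).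
Proof.
move=> mD /integrableP[/measurable_EFinP mf lt]; apply/integrableP; split.
  by apply/measurable_EFinP; exact: measurable_fun_reflect.
move: lt; rewrite integral_reflect //.
by do 2 apply: measurableT_comp => //.
Qed.

End Reflection.

Section ReflectionInterval.
Context {R : realType}.
Local Notation C := R[i].
Variables a b : R.

Lemma preimage_reflect_itv :
  (fun t => (a + b) - t) @^-1` `[a, b] = `[a, b]%classic :> set R.
Proof.
apply/seteqP; split => t /=; rewrite !in_itv /=;
  move=> /andP[h1 h2]; apply/andP; split; lra.
Qed.

Lemma square_integrable_reflect (phi : R -> C) :
  square_integrable `[a, b] phi ->
  square_integrable `[a, b] (fun t => phi (a + b - t)).
Proof.
move=> [p1 p2 p3]; rewrite -preimage_reflect_itv; split.
- exact: (measurable_fun_reflect (f := fun t => Re (phi t))).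
- exact: (measurable_fun_reflect (f := fun t => Im (phi t))).
- exact: (@integrable_reflect R (a + b) _ (fun t => normc (phi t) ^+ 2)).
Qed.

Lemma cintegral_reflect (h : R -> C) : cintegrable `[a, b] h ->
  cintegral `[a, b] (fun t => h (a + b - t)) = cintegral `[a, b] h.
Proof.
move=> [/measurable_int/measurable_EFinP i1 /measurable_int/measurable_EFinP i2].
apply: complexP => /=.
- rewrite [RHS](Rintegral_reflect (a + b)) //.
  by rewrite [in RHS]preimage_reflect_itv.
- rewrite [RHS](Rintegral_reflect (a + b)) //.
  by rewrite [in RHS]preimage_reflect_itv.
Qed.

Lemma sqn_reflect (phi : R -> C) : square_integrable `[a, b] phi ->
  sqn `[a, b] (fun t => phi (a + b - t)) = sqn `[a, b] phi.
Proof.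
move=> [_ _ /measurable_int/measurable_EFinP p].
rewrite [RHS](Rintegral_reflect (a + b)) //.
by rewrite [in RHS]preimage_reflect_itv.
Qed.

End ReflectionInterval.

(** * Square-summable data and uniform boundedness *)

Section Ell2.
Context {R : realType}.
Local Notation C := R[i].
Implicit Types (G : set C) (a : C -> C) (s : seq C).

(** [esum] is a supremum over finite sets; this lemma and its converse reduce square summability to
    bounds on sums over duplicate-free sequences. *)
Lemma ell2_of_bounded G a (K : R) :
  (forall s, uniq s -> (forall l, l \in s -> G l) ->
    \sum_(l <- s) normc (a l) ^+ 2 <= K) -> ell2 G a.
Proof.
move=> bd; apply: (@le_lt_trans _ _ K%:E); last exact: ltry.
apply: ge_ereal_sup => _ [A [fA AG] <-].
rewrite fsbig_finite //= sumEFin lee_fin; apply: bd => [|l].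
  exact: finmap.fset_uniq.
by rewrite in_fset_set // inE => /AG.
Qed.

Lemma bounded_of_ell2 G a : ell2 G a -> exists2 K : R, 0 <= K &
  forall s, uniq s -> (forall l, l \in s -> G l) ->
    \sum_(l <- s) normc (a l) ^+ 2 <= K.
Proof.
rewrite /ell2; set x := esum _ _ => xlt.
have x0 : (0 <= x)%E by apply: esum_ge0 => l _; rewrite lee_fin sqr_ge0.
have xf : x \is a fin_num by rewrite ge0_fin_numE.
exists (fine x); first exact: fine_ge0.
move=> s us sG; rewrite -lee_fin fineK // -sumEFin.
rewrite (fsbig_seq _ _ us); apply: ereal_sup_ubound.
by exists [set` s] => //; split; [exact: finite_seq|move=> l; exact: sG].
Qed.

End Ell2.

Lemma normc_sum (R : realType) (I : Type) (s : seq I) (f : I -> R[i]) :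
  normc (\sum_(i <- s) f i) <= \sum_(i <- s) normc (f i).
Proof.
elim: s => [|i s IH]; first by rewrite !big_nil normc0.
by rewrite !big_cons (le_trans (normcD _ _)) // lerD2l.
Qed.

Lemma normc_le_addB (R : realType) (z w : R[i]) :
  normc z <= normc w + normc (z - w).
Proof. by apply: le_trans (normcD _ _); rewrite addrC subrK. Qed.

Lemma finite_cauchy_schwarz (R : realType) (I : Type) (s : seq I) (f g : I -> R) :
  (\sum_(i <- s) f i * g i) ^+ 2 <=
  (\sum_(i <- s) f i ^+ 2) * (\sum_(i <- s) g i ^+ 2).
Proof.
apply: quadratic_ge0_le => [||x]; first exact: sqr_ge0.
  by apply: sumr_ge0 => i _; exact: sqr_ge0.
set n := \sum_(i <- s) f i * g i.
have -> : \sum_(i <- s) f i ^+ 2 - 2 * x * n ^+ 2 +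
    x ^+ 2 * n ^+ 2 * (\sum_(i <- s) g i ^+ 2) =
    \sum_(i <- s) (f i - x * n * g i) ^+ 2.
  under [RHS]eq_bigr do rewrite sqrrB exprMn.
  rewrite !big_split /= sumrN -mulr_sumr; congr (_ - _ + _); last by rewrite exprMn.
  rewrite (eq_bigr (fun i => (2 * x * n) * (f i * g i))); last by move=> i _; ring.
  by rewrite -mulr_sumr -/n; ring.
by apply: sumr_ge0 => i _; exact: sqr_ge0.
Qed.

Section UniformBoundedness.
Context {R : realType}.
Local Notation C := R[i].
Implicit Types (G : set C) (a : C -> C) (s : seq C).

(* The gliding hump: [x = \sum_n sg n * 4^-n * b n] with [sg n] in {0, 1} chosen
   so that the functional of index n is at least 4^-n / 2 on the partial sum
   following the n-th step; the remaining steps change it by at most 4^-n / 3. *)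
Lemma ell2_uniform_boundedness G (b : nat -> C -> C) (t : nat -> seq C) :
  (forall n, uniq (t n)) ->
  (forall n l, l \in t n -> G l) ->
  (forall n, \sum_(l <- t n) normc (b n l) ^+ 2 = 1) ->
  exists2 x, ell2 G x &
    forall n, (4 ^+ n)^-1 / 12 <= normc (\sum_(l <- t n) conjc (b n l) * x l).
Proof.
move=> ut tG b1.
pose d n l := if l \in t n then b n l else 0.
pose f n (x : C -> C) := \sum_(l <- t n) conjc (b n l) * x l.
pose e n : R := (4 ^+ n)^-1.
have e0 n : 0 < e n by rewrite invr_gt0 exprn_gt0.
have eS n : e n.+1 = e n / 4 by rewrite /e exprS invfM mulrC.
have fB n x y : f n (fun l => x l - y l) = f n x - f n y.
  by rewrite /f -sumrB; apply: eq_bigr => l _; rewrite mulrBr.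
have fDZ n x y c : f n (fun l => x l + c * y l) = f n x + c * f n y.
  rewrite /f mulr_sumr -big_split /=; apply: eq_bigr => l _; ring.
have fd n : f n (d n) = 1.
  rewrite /f -[RHS](rmorph1 (real_complex R)) -(b1 n) rmorph_sum /=.
  apply: eq_big_seq => l lt; rewrite /d lt mulrC mulzJ.
  by rewrite rmorphXn.
have dA s n : uniq s -> \sum_(l <- s) normc (d n l) ^+ 2 <= 1.
  move=> us; rewrite -(b1 n).
  rewrite (bigID (fun l => l \in t n)) /= [X in _ + X]big1 ?addr0; last first.
    by move=> l /negbTE lt; rewrite /d lt normc0 expr0n.
  rewrite -big_filter (eq_big_seq (fun l => normc (b n l) ^+ 2)); last first.
    by move=> l; rewrite mem_filter /d => /andP[->].
  rewrite [leRHS](bigID (fun l => l \in s)) /= -[X in X + _]big_filter.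
  rewrite (perm_big [seq l <- t n | l \in s]) /=; last first.
    apply: uniq_perm; rewrite ?filter_uniq // => l.
    by rewrite !mem_filter andbC.
  by rewrite lerDl; apply: sumr_ge0 => l _; exact: sqr_ge0.
have fle n k : normc (f n (d k)) <= 1.
  rewrite -(@ler_sqr R) ?nnegrE ?normc_ge0 // expr1n.
  apply: le_trans (_ : (\sum_(l <- t n) normc (b n l) * normc (d k l)) ^+ 2 <= _).
    rewrite ler_sqr ?nnegrE ?normc_ge0 ?sumr_ge0 //; last first.
      by move=> l _; rewrite mulr_ge0 ?normc_ge0.
    apply: le_trans (normc_sum _ _) _; apply: ler_sum => l _.
    by rewrite normcM normc_conj.
  by apply: le_trans (finite_cauchy_schwarz _ _ _) _; rewrite b1 mul1r dA.
have d1 n l : normc (d n l) <= 1.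
  rewrite -(@ler_sqr R) ?nnegrE ?normc_ge0 // expr1n.
  by have := dA [:: l] n erefl; rewrite big_seq1.
pose step n (x : C -> C) := fun l => x l +
  (if normc (f n x) < e n / 2 then (e n)%:C else 0) * d n l.
pose X := fix X n := if n is m.+1 then step m (X m) else fun=> 0.
pose sg n : C := if normc (f n (X n)) < e n / 2 then (e n)%:C else 0.
have XS n l : X n.+1 l = X n l + sg n * d n l by [].
have sgle n : normc (sg n) <= e n.
  rewrite /sg; case: ifP => _; last by rewrite normc0 ltW.
  by rewrite normc_real ger0_norm // ltW.
have big n : e n / 2 <= normc (f n (X n.+1)).
  rewrite /= /step fDZ fd mulr1; case: ltP => [lt|]; last by rewrite addr0.
  have := normcD (f n (X n) + (e n)%:C) (- f n (X n)).
  rewrite normcN (_ : _ + _ - _ = (e n)%:C); last by ring.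
  rewrite normc_real ger0_norm ?(ltW (e0 n)) //.
  move: (e n) (e0 n) lt => x x0; lra.
(* The term [4 * e] makes the induction exact: with j the last index, -4 e_j / 3 + e_j = -4 e_{j+1}
   / 3. *)
have tail n m : normc (f n (X (n.+1 + m)%N) - f n (X n.+1)) <=
    (e n - 4 * e (n.+1 + m)%N) / 3.
  elim: m => [|m IH].
    by rewrite addn0 subrr normc0 eS; move: (e n) (e0 n) => x x0; lra.
  have fe : f n (X (n.+1 + m.+1)%N) = f n (X (n.+1 + m)%N) + sg (n.+1 + m)%N * f n (d (n.+1 + m)%N).
    by rewrite addnS -fDZ.
  rewrite fe addrAC (le_trans (normcD _ _)) //.
  rewrite normcM; set j := (n.+1 + m)%N in IH *; rewrite addnS -/j eS.
  have p : normc (sg j) * normc (f n (d j)) <= e j * 1.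
    by apply: ler_pM => //; exact: normc_ge0.
  by move: (e j) IH p => z; lra.
have e2 n : e n <= (2 ^+ n)^-1.
  rewrite lef_pV2 ?posrE ?exprn_gt0 //; apply: lerXn2r; rewrite ?nnegrE //.
  by rewrite ler_nat.
have Xd n l : normc (X n.+1 l - X n l) <= e n.
  rewrite XS addrC addKr normcM -[leRHS]mulr1.
  by apply: ler_pM => //; exact: normc_ge0.
have Xcau n m l : normc (X (n + m)%N l - X n l) <= 4 / 3 * e n.
  suff : normc (X (n + m)%N l - X n l) <= 4 / 3 * (e n - e (n + m)%N).
    by have := e0 (n + m)%N; move: (e _) => y; lra.
  elim: m => [|m IH]; first by rewrite addn0 !subrr normc0 mulr0.
  rewrite addnS eS.
  have -> : X (n + m).+1 l - X n l = (X (n + m).+1 l - X (n + m)%N l) +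
     (X (n + m)%N l - X n l) by ring.
  apply: le_trans (normcD _ _) _.
  by have := Xd (n + m)%N l; move: IH; move: (e (n + m)%N) => y; lra.
have lim_part (g : C -> R) l : (forall z, `|g z| <= normc z) ->
    (forall z w, g (z - w) = g z - g w) ->
    exists L : R, forall n, `|L - g (X n l)| <= 4 / 3 * e n.
  move=> gle gB.
  have c : cvgn (fun n => g (X n l)).
    apply: (@cvgn_of_summable_steps R _ (fun=> 0)) => //; last by rewrite eseries0.
    move=> k; rewrite add0r -gB (le_trans (gle _)) // (le_trans (Xd k l)) //.
  exists (limn (fun n => g (X n l))) => n.
  apply/ler_addgt0Pl => x x0.
  have /cvgrPdist_le /(_ x x0) [N _ NP] := c.
  have := NP (N + n)%N (leq_addr _ _); rewrite /= => le1.
  have := le_trans (gle _) (Xcau n N l); rewrite gB addnC => le2.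
  rewrite (_ : limn _ - _ = (limn (fun n => g (X n l)) - g (X (N + n)%N l)) +
     (g (X (N + n)%N l) - g (X n l))); last by ring.
  by rewrite (le_trans (ler_normD _ _)) // lerD.
(* The real and imaginary parts are each off by at most 4/3 of 4^-n, and 8/3 <= 3. *)
have /choice[x xP] : forall l, exists z : C, forall n, normc (z - X n l) <= 3 * e n.
  move=> l.
  have [u uP] := lim_part (@complex.Re R) l (@Re_le_normc R) (@ReB R).
  have [v vP] := lim_part (@complex.Im R) l (@Im_le_normc R) (@ImB R).
  exists (u +i* v) => n.
  have -> : u +i* v - X n l = (u - Re (X n l))%:C + 'i * (v - Im (X n l))%:C.
    by apply: complexP; rewrite ?ReD ?ImD ?ReM ?ImM ?ReN ?ImN /=; ring.
  apply: le_trans (normcD _ _) _; rewrite normcM !normc_real.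
  rewrite (_ : normc 'i = 1); last by rewrite /= expr0n expr1n add0r sqrtr1.
  by have := uP n; have := vP n; have := e0 n; move: (e n) => y; lra.
have small (K : R) : 0 <= K -> forall y, 0 < y -> exists m, K * e m <= y.
  move=> K0 y y0; exists (Num.truncn (K / y)).+1; set m := _.+1.
  have lt1 : K / y < m%:R by exact: truncnS_gt.
  have lt2 : m%:R <= 4 ^+ m :> R by rewrite -natrX ler_nat ltnW // ltn_expl.
  rewrite /e ler_pdivrMr ?exprn_gt0 // mulrC -ler_pdivrMr //.
  by rewrite ltW // (lt_le_trans lt1).
exists x.
  (* The sum of all 4^-k is 4/3, and 7/3 = 1 + 4/3. From |x l| <= |X m l| + 3 * 4^-m comes the bound
     2 |X m l|^2 + 18 * 4^-m, and m is taken so large that the second terms add up to at most 2. *)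
  apply: (@ell2_of_bounded _ _ _ (2 * (7 / 3 * (4 / 3)) + 2)) => s us _.
  (* Cauchy-Schwarz with weights 4^-k, by induction; the first factor is 1 plus the sum of the
     weights, the 1 keeping it positive at n = 0. *)
  have XB n l : normc (X n l) ^+ 2 <= (1 + 4 / 3 * (1 - e n)) *
      \sum_(0 <= k < n) e k * normc (d k l) ^+ 2.
    elim: n => [|n IH]; first by rewrite big_nil mulr0 [X 0%N l]/= normc0 expr0n.
    rewrite big_nat_recr //= eS; set B := \sum_(_ <= _ < _) _ in IH *.
    have le : normc (X n.+1 l) <= normc (X n l) + e n * normc (d n l).
      rewrite XS (le_trans (normcD _ _)) // lerD2l normcM.
      by rewrite ler_wpM2r ?normc_ge0.
    have : normc (X n.+1 l) ^+ 2 <= (normc (X n l) + e n * normc (d n l)) ^+ 2.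
      rewrite ler_sqr ?nnegrE ?normc_ge0 // addr_ge0 ?normc_ge0 //.
      by rewrite mulr_ge0 ?normc_ge0 // ltW.
    move=> /le_trans; apply.
    have e1 : e n <= 1 by rewrite invf_le1 ?exprn_gt0 // exprn_ege1 // ler1n.
    move: IH (e0 n) e1; move: (e n) (normc (X n l)) (normc (d n l)) => y u v.
    move=> IH y0 y1; pose W := 1 + 4 / 3 * (1 - y).
    have W0 : 0 < W by rewrite /W; lra.
    have key : 0 <= W * v ^+ 2 - 2 * u * v + B.
      rewrite -(pmulr_rge0 _ W0); have := sqr_ge0 (W * v - u).
      by rewrite -/W in IH; rewrite sqrrB !expr2 in IH *; nra.
    rewrite (_ : 1 + 4 / 3 * (1 - y / 4) = W + y); last by rewrite /W; field.
    rewrite -/W in IH; have := mulr_ge0 (ltW y0) key; rewrite !expr2 in IH *; nra.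
  have XA n : \sum_(l <- s) normc (X n l) ^+ 2 <= 7 / 3 * (4 / 3).
    apply: le_trans (_ : \sum_(l <- s) 7 / 3 * \sum_(0 <= k < n) e k * normc (d k l) ^+ 2 <= _).
      apply: ler_sum => l _; apply: le_trans (XB n l) _; apply: ler_wpM2r.
        by apply: sumr_ge0 => k _; rewrite mulr_ge0 ?sqr_ge0 // ltW.
      by have := e0 n; lra.
    rewrite -mulr_sumr ler_wpM2l ?divr_ge0 // exchange_big /=.
    apply: le_trans (_ : \sum_(0 <= k < n) e k <= _).
      apply: ler_sum => k _; rewrite -mulr_sumr -[leRHS]mulr1 ler_wpM2l ?dA //.
      exact: ltW.
    suff -> : \sum_(0 <= k < n) e k = 4 / 3 * (1 - e n).
      by have := e0 n; lra.
    elim: n => [|n IH]; first by rewrite big_nil /e expr0 invr1 subrr mulr0.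
    by rewrite big_nat_recr //= IH eS; field.
  have [m mP] : exists m, 18 * (size s)%:R * e m <= 2 by apply: small => //; rewrite mulr_ge0.
  apply: le_trans (_ : \sum_(l <- s) (2 * normc (X m l) ^+ 2 + 18 * e m) <= _).
    apply: ler_sum => l _.
    have le : normc (x l) <= normc (X m l) + 3 * e m.
      by apply: le_trans (normc_le_addB _ (X m l)) _; rewrite lerD2l xP.
    have e1 : e m <= 1 by rewrite invf_le1 ?exprn_gt0 // exprn_ege1 // ler1n.
    have := e0 m; have := normc_ge0 (x l); have := normc_ge0 (X m l).
    move: le e1; move: (e m) (normc (x l)) (normc (X m l)) => y u v le y1 v0 u0 y0.
    apply: le_trans (_ : (v + 3 * y) ^+ 2 <= _).
      by rewrite ler_sqr ?nnegrE // addr_ge0 // mulr_ge0 // ltW.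
    by have := sqr_ge0 (v - 3 * y); rewrite !expr2; nra.
  rewrite big_split /= -mulr_sumr big_const_seq count_predT iter_addr_0 -mulr_natr.
  by have := XA m; move: mP; move: (e m) => y; lra.
move=> n; have [K K0 KP] : exists2 K : R, 0 <= K & forall m, normc (f n x - f n (X m)) <= K * e m.
  exists (\sum_(l <- t n) normc (b n l) * 3).
    by apply: sumr_ge0 => l _; rewrite mulr_ge0 ?normc_ge0.
  move=> m; rewrite -fB /f (le_trans (normc_sum _ _)) // mulr_suml.
  apply: ler_sum => l _; rewrite normcM normc_conj -mulrA ler_wpM2l ?normc_ge0 //.
(* 1/12 = 1/2 - 1/3 - 1/12: the hump, less the later steps, less the passage to the limit. *)
have [m mP] := small K K0 (e n / 12) (divr_gt0 (e0 n) (ltr0n _ 12)).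
have em : e (n.+1 + m)%N <= e m.
  by rewrite lef_pV2 ?posrE ?exprn_gt0 // ler_weXn2l ?ler1n // leq_addl.
have := normc_le_addB (f n (X n.+1)) (f n (X (n.+1 + m)%N)).
have := normc_le_addB (f n (X (n.+1 + m)%N)) (f n x).
rewrite -[normc (f n (X n.+1) - _)]normcN opprB.
rewrite -[normc (f n (X _) - f n x)]normcN opprB.
have := KP (n.+1 + m)%N; have := tail n m; have := big n; have := e0 (n.+1 + m)%N.
have KM : K * e (n.+1 + m)%N <= K * e m by rewrite ler_wpM2l.
rewrite -/(e n) -/(f n x); lra.
Qed.
End UniformBoundedness.

(** * Norm inequalities for interpolating and total systems of exponentials *)

Section ExponentialSystems.
Context {R : realType}.
Local Notation C := R[i].
Variable S : set R.
Hypothesis mS : measurable (S : set (measurableTypeR R)).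
Variable M : R.
Hypothesis SM : forall t, S t -> `|t| <= M.
Implicit Types (G : set C) (s : seq C) (c : C -> C) (w : C -> R).

Definition expsum s c (t : R) : C := \sum_(l <- s) c l * cexpi l t.

(** The existence half of complete interpolation in terms of spectra; [total] below is the
    uniqueness half. The weight is left free so that reflected systems are covered, where an
    exponential factor accompanies the kernel norm. *)
Definition interpolating G w : Prop := forall a, ell2 G a ->
  exists2 phi, square_integrable S phi &
    forall l, G l -> cintegral S (fun t => phi t * cexpi l t) = a l * (w l)%:C.

Definition total G : Prop := forall psi, square_integrable S psi ->
  (forall l, G l -> cintegral S (fun t => psi t * cexpi l t) = 0) ->
  sqn S psi = 0.

Lemma square_integrable_expsum s c : square_integrable S (expsum s c).
Proof.
apply: (square_integrable_sum mS s (h := fun l t => c l * cexpi l t)) => l.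
by apply: (square_integrableZ mS); exact: square_integrable_cexpi SM _.
Qed.

Lemma cintegral_expsum (phi : R -> C) s c : square_integrable S phi ->
  cintegral S (fun t => phi t * expsum s c t) =
  \sum_(l <- s) c l * cintegral S (fun t => phi t * cexpi l t).
Proof.
move=> sphi; have sc l := cintegrableM mS sphi (square_integrable_cexpi mS SM l).
transitivity (cintegral S (fun t => \sum_(l <- s) c l * (phi t * cexpi l t))).
  apply: eq_cintegral => t _; rewrite /expsum mulr_sumr.
  by apply: eq_bigr => l _; ring.
rewrite (cintegral_sum mS); last by move=> l; exact: cintegrableZ.
by apply: eq_bigr => l _; rewrite cintegralZ.
Qed.

Lemma expsum_dense G : total G -> forall phi, square_integrable S phi ->
  forall e, 0 < e -> exists s c, [/\ uniq s, forall l, l \in s -> G l &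
    nrm S (fun t => phi t - expsum s c t) <= e].
Proof.
move=> tot phi sphi e e0.
pose V (v : R -> C) := exists s c, [/\ uniq s, forall l, l \in s -> G l &
  v = expsum s c].
have [||||v [s [c [us sG ->]] le]] := @dense_of_total R S mS V _ _ _ _ phi sphi e e0.
- by move=> _ [s [c [_ _ ->]]]; exact: square_integrable_expsum.
- exists [::], (fun=> 0); split => //.
  by apply: funext => t; rewrite /expsum big_nil.
- move=> _ _ k [s1 [c1 [u1 G1 ->]]] [s2 [c2 [u2 G2 ->]]].
  exists (undup (s1 ++ s2)), (fun l => (if l \in s1 then c1 l else 0) +
    k * (if l \in s2 then c2 l else 0)); split; first exact: undup_uniq.
    by move=> l; rewrite mem_undup mem_cat => /orP[/G1|/G2].
  have aux (s' : seq C) (c' : C -> C) t : uniq s' ->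
      {subset s' <= s1 ++ s2} -> expsum s' c' t =
      \sum_(l <- undup (s1 ++ s2)) (if l \in s' then c' l else 0) * cexpi l t.
    move=> us' sub.
    rewrite [RHS](bigID (fun l => l \in s')) /= [X in _ + X]big1 ?addr0; last first.
      by move=> l /negbTE ->; rewrite mul0r.
    rewrite -[RHS]big_filter /expsum.
    rewrite [LHS](perm_big [seq l <- undup (s1 ++ s2) | l \in s']) /=; last first.
      apply: uniq_perm; rewrite ?filter_uniq ?undup_uniq // => l.
      rewrite mem_filter mem_undup; case: (boolP (l \in s')) => //= /sub ->.
      by [].
    by apply: eq_big_seq => l; rewrite mem_filter => /andP[-> _].
  apply: funext => t; rewrite (aux s1) // ?(aux s2) //.
  + rewrite mulr_sumr -big_split /=; apply: eq_bigr => l _; ring.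
  + by move=> l ls; rewrite mem_cat ls orbT.
  + by move=> l ls; rewrite mem_cat ls.
- move=> psi spsi orth; apply: tot => // l Gl.
  have := orth (expsum [:: l] (fun=> 1)).
  rewrite /expsum => <-.
    by apply: eq_cintegral => t _; rewrite big_seq1 mul1r.
  exists [:: l], (fun=> 1); split => // l'; rewrite inE => /eqP -> //.
- by exists s, c.
Qed.

(** If no [K] worked, there would be unit sequences whose exponential sums have norm at most 8^-n.
    The gliding hump yields square-summable data on which they act with size at least 4^-n / 12,
    whereas an interpolant of these data limits the action to 8^-n times its norm. *)
Lemma riesz_fischer G w : (forall l, G l -> 0 < w l) -> interpolating G w ->
  exists2 K : R, 0 < K & forall s c, uniq s -> (forall l, l \in s -> G l) ->
    \sum_(l <- s) (normc (c l) * w l) ^+ 2 <= K * sqn S (expsum s c).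
Proof.
move=> w0 int; apply: contrapT => nK.
have bad (n : nat) : exists sc : seq C * (C -> C),
    [/\ uniq sc.1, forall l, l \in sc.1 -> G l,
        \sum_(l <- sc.1) (normc (sc.2 l) * w l) ^+ 2 = 1 &
        nrm S (expsum sc.1 sc.2) <= (8 ^+ n)^-1].
  (* 64^n is the square of 8^n: a counterexample to the constant 64^n, once normalised, is the
     sequence wanted. *)
  apply: contrapT => nsc; apply: nK; exists (64 ^+ n); first exact: exprn_gt0.
  move=> s c us sG; rewrite leNgt; apply/negP => lt.
  apply: nsc; set A := \sum_(l <- s) _ in lt.
  have A0 : 0 < A by apply: le_lt_trans lt; rewrite mulr_ge0 ?sqn_ge0 ?exprn_ge0.
  have r0 : 0 < Num.sqrt A by rewrite sqrtr_gt0.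
  have rA : Num.sqrt A ^+ 2 = A by rewrite sqr_sqrtr // ltW.
  exists (s, fun l => ((Num.sqrt A)^-1)%:C * c l); split => //=.
    rewrite (eq_bigr (fun l => A^-1 * (normc (c l) * w l) ^+ 2)); last first.
      move=> l _; rewrite normcM normc_real ger0_norm ?invr_ge0 ?(ltW r0) //.
      by rewrite -mulrA exprMn exprVn rA.
    by rewrite -mulr_sumr mulVf // gt_eqF.
  rewrite (_ : expsum _ _ = fun t => ((Num.sqrt A)^-1)%:C * expsum s c t); last first.
    apply: funext => t; rewrite /expsum mulr_sumr.
    by apply: eq_bigr => l _; rewrite mulrA.
  rewrite (nrmZ mS _ (square_integrable_expsum s c)) normc_real.
  rewrite ger0_norm ?invr_ge0 ?(ltW r0) //.
  rewrite ler_pdivrMl // -ler_sqr ?nnegrE ?nrm_ge0 ?mulr_ge0 ?(ltW r0) ?invr_ge0 //.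
  rewrite nrm2 exprMn rA exprVn -exprM mulnC exprM ler_pdivlMr ?exprn_gt0 //.
  have -> : (8 : R) ^+ 2 = 64 by ring.
  by rewrite mulrC; exact: ltW.
have /choice[sc scP] := bad.
pose b n l := conjc ((sc n).2 l) * (w l)%:C.
have [|||x ex xP] := @ell2_uniform_boundedness R G b (fun n => (sc n).1).
- by move=> n; have [] := scP n.
- by move=> n; have [] := scP n.
- move=> n; have [_ _ <- _] := scP n; apply: eq_bigr => l _.
  rewrite /b normcM normc_conj normc_real !exprMn real_normK ?num_real //.
have [phi sphi phiP] := int x ex.
have le n : (4 ^+ n)^-1 / 12 <= nrm S phi * (8 ^+ n)^-1.
  have [_ sG _ small] := scP n.
  apply: le_trans (xP n) _.
  apply: le_trans (_ : _ <= nrm S phi * nrm S (expsum (sc n).1 (sc n).2)) _.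
    apply: le_trans (normc_pairing_le mS sphi (square_integrable_expsum _ _)).
    rewrite cintegral_expsum // le_eqVlt; apply/orP; left; apply/eqP; congr normc.
    apply: eq_big_seq => l /sG Gl; rewrite phiP // /b conjM conjcK conjc_real; ring.
  by rewrite ler_wpM2l ?nrm_ge0.
have le2 n : (2 : R) ^+ n <= 12 * nrm S phi.
  have := le n; rewrite (_ : 8 ^+ n = 4 ^+ n * 2 ^+ n :> R); last first.
    by rewrite -exprMn; congr (_ ^+ _); ring.
  have p4 : (0 : R) < 4 ^+ n by rewrite exprn_gt0.
  have p2 : (0 : R) < 2 ^+ n by rewrite exprn_gt0.
  move: (4 ^+ n) (2 ^+ n) p4 p2 => x2 y2 p4 p2.
  rewrite -(ler_pM2r (_ : 0 < 12 * (x2 * y2))) ?mulr_gt0 //.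
  have -> : x2^-1 / 12 * (12 * (x2 * y2)) = y2 by field; rewrite gt_eqF.
  by have -> : nrm S phi / (x2 * y2) * (12 * (x2 * y2)) = 12 * nrm S phi
    by field; rewrite !gt_eqF.
pose m := (Num.truncn (12 * nrm S phi)).+1.
have lt1 : 12 * nrm S phi < m%:R by exact: truncnS_gt.
have lt2 : m%:R <= 2 ^+ m :> R by rewrite -natrX ler_nat ltnW // ltn_expl.
by have := lt_le_trans lt1 (le_trans lt2 (le2 m)); rewrite ltxx.
Qed.

(** Duality: pairing [phi] with an exponential sum close to its conjugate nearly recovers the
    squared norm of [phi], while [riesz_fischer] bounds the coefficients of that sum and thereby the
    pairing. *)
Lemma frame_lower_bound G w : (forall l, G l -> 0 < w l) ->
  interpolating G w -> total G ->
  exists2 K : R, 0 < K & forall phi B, square_integrable S phi -> 0 <= B ->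
    (forall s, uniq s -> (forall l, l \in s -> G l) ->
      \sum_(l <- s) (normc (cintegral S (fun t => phi t * cexpi l t)) / w l) ^+ 2
        <= B ^+ 2) ->
    nrm S phi <= K * B.
Proof.
move=> w0 int tot; have [K0 K00 KP] := riesz_fischer w0 int.
exists (Num.sqrt K0); first by rewrite sqrtr_gt0.
move=> phi B sphi B0 bd.
have nphi := nrm_ge0 S phi.
have scphi := square_integrable_conj mS sphi.
set K := Num.sqrt K0; have K0' : 0 <= K by exact: sqrtr_ge0.
suff key : sqn S phi <= K * B * nrm S phi.
  have [->|n0] := eqVneq (nrm S phi) 0; first by rewrite mulr_ge0.
  have np : 0 < nrm S phi by rewrite lt0r n0.
  by rewrite -(ler_pM2r np) -expr2 nrm2.
apply/ler_addgt0Pl => e e0.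
have p1 : 0 < nrm S phi + K * B + 1 by rewrite ltr_wpDl // addr_ge0 // mulr_ge0.
(* The two error terms are K B y and y times the norm of [phi]; the +1 makes the divisor
   positive. *)
have [y y0 yE] : exists2 y, 0 < y & e = y * (nrm S phi + K * B + 1).
  exists (e / (nrm S phi + K * B + 1)); first by rewrite divr_gt0.
  by field; rewrite gt_eqF.
have [s [c [us sG close]]] := expsum_dense tot scphi y0.
have su := square_integrable_expsum s c.
set u := expsum s c in close su.
have sd : square_integrable S (fun t => conjc (phi t) - u t) by exact: square_integrableB.
have nu : nrm S u <= nrm S phi + y.
  rewrite (_ : u = fun t => conjc (phi t) - (conjc (phi t) - u t)); last first.
    by apply: funext => t; ring.
  by apply: le_trans (nrmB mS scphi sd) _; rewrite nrm_conj lerD2l.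
have pu : normc (cintegral S (fun t => phi t * u t)) <= K * B * nrm S u.
  rewrite cintegral_expsum //; apply: le_trans (normc_sum _ _) _.
  pose f l := normc (c l) * w l.
  pose g l := normc (cintegral S (fun t => phi t * cexpi l t)) / w l.
  have -> : \sum_(l <- s) normc (c l * cintegral S (fun t => phi t * cexpi l t)) =
      \sum_(l <- s) f l * g l.
    apply: eq_big_seq => l /sG /w0 wl; rewrite normcM /f /g; field.
    by rewrite gt_eqF.
  have fg0 : 0 <= \sum_(l <- s) f l * g l.
    rewrite big_seq; apply: sumr_ge0 => l /sG /w0 wl.
    by rewrite !mulr_ge0 ?normc_ge0 ?invr_ge0 // ltW.
  rewrite -ler_sqr ?nnegrE ?mulr_ge0 ?nrm_ge0 //.
  apply: le_trans (finite_cauchy_schwarz _ _ _) _.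
  rewrite !exprMn nrm2 /K sqr_sqrtr ?(ltW K00) // mulrAC.
  apply: ler_pM; [by apply: sumr_ge0 => l _; exact: sqr_ge0..| |].
  - exact: KP.
  - exact: bd.
have E : (sqn S phi)%:C = cintegral S (fun t => phi t * u t) +
    cintegral S (fun t => phi t * (conjc (phi t) - u t)).
  rewrite -sqnE -cintegralD //; [|exact: cintegrableM..].
  by apply: eq_cintegral => t _; ring.
have := normcD (cintegral S (fun t => phi t * u t))
  (cintegral S (fun t => phi t * (conjc (phi t) - u t))).
rewrite -E normc_real ger0_norm ?sqn_ge0 //.
have := normc_pairing_le mS sphi sd.
have := ler_wpM2l (mulr_ge0 K0' B0) nu.
have := ler_wpM2l nphi close.
rewrite yE; move: (K * B) (mulr_ge0 K0' B0) pu => z z0 pu; nra.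
Qed.

End ExponentialSystems.

(** * Cauchy matrices: from a lower to an upper bound *)

Lemma lagrange_interpolation (K : fieldType) (s : seq K) (r : {poly K}) :
  uniq s -> (size r <= size s)%N ->
  r = \sum_(k <- s) (r.[k] / \prod_(m <- s | m != k) (k - m)) *:
    \prod_(m <- s | m != k) ('X - m%:P).
Proof.
move=> us sr; apply/eqP; rewrite -subr_eq0; apply/eqP.
set q := \sum_(k <- s) _.
have szP k : k \in s -> size (\prod_(m <- s | m != k) ('X - m%:P)) = size s.
  move=> ks; rewrite -big_filter size_prod_XsubC -rem_filter // size_rem //.
  by rewrite prednK // (leq_ltn_trans _ (_ : 0 < size s)%N) // -has_predT; apply/hasP; exists k.
have szq : (size q <= size s)%N.
  rewrite /q big_seq; apply: leq_trans (size_sum _ _ _) _.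
  apply/bigmax_leqP_seq => k _ ks.
  by apply: leq_trans (size_scale_leq _ _) _; rewrite szP.
apply: (@roots_geq_poly_eq0 _ _ s) => //.
- apply/allP => k ks; rewrite /root hornerD hornerN subr_eq0 /q horner_sum.
  rewrite (bigD1_seq k) //= [X in _ + X]big1 ?addr0.
    rewrite hornerZ horner_prod; under [X in _ * X]eq_bigr do rewrite hornerXsubC.
    rewrite mulfVK //; rewrite prodf_seq_neq0; apply/allP => m ms.
    by apply/implyP => mk; rewrite subr_eq0 eq_sym.
  move=> m mk; rewrite hornerZ horner_prod.
  rewrite (_ : \prod_(i <- s | i != m) _ = 0) ?mulr0 //.
  apply/eqP; rewrite prodf_seq_eq0; apply/hasP; exists k => //.
  by rewrite eq_sym mk hornerXsubC subrr eqxx.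
- by rewrite (leq_trans (size_polyD _ _)) // size_polyN geq_max sr szq.
Qed.

Section CauchyMatrix.
Context {R : realType}.
Local Notation C := R[i].
Variable s : seq C.
Hypothesis us : uniq s.
Hypothesis s0 : forall l, l \in s -> 0 < Im l.

(** The inner product of e^{ilt} and e^{imt} on the half-line t > 0: up to a constant, the Szego
    kernel of the upper half-plane. Its diagonal is 1 / (2 Im l), the normalisation of the bounds
    below. *)
Definition szego (m l : C) : C := 'i / (l - conjc m).
Definition gram (v : C -> C) : C :=
  \sum_(m <- s) \sum_(l <- s) v l * conjc (v m) * szego m l.

Lemma szego_conj m l : conjc (szego m l) = szego l m.
Proof.
rewrite /szego conjM conjc_inv conjB conjcK.
rewrite (_ : conjc 'i = - 'i); last by apply: complexP => /=; ring.
by rewrite mulNr -mulrN -invrN opprB.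
Qed.

Lemma sub_conj_neq0 l m : l \in s -> m \in s -> l - conjc m != 0.
Proof.
move=> /s0 l0 /s0 m0; apply/eqP => /(congr1 (@complex.Im R)).
by rewrite ImB Im_conj opprK /= => e; have := addr_gt0 l0 m0; rewrite e ltxx.
Qed.

(* [d] is the diagonal of the inverse [D G (conj D)] of the Cauchy matrix [G = szego]. *)
Let d k := \prod_(m <- s) (k - conjc m) / \prod_(m <- s | m != k) (k - m).

Let d_neq0 k : k \in s -> d k != 0.
Proof.
move=> ks; rewrite mulf_neq0 ?invr_eq0 //.
  rewrite prodf_seq_neq0; apply/allP => m ms; exact: sub_conj_neq0.
rewrite prodf_seq_neq0; apply/allP => m ms.
by apply/implyP => mk; rewrite subr_eq0 eq_sym.
Qed.

(** The factor m = k of the numerator is 2i Im k. Every other factor is paired with one of the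
    denominator, and in the upper half-plane k is at least as far from conj m as from m. *)
Let d_ge k : k \in s -> 2 * Im k <= normc (d k).
Proof.
move=> ks; rewrite /d (bigD1_seq k) //= -mulrA.
rewrite (_ : \prod_(i <- s | i != k) (k - conjc i) / _ =
  \prod_(i <- s | i != k) ((k - conjc i) / (k - i))); last first.
  by rewrite prodf_div.
have k0 := s0 ks.
rewrite normcM (_ : normc (k - conjc k) = 2 * Im k); last first.
  case: (k) k0 => x y /= y0; rewrite subrr expr0n add0r opprK sqrtr_sqr ger0_norm; lra.
rewrite ler_peMr ?mulr_ge0 ?(ltW k0) //.
rewrite -big_filter; have : {subset [seq i <- s | i != k] <= s} /\
    all (fun i => i != k) [seq i <- s | i != k].
  by split; [move=> i; rewrite mem_filter => /andP[]|exact: filter_all].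
elim: [seq i <- s | i != k] => [|i r IH] [sub al]; first by rewrite big_nil normc1.
rewrite big_cons normcM; move: al => /= /andP[ik al].
have is_ : i \in s by rewrite sub // inE eqxx.
have i0 := s0 is_.
rewrite -[1]mulr1 ler_pM //; last by apply: IH; split => // j jr; rewrite sub // inE jr orbT.
rewrite normcM normcV ler_pdivlMr ?mul1r; last first.
  by rewrite lt0r normc_ge0 normc_eq0 subr_eq0 eq_sym ik.
rewrite -ler_sqr ?nnegrE ?normc_ge0 // !normc2E !ReB !ImB Re_conj Im_conj.
rewrite !expr2; nra.
Qed.

(** Lagrange interpolation, at the nodes [s], of the product of the X - conj m with m != j,
    evaluated at conj n: this is a root of the product unless n = j. *)
Let cauchy_inverse j n : j \in s -> n \in s ->
  \sum_(k <- s) szego j k * szego n k * d k = if j == n then (conjc (d j))^-1 else 0.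
Proof.
move=> js ns.
pose r : {poly C} := \prod_(m <- s | m != j) ('X - (conjc m)%:P).
have szr : (size r <= size s)%N.
  rewrite /r -big_filter size_prod_XsubC -rem_filter // size_rem //.
  by rewrite prednK // (leq_ltn_trans _ (_ : 0 < size s)%N) // -has_predT; apply/hasP; exists j.
have rE z : r.[z] = \prod_(m <- s | m != j) (z - conjc m).
  by rewrite horner_prod; apply: eq_bigr => m _; rewrite hornerXsubC.
have := congr1 (fun p : {poly C} => p.[conjc n]) (lagrange_interpolation us szr).
rewrite /= horner_sum.
pose p z := \prod_(m <- s) (z - m).
have p_neq0 i : i \in s -> p (conjc i) != 0.
  move=> is_; rewrite prodf_seq_neq0; apply/allP => m ms /=.
  by rewrite -oppr_eq0 opprB sub_conj_neq0.
rewrite (eq_big_seq (fun k => szego j k * szego n k * d k * p (conjc n))); last first.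
  move=> k ks; rewrite hornerZ rE horner_prod.
  under [X in _ * X]eq_bigr do rewrite hornerXsubC.
  have kj := sub_conj_neq0 ks js; have kn := sub_conj_neq0 ks ns.
  rewrite /p /d /szego.
  have -> : \prod_(m <- s) (conjc n - m) = (conjc n - k) * \prod_(m <- s | m != k) (conjc n - m).
    exact: bigD1_seq.
  have -> : \prod_(m <- s) (k - conjc m) = (k - conjc j) * \prod_(m <- s | m != j) (k - conjc m).
    exact: bigD1_seq.
  have ii : 'i * 'i = -1 :> C by rewrite -expr2 sqr_i.
  set A := \prod_(_ <- _ | _) _; set B := \prod_(_ <- _ | _) _; set D := \prod_(_ <- _ | _) _.
  rewrite (_ : 'i / (k - conjc j) * ('i / (k - conjc n)) =
     ('i * 'i) / ((k - conjc j) * (k - conjc n))); last by rewrite invfM; ring.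
  rewrite ii.
  have D0 : D != 0.
    rewrite prodf_seq_neq0; apply/allP => m ms.
    by apply/implyP => mk; rewrite subr_eq0 eq_sym.
  by field; rewrite D0 kj kn.
rewrite -mulr_suml rE => e; apply: (mulIf (p_neq0 n ns)); rewrite -e.
case: eqVneq => [<-|jn]; last first.
  rewrite mul0r; apply/eqP; rewrite prodf_seq_eq0; apply/hasP; exists n => //.
  by rewrite eq_sym jn subrr eqxx.
rewrite /d conjM conjc_inv invfM invrK.
have cprod (P : pred C) (f : C -> C) :
    conjc (\prod_(m <- s | P m) f m) = \prod_(m <- s | P m) conjc (f m).
  by elim/big_rec2: _ => [|i x y _ <-]; rewrite ?conjM // conjc1.
rewrite !cprod /p.
under [X in X^-1 * _]eq_bigr do rewrite conjB conjcK.
under [X in _ * X * _]eq_bigr do rewrite conjB.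
by rewrite mulrAC mulVf ?mul1r //; exact: p_neq0.
Qed.

(** By [cauchy_inverse], summing [szego j k * c k] over k undoes the sum inside [c] and leaves v j /
    conj (d j). *)
Let gram_transpose (v : C -> C) (c := fun k => d k * \sum_(l <- s) szego l k * v l) :
  gram c = \sum_(j <- s) conjc (c j) * (v j / conjc (d j)).
Proof.
rewrite /gram; apply: eq_big_seq => j js.
transitivity (conjc (c j) * \sum_(k <- s) szego j k * c k).
  by rewrite mulr_sumr; apply: eq_bigr => k _; ring.
congr (_ * _).
transitivity (\sum_(l <- s) v l * \sum_(k <- s) szego j k * szego l k * d k).
  under eq_bigr do rewrite /c !mulr_sumr.
  rewrite exchange_big /=; apply: eq_bigr => l _; rewrite mulr_sumr.
  by apply: eq_bigr => k _; ring.
rewrite (bigD1_seq j) //= [X in _ + X]big_seq_cond [X in _ + X]big1 ?addr0.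
  by rewrite cauchy_inverse // eqxx.
move=> l /andP[ls lj]; rewrite cauchy_inverse // eq_sym (negbTE lj) mulr0 //.
Qed.

(** The vector [c] built from conj v by the inverse pattern has the same Gram value Q as [v]. With A
    and B the weighted sums for [c] and [v], the lower bound gives g A <= Q, and Cauchy-Schwarz with
    |d| >= 2 Im gives Q^2 <= A B; hence Q <= B / g, with a constant independent of [s]. *)
Lemma cauchy_gram_bound (g : R) : 0 < g ->
  (forall c, g * \sum_(l <- s) normc (c l) ^+ 2 / (2 * Im l) <= Re (gram c)) ->
  forall v, Re (gram v) <= g^-1 * \sum_(l <- s) normc (v l) ^+ 2 / (2 * Im l).
Proof.
move=> g0 lb v.
pose u l := conjc (v l).
pose c k := d k * \sum_(l <- s) szego l k * u l.
have gE : gram c = \sum_(j <- s) conjc (c j) * (u j / conjc (d j)) by exact: gram_transpose.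
have gcv : gram c = gram v.
  rewrite gE; apply: eq_big_seq => j js.
  have dj : conjc (d j) != 0 by rewrite conjc_eq0 d_neq0.
  rewrite /c conjM (_ : conjc (\sum_(l <- s) szego l j * u l) = \sum_(l <- s) szego j l * v l).
    transitivity ((\sum_(l <- s) szego j l * v l) * u j); first by field; rewrite dj.
    rewrite /u mulr_suml.
    apply: eq_bigr => l _; ring.
  elim: s => [|i r IH]; first by rewrite !big_nil conjc0.
  by rewrite !big_cons conjD conjM szego_conj conjcK IH.
rewrite -gcv; set Q := Re (gram c).
pose B := \sum_(l <- s) normc (v l) ^+ 2 / (2 * Im l).
pose A := \sum_(l <- s) normc (c l) ^+ 2 / (2 * Im l).
have B0 : 0 <= B.
  rewrite /B big_seq; apply: sumr_ge0 => l /s0 l0.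
  by rewrite divr_ge0 ?sqr_ge0 // mulr_ge0 // ltW.
have A0 : 0 <= A.
  rewrite /A big_seq; apply: sumr_ge0 => l /s0 l0.
  by rewrite divr_ge0 ?sqr_ge0 // mulr_ge0 // ltW.
have QA : Q <= \sum_(j <- s) (normc (c j) / Num.sqrt (2 * Im j)) *
    (Num.sqrt (2 * Im j) * normc (v j) / normc (d j)).
  apply: le_trans (ler_norm _) _; apply: le_trans (Re_le_normc _) _.
  rewrite gE; apply: le_trans (normc_sum _ _) _; rewrite le_eqVlt; apply/orP; left.
  apply/eqP; apply: eq_big_seq => j js.
  have -> : normc (conjc (c j) * (u j / conjc (d j))) =
      normc (c j) * (normc (v j) / normc (d j)).
    rewrite normcM normc_conj; congr (_ * _); rewrite normcM normcV.
    by congr (_ * _^-1); exact: normc_conj.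
  have dj : normc (d j) != 0 by rewrite normc_eq0 d_neq0.
  have r0 : Num.sqrt (2 * Im j) != 0 by rewrite gt_eqF // sqrtr_gt0 mulr_gt0 // s0.
  by move: (normc (d j)) dj (normc (c j)) => x x0 y; field; rewrite r0 x0.
have Q2 : Q <= Num.sqrt (A * B).
  apply: le_trans QA _; rewrite -[leLHS]ger0_norm; last first.
    apply: sumr_ge0 => l _.
    by rewrite !mulr_ge0 ?invr_ge0 ?normc_ge0 ?sqrtr_ge0.
  rewrite -sqrtr_sqr ler_wsqrtr //.
  apply: le_trans (finite_cauchy_schwarz _ _ _) _; apply: ler_pM.
  - by apply: sumr_ge0 => l _; exact: sqr_ge0.
  - by apply: sumr_ge0 => l _; exact: sqr_ge0.
  - rewrite le_eqVlt; apply/orP; left; apply/eqP; apply: eq_big_seq => l /s0 l0.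
    by rewrite exprMn exprVn sqr_sqrtr // mulr_ge0 // ltW.
  - rewrite /B big_seq [leRHS]big_seq; apply: ler_sum => l ls; have l0 := s0 ls.
    have y0 : 0 < 2 * Im l by rewrite mulr_gt0.
    have dl := d_ge ls; have d0 : 0 < normc (d l) by exact: lt_le_trans dl.
    rewrite !exprMn exprVn sqr_sqrtr ?(ltW y0) //.
    rewrite [2 * Im l * _]mulrC -mulrA ler_wpM2l ?sqr_ge0 //.
    rewrite ler_pdivrMr ?exprn_gt0 // ler_pdivlMl //.
    rewrite -expr2 ler_sqr ?nnegrE ?(ltW y0) ?(ltW d0) //.
have lb' : g * A <= Q by exact: lb.
have Q0 : 0 <= Q by apply: le_trans lb'; rewrite mulr_ge0 // ltW.
rewrite ler_pdivlMl //.
have QQ : Q ^+ 2 <= A * B.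
  by rewrite -(sqr_sqrtr (mulr_ge0 A0 B0)) ler_sqr ?nnegrE ?sqrtr_ge0.
have [Qz|Qn] := eqVneq Q 0; first by rewrite Qz mulr0.
have Qp : 0 < Q by rewrite lt0r Qn.
rewrite -(ler_pM2r Qp) -/B.
have := ler_wpM2r B0 lb'; have := ler_wpM2l (ltW g0) QQ; rewrite expr2; nra.
Qed.

End CauchyMatrix.

Lemma cintegrable_cexpi (R : realType) (S : set R) (M : R) :
  measurable (S : set (measurableTypeR R)) -> (forall t, S t -> `|t| <= M) ->
  forall w, cintegrable S (cexpi w).
Proof.
move=> mS SM w.
rewrite (_ : cexpi w = fun t => cexpi w t * cexpi 0 t).
  by apply: cintegrableM => //; exact: square_integrable_cexpi SM _.
by apply: funext => t; rewrite cexpi0 mulr1.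
Qed.

(** * Exponential sums on intervals as differences of Gram forms *)

Section GramIntegral.
Context {R : realType}.
Local Notation C := R[i].
Local Notation mu := (@lebesgue_measure R).

Lemma is_derive_Re_cexpi (w : C) (t : R) :
  is_derive t 1 (fun t => Re (cexpi w t)) (Re ('i * w * cexpi w t)).
Proof.
rewrite (_ : (fun t => _) = fun t => expR (- Im w * t) * cos (Re w * t)); last first.
  by apply: funext => x; rewrite cexpiE.
apply: is_derive_eq.
rewrite !scaler1 cexpiE !(ReM, ImM) /= /GRing.scale /=; ring.
Qed.

Lemma is_derive_Im_cexpi (w : C) (t : R) :
  is_derive t 1 (fun t => Im (cexpi w t)) (Im ('i * w * cexpi w t)).
Proof.
rewrite (_ : (fun t => _) = fun t => expR (- Im w * t) * sin (Re w * t)); last first.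
  by apply: funext => x; rewrite cexpiE.
apply: is_derive_eq.
rewrite !scaler1 cexpiE !(ReM, ImM) /= /GRing.scale /=; ring.
Qed.

Lemma FTC_Rintegral (F f : R -> R) (x y : R) : x <= y ->
  (forall t : R, is_derive t 1 F (f t)) -> continuous f ->
  (\int[mu]_(t in `[x, y]) f t)%R = F y - F x.
Proof.
move=> xy dF cf; move: xy; rewrite le_eqVlt => /orP[/eqP ->|xy].
  by rewrite subrr set_itv1 Rintegral_set1.
rewrite /Rintegral (@continuous_FTC2 _ f F) //.
- exact: continuous_subspaceT.
- split.
  + by move=> t _; have [] := dF t.
  + apply: cvg_at_right_filter; apply: differentiable_continuous.
    by apply/derivable1_diffP; have [] := dF x.
  + apply: cvg_at_left_filter; apply: differentiable_continuous.
    by apply/derivable1_diffP; have [] := dF y.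
- by move=> t _; rewrite derive1E; have [_ ->] := dF t.
Qed.

Lemma continuous_Re_cexpi (w : C) : continuous (fun t => Re (cexpi w t)).
Proof.
move=> t; apply: differentiable_continuous; apply/derivable1_diffP.
by have [] := is_derive_Re_cexpi w t.
Qed.

Lemma continuous_Im_cexpi (w : C) : continuous (fun t => Im (cexpi w t)).
Proof.
move=> t; apply: differentiable_continuous; apply/derivable1_diffP.
by have [] := is_derive_Im_cexpi w t.
Qed.

Lemma itv_bounded (x y : R) (t : R) : `[x, y]%classic t -> `|t| <= `|x| + `|y|.
Proof.
rewrite /= in_itv /= => /andP[xt ty]; rewrite ler_norml.
have := ler_norm y; have := ler_norm (- x); rewrite normrN.
have := normr_ge0 x; have := normr_ge0 y; lra.
Qed.

Lemma cintegral_cexpi (w : C) (x y : R) : w != 0 -> x <= y ->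
  cintegral `[x, y] (cexpi w) = (cexpi w y - cexpi w x) / ('i * w).
Proof.
move=> w0 xy.
have iw0 : 'i * w != 0 by rewrite mulf_neq0 // eq_complex /= oner_eq0 andbF.
have mS : measurable (`[x, y] : set (measurableTypeR R)) by [].
have ci := cintegrable_cexpi mS (@itv_bounded x y) w.
apply: (mulIf iw0); rewrite mulfVK // mulrC -(cintegralZ mS _ ci).
apply: complexP; rewrite ?ReB ?ImB [LHS]/=.
- apply: (FTC_Rintegral (F := fun t => Re (cexpi w t))) => // [t|t].
    exact: is_derive_Re_cexpi.
  under eq_fun do rewrite ReM.
  apply: cvgB; apply: cvgM; try exact: cvg_cst.
    exact: continuous_Re_cexpi.
  exact: continuous_Im_cexpi.
- apply: (FTC_Rintegral (F := fun t => Im (cexpi w t))) => // [t|t].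
    exact: is_derive_Im_cexpi.
  under eq_fun do rewrite ImM.
  apply: cvgD; apply: cvgM; try exact: cvg_cst.
    exact: continuous_Im_cexpi.
  exact: continuous_Re_cexpi.
Qed.

(** The interval is the half-line from x minus the half-line from y, and moving the origin to x
    multiplies the coefficients by e^{ilx}. The proof only evaluates primitives of e^{i(l - conj
    m)t} at x and y. *)
Lemma sqn_expsum_gram (s : seq C) (c : C -> C) (x y : R) : uniq s ->
  (forall l, l \in s -> 0 < Im l) -> x <= y ->
  (sqn `[x, y] (expsum s c))%:C =
  gram s (fun l => c l * cexpi l x) - gram s (fun l => c l * cexpi l y).
Proof.
move=> us s0 xy.
have mS : measurable (`[x, y] : set (measurableTypeR R)) by [].
have bd := @itv_bounded x y.
have cc l t : conjc (cexpi l t) = cexpi (- conjc l) t.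
  rewrite /cexpi -cexp_conj; congr cexp.
  by case: l => u v; apply: complexP => /=; ring.
rewrite -sqnE.
have se l := square_integrable_cexpi mS bd l.
transitivity (cintegral `[x, y] (fun t => \sum_(m <- s) \sum_(l <- s)
    (c l * conjc (c m)) * cexpi (l - conjc m) t)).
  apply: eq_cintegral => t _; rewrite /expsum.
  have -> : conjc (\sum_(l <- s) c l * cexpi l t) = \sum_(m <- s) conjc (c m) * cexpi (- conjc m) t.
    elim: (s) => [|i r IH]; first by rewrite !big_nil conjc0.
    by rewrite !big_cons conjD conjM cc IH.
  rewrite mulr_sumr; apply: eq_bigr => m _; rewrite mulr_suml.
  by apply: eq_bigr => l _; rewrite cexpiD; ring.
have ie w := cintegrable_cexpi mS bd w.
rewrite (cintegral_sum mS); last first.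
  move=> m; apply: (cintegrable_sum mS s
    (h := fun l t => c l * conjc (c m) * cexpi (l - conjc m) t)) => l.
  exact: cintegrableZ.
rewrite /gram -sumrB; apply: eq_big_seq => m ms.
rewrite (cintegral_sum mS); last by move=> l; exact: cintegrableZ.
rewrite -sumrB; apply: eq_big_seq => l ls.
have lm := sub_conj_neq0 s0 ls ms.
rewrite (cintegralZ mS _ (ie _)) cintegral_cexpi // !cexpiD !conjM !cc /szego.
rewrite invfM (_ : ('i : C)^-1 = - 'i); first by ring.
by apply: (@mulfI _ ('i : C));
  rewrite ?divff ?mulrN -?expr2 ?sqr_i ?opprK // eq_complex /= oner_eq0 andbF.
Qed.

(* [gram] is the integral of [|expsum|^2] over the half-line [0, +oo[. *)
Lemma Re_gram_ge0 (s : seq C) (v : C -> C) : uniq s ->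
  (forall l, l \in s -> 1 <= Im l) -> 0 <= Re (gram s v).
Proof.
move=> us s1.
have s0 l : l \in s -> 0 < Im l by move=> /s1; apply: lt_le_trans.
pose K := \sum_(m <- s) \sum_(l <- s) normc (v l) * normc (v m) * normc (szego m l).
have K0 : 0 <= K.
  by do 2 apply: sumr_ge0 => ? _; rewrite !mulr_ge0 ?normc_ge0.
(* As Im >= 1, the Gram form restarted at y is at most K e^{-2y}; the identity on [[0, y]] thus
   bounds Re gram from below by quantities tending to 0. *)
have dec y : 0 <= y -> normc (gram s (fun l => v l * cexpi l y)) <= K * expR (- y) ^+ 2.
  move=> y0; rewrite /gram /K mulr_suml (le_trans (normc_sum _ _)) //.
  rewrite big_seq [leRHS]big_seq; apply: ler_sum => m ms.
  rewrite mulr_suml (le_trans (normc_sum _ _)) //.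
  rewrite big_seq [leRHS]big_seq; apply: ler_sum => l ls.
  rewrite conjM normcM (normcM (v l * _)) (normcM (v l)) (normcM (conjc _)).
  rewrite !normc_conj !normc_cexpi.
  have e1 i : i \in s -> expR (- Im i * y) <= expR (- y).
    move=> /s1 i1; rewrite ler_expR mulNr lerN2; nra.
  have el := e1 l ls; have em := e1 m ms.
  rewrite (_ : _ * normc (szego m l) = (normc (v l) * normc (v m) * normc (szego m l)) *
    (expR (- Im l * y) * expR (- Im m * y))); last by ring.
  rewrite ler_wpM2l ?mulr_ge0 ?normc_ge0 // expr2 ler_pM ?expR_ge0 //.
have lb y : 0 <= y -> - (K * expR (- y)) <= Re (gram s v).
  move=> y0; have /(congr1 (@complex.Re R)) := sqn_expsum_gram v us s0 y0.
  rewrite ReB /= (_ : gram s (fun l => v l * cexpi l 0) = gram s v); last first.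
    congr gram; apply: funext => l.
    by rewrite /cexpi mulr0 cexp0 mulr1.
  move=> e; have := sqn_ge0 `[0, y] (expsum s v); rewrite e subr_ge0.
  apply: le_trans; have := le_trans (ler_norm _)
    (le_trans (Re_le_normc (- gram s (fun l => v l * cexpi l y))) _).
  move=> /(_ (K * expR (- y) ^+ 2)); rewrite normcN ReN => /(_ (dec y y0)).
  have E0 := expR_ge0 (- y); have E1 : expR (- y) <= 1 by rewrite expR_le1 oppr_le0.
  have E2 : K * expR (- y) ^+ 2 <= K * expR (- y).
    by rewrite ler_wpM2l // expr2 ler_piMr.
  by lra.
rewrite leNgt; apply/negP => neg.
pose z := - Re (gram s v); have z0 : 0 < z by rewrite oppr_gt0.
(* At y = K / z the bound reads z e^{K/z} <= K, against e^{K/z} >= 1 + K / z. *)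
have := lb (K / z) (divr_ge0 K0 (ltW z0)).
have e1 := expR_ge1Dx (K / z).
rewrite expRN; have p := expR_gt0 (K / z).
rewrite lerNl -/z ler_pdivlMr //.
have := ler_wpM2l (ltW z0) e1; rewrite mulrDr mulr1 mulrC divfK ?gt_eqF //.
by move=> l1 l2; have := le_trans l1 l2; lra.
Qed.

End GramIntegral.

(** * The Bessel inequality on [-r, r] *)

Section Bessel.
Context {R : realType}.
Local Notation C := R[i].
Local Notation mu := (@lebesgue_measure R).

Lemma sqn_le (S : set R) (f g : R -> C) (k : R) :
  measurable (S : set (measurableTypeR R)) ->
  square_integrable S f -> square_integrable S g -> 0 <= k ->
  (forall t, S t -> normc (f t) <= k * normc (g t)) ->
  sqn S f <= k ^+ 2 * sqn S g.
Proof.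
move=> mS [_ _ sf] sg k0 le.
have kE : normc (k%:C) = k by rewrite normc_real ger0_norm.
have [_ _ skg] := square_integrableZ mS k%:C sg.
rewrite -{1}kE -sqnZ //; apply: le_Rintegral => // t St.
by rewrite ler_sqr ?nnegrE ?normc_ge0 // normcM kE le.
Qed.

Variable r : R.
Hypothesis r0 : 0 < r.
Let I : set R := `[- r, r].
Let mI : measurable (I : set (measurableTypeR R)). Proof. exact: measurable_itv. Qed.
Let Ibd (t : R) : I t -> `|t| <= r.
Proof. by rewrite /I /= in_itv /= ler_norml. Qed.
Let sq_sum s c := square_integrable_expsum mI Ibd s c.

Lemma cexpi_shift (l : C) (t : R) : cexpi l t = (expR t)%:C * cexpi (l + 'i) t.
Proof.
rewrite cexpiD mulrCA (_ : _ * cexpi 'i t = 1) ?mulr1 //.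
rewrite cexpiE /= mul0r cos0 sin0 mulr1 mulr0 mulN1r.
have := expRxMexpNx_1 t => e.
by apply: complexP; rewrite ?ReM ?ImM /= ?mulr0 ?mul0r ?subr0 ?addr0.
Qed.

(* The shift by ['i] moves the frequencies into [Im >= 1], where [gram] makes sense. *)
Lemma bessel_upper (G : set C) (w : C -> R) (K0 k : R) : 0 < K0 -> 0 < k ->
  (forall s c, uniq s -> (forall l, l \in s -> G l) ->
    \sum_(l <- s) (normc (c l) * w l) ^+ 2 <= K0 * sqn I (expsum s c)) ->
  (forall l, G l -> k * expR (2 * r * `|Im l|) / (1 + `|Im l|) <= w l ^+ 2) ->
  exists2 K : R, 0 < K & forall s c, uniq s -> (forall l, l \in s -> G l) ->
    (forall l, l \in s -> 0 <= Im l) ->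
    sqn I (expsum s c) <= K * \sum_(l <- s) (normc (c l) * w l) ^+ 2.
Proof.
move=> K00 k0 rf lw.
pose E := expR (2 * r); have E0 : 0 < E by exact: expR_gt0.
have EE : expR r ^+ 2 = E by rewrite /E expRM_natl.
(* Read off from a chain in which the weighted sum of the |v|^2 / (2 Im), times 2k, is at most E K0
   E times Re gram: one E bounds the squared factor e^t of the shift, the other comes from the shift
   of Im by 1 in the size of the coefficients. *)
pose g := 2 * k / (K0 * E ^+ 2).
have g0 : 0 < g by rewrite divr_gt0 ?mulr_gt0 ?exprn_gt0.
exists (E ^+ 2 / (2 * k * g)).
  by apply: divr_gt0; [exact: exprn_gt0|do 2 (apply: mulr_gt0 => //)].
move=> s c us sG s0.
pose s' := [seq l + 'i | l <- s].
have us' : uniq s' by rewrite map_inj_uniq //; exact: addIr.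
have Im' (l : C) : Im (l + 'i) = Im l + 1 by rewrite ImD.
have s1 m : m \in s' -> 1 <= Im m.
  by move=> /mapP[l /s0 l0 ->]; rewrite Im' lerDr.
have s0' m : m \in s' -> 0 < Im m by move=> /s1; apply: lt_le_trans.
have rr : - r <= r by rewrite (@le_trans _ _ 0) ?oppr_le0 ?ltW.
have shift a : expsum s a = fun t => (expR t)%:C * expsum s' (fun m => a (m - 'i)) t.
  apply: funext => t; rewrite /expsum big_map mulr_sumr; apply: eq_bigr => l _.
  by rewrite addrK cexpi_shift; ring.
have le_shift a : sqn I (expsum s a) <= E * sqn I (expsum s' (fun m => a (m - 'i))).
  rewrite -EE; apply: (sqn_le mI (sq_sum _ _) (sq_sum _ _) (expR_ge0 r)).
  move=> t /Ibd tr; rewrite shift normcM normc_real ger0_norm ?expR_ge0 //.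
  by rewrite ler_wpM2r ?normc_ge0 // ler_expR (le_trans (ler_norm _)).
have gramle a : sqn I (expsum s' a) <= Re (gram s' (fun m => a m * cexpi m (- r))).
  have /(congr1 (@complex.Re R)) := sqn_expsum_gram a us' s0' rr.
  by rewrite ReB [LHS]/= -/I => ->; rewrite gerBl Re_gram_ge0.
have key := cauchy_gram_bound us' s0' g0.
have {}key : forall v, Re (gram s' v) <= g^-1 * \sum_(m <- s') normc (v m) ^+ 2 / (2 * Im m).
  apply: key => v.
  (* Cancels the factor e^{-imr} that starts the half-line at -r, so that the Gram form becomes that
     of [v]. *)
  pose a l := v (l + 'i) * cexpi (l + 'i) r.
  have gv : sqn I (expsum s a) <= E * Re (gram s' v).
    apply: le_trans (le_shift a) _; rewrite ler_pM2l //.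
    apply: le_trans (gramle _) _; rewrite le_eqVlt; apply/orP; left; apply/eqP.
    congr (Re (gram _ _)); apply: funext => m; rewrite /a subrK -mulrA.
    by rewrite /cexpi -cexpD (_ : _ + _ = 0) ?cexp0 ?mulr1 // rmorphN; ring.
  have up := le_trans (rf s a us sG) (ler_wpM2l (ltW K00) gv).
  (* The growth of [w] enters here: |a|^2 contains e^{-2r Im l}, and w^2 >= k e^{2r Im l} / (1 + Im
     l) leaves the diagonal of the Gram matrix up to a constant. *)
  have low : 2 * k * \sum_(m <- s') normc (v m) ^+ 2 / (2 * Im m) <=
      E * \sum_(l <- s) (normc (a l) * w l) ^+ 2.
    rewrite big_map !mulr_sumr big_seq [leRHS]big_seq; apply: ler_sum => l ls.
    have y0 := s0 l ls; have := lw l (sG l ls); rewrite ger0_norm //.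
    rewrite Im' /a normcM normc_cexpi !exprMn Im' -expRM_natl.
    set u := normc _; move: (w l ^+ 2) => W lwl.
    have p : 0 < 1 + Im l by lra.
    rewrite (_ : E * _ = u ^+ 2 * (W * expR (- (2 * r * Im l)))); last first.
      have -> : expR (2%:R * (- (Im l + 1) * r)) = E^-1 * expR (- (2 * r * Im l)).
        by rewrite /E -expRN -expRD; congr expR; ring.
      by field; rewrite gt_eqF.
    rewrite (_ : 2 * k * _ = u ^+ 2 * (k / (1 + Im l))); last first.
      by rewrite [Im l + 1]addrC; move: (1 + Im l) p => P p; field; rewrite gt_eqF.
    rewrite ler_wpM2l ?sqr_ge0 // expRN ler_pdivlMr ?expR_gt0 //.
    by rewrite mulrAC.
  have := le_trans low (ler_wpM2l (ltW E0) up).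
  set X := \sum_(m <- s') _.
  rewrite (_ : g * X = 2 * k * X / (K0 * E ^+ 2)); last by rewrite /g; ring.
  rewrite ler_pdivrMr ?mulr_gt0 ?exprn_gt0 //.
  by rewrite (_ : Re (gram s' v) * _ = E * (K0 * (E * Re (gram s' v)))) //; ring.
apply: le_trans (le_shift c) _.
apply: le_trans (ler_wpM2l (ltW E0) (gramle _)) _.
apply: le_trans (ler_wpM2l (ltW E0) (key _)) _.
rewrite (_ : E ^+ 2 / (2 * k * g) = E * g^-1 * (E / (2 * k))); last first.
  by field; rewrite !gt_eqF.
rewrite [leLHS]mulrA -(mulrA (E / g)); apply: ler_wpM2l.
  by apply: ltW; exact: divr_gt0.
rewrite big_map mulr_sumr big_seq [leRHS]big_seq; apply: ler_sum => l ls.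
have y0 := s0 l ls; have := lw l (sG l ls); rewrite ger0_norm //.
rewrite Im' addrK normcM normc_cexpi !exprMn Im' -expRM_natl.
set u := normc _; move: (w l ^+ 2) => W lwl.
have p : 0 < 1 + Im l by lra.
rewrite (_ : _ / (2 * (Im l + 1)) =
    u ^+ 2 * (E / (2 * k)) * (k * expR (2 * r * Im l) / (1 + Im l))); last first.
  have -> : expR (2%:R * (- (Im l + 1) * - r)) = E * expR (2 * r * Im l).
    by rewrite /E -expRD; congr expR; ring.
  rewrite [Im l + 1]addrC; move: (1 + Im l) p => P p.
  by field; rewrite (gt_eqF k0) gt_eqF.
rewrite (_ : _ * (u ^+ 2 * W) = u ^+ 2 * (E / (2 * k)) * W); last by ring.
apply: ler_wpM2l => //; apply: mulr_ge0; first exact: sqr_ge0.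
by apply: ltW; rewrite divr_gt0 ?mulr_gt0.
Qed.

Lemma expsum_opp (s : seq C) (c : C -> C) :
  (fun t => expsum s c (- r + r - t)) =
  expsum [seq - l | l <- s] (fun l => c (- l)).
Proof.
apply: funext => t; rewrite /expsum big_map; apply: eq_bigr => l _.
rewrite opprK addNr sub0r; congr (_ * _).
by rewrite /cexpi rmorphN; congr cexp; ring.
Qed.

Lemma sqn_expsum_opp (s : seq C) (c : C -> C) :
  sqn I (expsum [seq - l | l <- s] (fun l => c (- l))) = sqn I (expsum s c).
Proof. by rewrite -expsum_opp sqn_reflect. Qed.

(** Frequencies are split by the sign of Im. The reflection t -> -t replaces l by -l and carries the
    lower half-plane to the upper one; the growth condition on [w] survives, as it depends on |Im l|
    only. *)
Lemma bessel_expsum (G : set C) (w : C -> R) (K0 k : R) : 0 < K0 -> 0 < k ->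
  (forall s c, uniq s -> (forall l, l \in s -> G l) ->
    \sum_(l <- s) (normc (c l) * w l) ^+ 2 <= K0 * sqn I (expsum s c)) ->
  (forall l, G l -> k * expR (2 * r * `|Im l|) / (1 + `|Im l|) <= w l ^+ 2) ->
  exists2 K : R, 0 < K & forall s c, uniq s -> (forall l, l \in s -> G l) ->
    sqn I (expsum s c) <= K * \sum_(l <- s) (normc (c l) * w l) ^+ 2.
Proof.
move=> K00 k0 rf lw.
have [K1 K10 up] := bessel_upper K00 k0 rf lw.
have [|l|K2 K20 lo] := @bessel_upper [set l | G (- l)] (fun l => w (- l)) K0 k K00 k0.
- move=> s c us sG; rewrite -sqn_expsum_opp.
  apply: le_trans (rf [seq - l | l <- s] (fun l => c (- l)) _ _).
  + by rewrite big_map; under [leRHS]eq_bigr do rewrite opprK.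
  + by rewrite map_inj_uniq //; exact: oppr_inj.
  + by move=> _ /mapP[l ls ->]; exact: sG.
- by move=> /lw; rewrite ImN normrN.
exists (2 * (K1 + K2)); first by rewrite mulr_gt0 // addr_gt0.
move=> s c us sG.
pose sp := [seq l <- s | 0 <= Im l]; pose sn := [seq l <- s | ~~ (0 <= Im l)].
have split (f : C -> C) : \sum_(l <- s) f l = \sum_(l <- sp) f l + \sum_(l <- sn) f l.
  by rewrite !big_filter (bigID (fun l => 0 <= Im l)).
have splitR (f : C -> R) : \sum_(l <- s) f l = \sum_(l <- sp) f l + \sum_(l <- sn) f l.
  by rewrite !big_filter (bigID (fun l => 0 <= Im l)).
have -> : expsum s c = fun t => expsum sp c t + expsum sn c t.
  by apply: funext => t; rewrite /expsum split.
have le2 : sqn I (fun t => expsum sp c t + expsum sn c t) <=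
    2 * sqn I (expsum sp c) + 2 * sqn I (expsum sn c).
  have := parallelogram mI (sq_sum sp c) (sq_sum sn c).
  by have := sqn_ge0 I (fun t => expsum sp c t - expsum sn c t); lra.
apply: le_trans le2 _; rewrite splitR.
have bp : sqn I (expsum sp c) <= K1 * \sum_(l <- sp) (normc (c l) * w l) ^+ 2.
  apply: up; first exact: filter_uniq.
    by move=> l; rewrite mem_filter => /andP[_ /sG].
  by move=> l; rewrite mem_filter => /andP[].
have bn : sqn I (expsum sn c) <= K2 * \sum_(l <- sn) (normc (c l) * w l) ^+ 2.
  rewrite -sqn_expsum_opp.
  have := lo [seq - l | l <- sn] (fun l => c (- l)).
  rewrite big_map; under eq_bigr do rewrite opprK.
  apply; first by rewrite map_inj_uniq ?filter_uniq //; exact: oppr_inj.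
    by move=> _ /mapP[l + ->]; rewrite mem_filter /= opprK => /andP[_ /sG].
  move=> _ /mapP[l + ->]; rewrite mem_filter -ltNge ImN oppr_ge0 => /andP[+ _].
  exact: ltW.
have sp0 : 0 <= \sum_(l <- sp) (normc (c l) * w l) ^+ 2.
  by apply: sumr_ge0 => l _; exact: sqr_ge0.
have sn0 : 0 <= \sum_(l <- sn) (normc (c l) * w l) ^+ 2.
  by apply: sumr_ge0 => l _; exact: sqr_ge0.
move: (\sum_(l <- sp) _) (\sum_(l <- sn) _) sp0 sn0 bp bn => x y x0 y0 bp bn.
nra.
Qed.

(** Duality: with A the left-hand sum, the exponential sum with coefficients conj(f l) / w^2 pairs
    with [phi] to A and has weighted coefficient sum A, so that A^2 <= K A [sqn I phi]. *)
Lemma bessel (G : set C) (w : C -> R) (K0 k : R) : 0 < K0 -> 0 < k ->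
  (forall s c, uniq s -> (forall l, l \in s -> G l) ->
    \sum_(l <- s) (normc (c l) * w l) ^+ 2 <= K0 * sqn I (expsum s c)) ->
  (forall l, G l -> k * expR (2 * r * `|Im l|) / (1 + `|Im l|) <= w l ^+ 2) ->
  (forall l, G l -> 0 < w l) ->
  exists2 K : R, 0 < K & forall phi s, square_integrable I phi ->
    uniq s -> (forall l, l \in s -> G l) ->
    \sum_(l <- s) (normc (cintegral I (fun t => phi t * cexpi l t)) / w l) ^+ 2
      <= K * sqn I phi.
Proof.
move=> K00 k0 rf lw w0; have [K K0' be] := bessel_expsum K00 k0 rf lw.
exists K => // phi s sphi us sG.
pose f l := cintegral I (fun t => phi t * cexpi l t).
pose c l := conjc (f l) * ((w l)^-1 ^+ 2)%:C.
set A := \sum_(l <- s) _.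
have A0 : 0 <= A by apply: sumr_ge0 => l _; exact: sqr_ge0.
have AE : cintegral I (fun t => phi t * expsum s c t) = A%:C.
  rewrite (cintegral_expsum mI Ibd) // rmorph_sum /=; apply: eq_bigr => l _.
  by rewrite -/(f l) /c mulrAC [_ * f l]mulrC mulzJ -rmorphM -exprMn.
have AE2 : \sum_(l <- s) (normc (c l) * w l) ^+ 2 = A.
  apply: eq_big_seq => l /sG /w0 wl; congr (_ ^+ 2).
  rewrite /c normcM normc_conj normc_real ger0_norm ?sqr_ge0 //.
  by rewrite -/(f l); field; rewrite gt_eqF.
have := cauchy_schwarz mI sphi (sq_sum s c).
rewrite AE normc_real real_normK ?num_real // => le.
have := le_trans le (ler_wpM2l (sqn_ge0 I phi) (be s c us sG)).
rewrite AE2 expr2 mulrA; have [->|An] := eqVneq A 0.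
  by move=> _; rewrite mulr_ge0 ?sqn_ge0 // ltW.
have Ap : 0 < A by rewrite lt0r An.
by rewrite ler_pM2r // mulrC.
Qed.

End Bessel.

(** * Bounds for the kernel norms *)

Section KernelNorms.
Context {R : realType}.
Local Notation C := R[i].
Local Notation mu := (@lebesgue_measure R).
Implicit Types (S : set R) (l z : C).

Lemma sqn_cst1 (x y : R) : x <= y -> sqn `[x, y] (fun=> 1 : C) = y - x.
Proof.
move=> xy; rewrite /sqn; under eq_Rintegral do rewrite normc1 expr1n.
rewrite Rintegral_cst // mul1r.
have := lebesgue_measure_itv `[x, y]; rewrite /= lte_fin => ->.
by case: ltgtP xy => // -> _; rewrite subrr.
Qed.

Lemma normc_cintegral_cexpi_le (z : C) (x y k : R) : x <= y ->
  (forall t, `[x, y]%classic t -> expR (- Im z * t) <= k) ->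
  normc (cintegral `[x, y] (cexpi z)) <= k * (y - x).
Proof.
move=> xy le; have mS : measurable (`[x, y] : set (measurableTypeR R)) by [].
have k0 : 0 <= k.
  apply: le_trans (expR_ge0 _) (le x _).
  by rewrite /= in_itv /= lexx.
have sz := square_integrable_cexpi mS (@itv_bounded R x y) z.
have s0 := square_integrable_cexpi mS (@itv_bounded R x y) 0.
have c0 : cexpi 0 = (fun=> 1) :> (R -> C) by apply: funext => t; rewrite cexpi0.
have sle : sqn `[x, y] (cexpi z) <= k ^+ 2 * (y - x).
  rewrite -(sqn_cst1 xy) -c0; apply: sqn_le => // t /le.
  by rewrite cexpi0 normc1 mulr1 normc_cexpi.
have := cauchy_schwarz mS sz s0; rewrite {2}c0 sqn_cst1 //.
rewrite (_ : (fun t => _ * _) = cexpi z); last first.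
  by apply: funext => t; rewrite cexpi0 mulr1.
have xy0 : 0 <= y - x by rewrite subr_ge0.
move=> le1; rewrite -ler_sqr ?nnegrE ?normc_ge0 ?mulr_ge0 //.
apply: le_trans le1 _; rewrite exprMn [(y - x) ^+ 2]expr2 mulrA.
by rewrite ler_wpM2r.
Qed.

(** e^{iht} - 1 is ih times the integral of e^{ihs} over [0, t]; the case t < 0 follows by replacing
    (h, t) with (-h, -t). *)
Lemma normc_cexpi_sub1_le (h : C) (t : R) :
  normc (cexpi h t - 1) <= normc h * `|t| * expR (`|Im h| * `|t|).
Proof.
wlog t0 : h t / 0 <= t.
  move=> H; have [|t0] := leP 0 t; first exact: H.
  have -> : cexpi h t = cexpi (- h) (- t).
    by rewrite /cexpi rmorphN; congr cexp; ring.
  have := H (- h) (- t); rewrite ImN !normrN (normcN h); apply.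
  by rewrite oppr_ge0 ltW.
have [->|h0] := eqVneq h 0; first by rewrite cexpi0 subrr normc0 !mul0r.
have iw0 : 'i * h != 0 by rewrite mulf_neq0 // eq_complex /= oner_eq0 andbF.
have e0 : cexpi h 0 = 1 by rewrite /cexpi mulr0 cexp0.
have := cintegral_cexpi h0 t0; rewrite e0 => /(congr1 (fun z => z * ('i * h))).
rewrite mulfVK // => <-.
rewrite normcM mulrC normcM (_ : normc 'i = 1); last first.
  by rewrite /= expr0n expr1n add0r sqrtr1.
rewrite mul1r -mulrA ler_wpM2l ?normc_ge0 // (ger0_norm t0) mulrC -[X in _ * X](subr0 t).
apply: normc_cintegral_cexpi_le => // s; rewrite /= in_itv /= => /andP[s0 st].
rewrite ler_expR (le_trans (ler_norm _)) // normrM normrN (ger0_norm s0).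
by rewrite ler_wpM2l.
Qed.

(** This local Lipschitz bound supplies the continuity of the kernels on the real axis, hence their
    measurability, and later the value of F'(t). *)
Lemma paley_wiener_lipschitz S (M : R) (phi : R -> C) (l : C) :
  measurable (S : set (measurableTypeR R)) -> (forall t, S t -> `|t| <= M) ->
  square_integrable S phi -> exists2 K : R, 0 <= K & forall h, normc h <= 1 ->
    normc (cintegral S (fun t => phi t * cexpi (l + h) t) -
           cintegral S (fun t => phi t * cexpi l t)) <= K * normc h.
Proof.
move=> mS SM sphi; have sc z := square_integrable_cexpi mS SM z.
pose k := `|M| * expR `|M|; have k0 : 0 <= k by rewrite mulr_ge0 ?expR_ge0.
exists (nrm S phi * (k * nrm S (cexpi l))); first by rewrite !mulr_ge0 ?nrm_ge0.
move=> h h1.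
rewrite -mulN1r -cintegralZ; [|exact: mS|exact: cintegrableM].
rewrite -cintegralD; [|exact: mS|exact: cintegrableM|]; last first.
  by apply: cintegrableZ => //; exact: cintegrableM.
rewrite (_ : cintegral S _ =
    cintegral S (fun t => phi t * (cexpi (l + h) t - cexpi l t))); last first.
  by apply: eq_cintegral => t _; ring.
have sd := square_integrableB mS (sc (l + h)) (sc l).
apply: le_trans (normc_pairing_le mS sphi sd) _.
rewrite -!mulrA ler_wpM2l ?nrm_ge0 //.
rewrite -ler_sqr ?nnegrE ?mulr_ge0 ?nrm_ge0 ?expR_ge0 ?normc_ge0 //.
rewrite nrm2; apply: le_trans (sqn_le mS sd (sc l) (_ : 0 <= k * normc h) _) _.
- by rewrite mulr_ge0 ?normc_ge0.
- move=> t St; rewrite cexpiD -[X in _ - X]mulr1 -mulrBr normcM mulrC.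
  rewrite ler_wpM2r ?normc_ge0 //; apply: le_trans (normc_cexpi_sub1_le h t) _.
  have tM : `|t| <= `|M| by rewrite (le_trans (SM t St)) ?ler_norm.
  rewrite mulrC mulrCA [k * _]mulrC ler_wpM2l ?normc_ge0 // /k mulrC.
  apply: ler_pM => //; rewrite ?expR_ge0 //.
  rewrite ler_expR -[leRHS]mul1r; apply: ler_pM => //.
  exact: le_trans (Im_le_normc _) h1.
- rewrite -nrm2 -exprMn le_eqVlt; apply/orP; left; apply/eqP; congr (_ ^+ 2); rewrite /k; ring.
Qed.

Lemma kappaE S l z : kappa S l z = cintegral S (cexpi (z - conjc l)).
Proof. by []. Qed.

Lemma pw_normE (f : C -> C) :
  pw_norm f = Num.sqrt ((2 * pi)^-1 * sqn setT (fun x : R => f x%:C)).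
Proof.
rewrite /pw_norm /pw_inner; congr Num.sqrt.
rewrite (_ : cintegral setT _ = (sqn setT (fun x : R => f x%:C))%:C); last exact: sqnE.
by rewrite -rmorphM.
Qed.

(** A primitive is atan((x - p) / m) / m, whose increment over [-n, n] is below pi / m; these
    intervals exhaust the line. *)
Lemma cauchy_density_integral (m p : R) : 0 < m ->
  (\int[mu]_x ((m ^+ 2 + (x - p) ^+ 2)^-1)%:E <= (pi / m)%:E)%E.
Proof.
move=> m0; pose f x := (m ^+ 2 + (x - p) ^+ 2)^-1.
have den x : 0 < m ^+ 2 + (x - p) ^+ 2 by rewrite ltr_wpDr ?sqr_ge0 ?exprn_gt0.
have f0 x : 0 <= f x by rewrite invr_ge0 ltW.
pose F x := atan ((x - p) / m) / m.
have dF (x : R) : is_derive x 1 F (f x).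
  have datan (y : R) : is_derive y 1 (@atan R) (1 + y ^+ 2)^-1.
    apply: DeriveDef; first exact: derivable_atan.
    by rewrite -derive1E derive1_atan.
  pose q := fun x : R => (x - p) / m.
  have dq : is_derive x 1 q (m^-1).
    by apply: is_derive_eq; rewrite /GRing.scale /=; ring.
  have dc := @is_derive1_comp R (@atan R) q x _ _ (datan (q x)) dq.
  have := is_deriveM dc (is_derive_cst (m^-1) x 1).
  move=> dd.
  have -> : f x = (atan \o q) x *: 0 + cst m^-1 x *: ((1 + q x ^+ 2)^-1 / m); last exact: dd.
  rewrite /f /q /GRing.scale /=.
  by field; rewrite (gt_eqF m0) (gt_eqF (den x)).
have cf : continuous f.
  move=> x; apply: cvgV; first by rewrite gt_eqF.
  apply: cvgD; first exact: cvg_cst.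
  rewrite expr2; under eq_fun do rewrite expr2.
  by apply: cvgM; (apply: cvgB; [exact: cvg_id|exact: cvg_cst]).
have mf : measurable_fun setT f by exact: continuous_measurable_fun.
pose D (n : nat) : set R := `[- n%:R, n%:R]%classic.
have -> : [set: R] = \bigcup_n D n.
  apply/seteqP; split => // x _; exists (Num.truncn `|x|).+1 => //.
  by rewrite /D /= in_itv /= -ler_norml ltW // truncnS_gt.
have cv : (\int[mu]_(x in D n) (f x)%:E)%E @[n --> \oo] -->
    (\int[mu]_(x in \bigcup_n D n) (f x)%:E)%E.
  apply: ge0_nondecreasing_set_cvg_integral.
  - move=> n k nk; apply/subsetPset => x; rewrite /D /= !in_itv /= => /andP[x1 x2].
    have : n%:R <= k%:R :> R by rewrite ler_nat.
    by move=> le; apply/andP; split; lra.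
  - by move=> n; exact: measurable_itv.
  - by move=> n; exact/measurable_EFinP/measurable_funTS.
  - by move=> n x _; rewrite lee_fin.
rewrite -(cvg_lim _ cv) //; apply: lime_le; first by apply/cvg_ex; eexists; exact: cv.
apply: nearW => n.
have i : mu.-integrable (D n) (EFin \o f).
  apply: continuous_compact_integrable; first exact: segment_compact.
  exact: continuous_subspaceT.
have mD : measurable (D n : set (measurableTypeR R)) by exact: measurable_itv.
rewrite -(fineK (integrable_fin_num mD i)) lee_fin.
have nn : - n%:R <= n%:R :> R by rewrite (@le_trans _ _ 0) ?oppr_le0.
rewrite [leLHS](FTC_Rintegral nn dF cf) /F -mulrBl ler_wpM2r ?invr_ge0 ?(ltW m0) //.
have := atan_gtNpi2 ((- n%:R - p) / m); have := atan_ltpi2 ((n%:R - p) / m).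
by move: (atan _) (atan _) => x y; lra.
Qed.

Lemma continuous_paley_wiener S (M : R) (g : C -> R) (phi : R -> C) (l : C) :
  measurable (S : set (measurableTypeR R)) -> (forall t, S t -> `|t| <= M) ->
  square_integrable S phi ->
  (forall z, `|g z| <= normc z) -> (forall z w, g (z - w) = g z - g w) ->
  continuous (fun x : R => g (cintegral S (fun t => phi t * cexpi (x%:C - l) t))).
Proof.
move=> mS SM sphi gle gB x.
have [K K0 KP] := paley_wiener_lipschitz (x%:C - l) mS SM sphi.
apply/(@cvgrPdist_le _ R^o) => e e0; near=> t.
have ht : normc (t - x)%:C <= 1.
  rewrite normc_real; near: t; apply: cvgr_distC_le => //; exact: cvg_id.
have := KP _ ht; rewrite (_ : x%:C - l + (t - x)%:C = t%:C - l); last first.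
  by rewrite rmorphB; ring.
move=> le; rewrite /= distrC -gB; apply: le_trans (gle _) _.
apply: le_trans le _; rewrite normc_real.
have : `|t - x| <= e / (K + 1).
  near: t; apply: cvgr_distC_le; last by rewrite divr_gt0 // ltr_wpDl.
  exact: cvg_id.
rewrite ler_pdivlMr ?ltr_wpDl // => le2; apply: le_trans le2.
by rewrite mulrC ler_wpM2l // lerDl.
Unshelve. all: by end_near. Qed.

Lemma kappa_reE S l (x : R) : kappa S l x%:C =
  cintegral S (fun t => cexpi 0 t * cexpi (x%:C - conjc l) t).
Proof. by rewrite kappaE; apply: eq_cintegral => t _; rewrite cexpi0 mul1r. Qed.

Lemma measurable_kappa S (M : R) l :
  measurable (S : set (measurableTypeR R)) -> (forall t, S t -> `|t| <= M) ->
  measurable_fun setT (fun x : R => Re (kappa S l x%:C)) /\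
  measurable_fun setT (fun x : R => Im (kappa S l x%:C)).
Proof.
move=> mS SM; have s0 := square_integrable_cexpi mS SM 0.
split; apply: continuous_measurable_fun.
- under eq_fun do rewrite kappa_reE.
  exact: (continuous_paley_wiener mS SM s0 (@Re_le_normc R) (@ReB R)).
- under eq_fun do rewrite kappa_reE.
  exact: (continuous_paley_wiener mS SM s0 (@Im_le_normc R) (@ImB R)).
Qed.

Lemma kernel_arg l (x : R) : x%:C - conjc l = (x - Re l) +i* Im l.
Proof. by case: l => u v; apply: complexP => /=; ring. Qed.

Lemma normc_cexpi_le_pi (z : C) (t : R) : `|t| <= pi ->
  normc (cexpi z t) <= expR (pi * `|Im z|).
Proof.
move=> tp; rewrite normc_cexpi ler_expR (le_trans (ler_norm _)) // normrM normrN.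
by rewrite mulrC ler_wpM2r.
Qed.

Lemma itv_le_pi (c d : R) : - pi <= c -> d <= pi ->
  forall t, `[c, d]%classic t -> `|t| <= pi.
Proof.
move=> cp dp t; rewrite /= in_itv /= => /andP[ct td].
by rewrite ler_norml; apply/andP; split; [exact: le_trans ct|exact: le_trans dp].
Qed.

(** Two bounds are merged, with w = x - conj l: the modulus is at most 2 pi e^{pi |y|}, and by the
    primitive its product with |w| is at most 2 e^{pi |y|}. Since (1 + |y|)^2 + u^2 <= 2 (1 +
    |w|^2), a Cauchy density results, whose integral yields the factor 1 / (1 + |Im l|). *)
Lemma kernel_pointwise_upper (c d : R) l (x : R) :
  - pi <= c -> c <= d -> d <= pi ->
  normc (kappa `[c, d] l x%:C) ^+ 2 <=
  2 * (4 * pi ^+ 2 + 4) * expR (2 * pi * `|Im l|) *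
    ((1 + `|Im l|) ^+ 2 + (x - Re l) ^+ 2)^-1.
Proof.
move=> cp cd dp; rewrite kappaE kernel_arg.
set u := x - Re l; set y := Im l; set w := u +i* y.
have wy : Im w = y by [].
set E := expR (pi * `|y|); have E0 : 0 < E by exact: expR_gt0.
have EE : expR (2 * pi * `|y|) = E ^+ 2 by rewrite /E -expRM_natl mulrA.
have bd := itv_le_pi cp dp.
have dcp : d - c <= 2 * pi by lra.
have b1 : normc (cintegral `[c, d] (cexpi w)) <= E * (2 * pi).
  apply: le_trans (_ : E * (d - c) <= _); last by rewrite ler_wpM2l // ltW.
  apply: normc_cintegral_cexpi_le => // t /bd tp.
  by rewrite -normc_cexpi normc_cexpi_le_pi.
have b2 : normc (cintegral `[c, d] (cexpi w)) * normc w <= 2 * E.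
  have [->|w0] := eqVneq w 0; first by rewrite normc0 mulr0 mulr_ge0 // ltW.
  have iw0 : 'i * w != 0 by rewrite mulf_neq0 // eq_complex /= oner_eq0 andbF.
  have nw : normc w = normc ('i * w).
    rewrite normcM (_ : normc 'i = 1) ?mul1r //.
    by rewrite /= expr0n expr1n add0r sqrtr1.
  rewrite cintegral_cexpi // nw -normcM mulfVK // (le_trans (normcD _ _)) // normcN.
  have dd : `|d| <= pi by apply: bd; rewrite /= in_itv /= lexx cd.
  have cc : `|c| <= pi by apply: bd; rewrite /= in_itv /= lexx cd.
  have := normc_cexpi_le_pi w dd; have := normc_cexpi_le_pi w cc.
  by rewrite wy -/E; lra.
have n0 := normc_ge0 (cintegral `[c, d] (cexpi w)).
move: (normc (cintegral `[c, d] (cexpi w))) b1 b2 n0 => N b1 b2 N0.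
have w0 := normc_ge0 w.
have w2 : normc w ^+ 2 = u ^+ 2 + y ^+ 2 by rewrite normc2E.
have b1' : N ^+ 2 <= (E * (2 * pi)) ^+ 2.
  by rewrite ler_sqr ?nnegrE // ?mulr_ge0 ?pi_ge0 // ltW.
have b2' : N ^+ 2 * (u ^+ 2 + y ^+ 2) <= (2 * E) ^+ 2.
  by rewrite -w2 -exprMn ler_sqr ?nnegrE ?mulr_ge0 // ltW.
have m0 : 0 < (1 + `|y|) ^+ 2 + u ^+ 2.
  by rewrite ltr_wpDr ?sqr_ge0 // exprn_gt0 // ltr_wpDr.
rewrite EE ler_pdivlMr //.
have : (1 + `|y|) ^+ 2 + u ^+ 2 <= 2 * (1 + (u ^+ 2 + y ^+ 2)).
  have := sqr_ge0 (1 - `|y|); have := sqr_ge0 u.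
  rewrite -[y ^+ 2]real_normK ?num_real // !expr2; nra.
move=> le; apply: le_trans (ler_wpM2l (sqr_ge0 N) le) _.
rewrite mulrCA mulrDr mulr1 -!mulrA ler_pM2l //.
rewrite !exprMn in b1' b2'; rewrite mulrDl; nra.
Qed.

Lemma kernel_integral_upper (f : R -> C) (A m p : R) : 0 < m ->
  measurable_fun setT (fun x => Re (f x)) ->
  measurable_fun setT (fun x => Im (f x)) ->
  (forall x, normc (f x) ^+ 2 <= A * (m ^+ 2 + (x - p) ^+ 2)^-1) ->
  square_integrable setT f /\ sqn setT f <= A * (pi / m).
Proof.
move=> m0 m1 m2 le.
have den x : 0 < m ^+ 2 + (x - p) ^+ 2 by rewrite ltr_wpDr ?sqr_ge0 ?exprn_gt0.
have A0 : 0 <= A.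
  have := le_trans (sqr_ge0 _) (le p); rewrite pmulr_lge0 // invr_gt0.
  exact: den.
pose q (x : R) := (m ^+ 2 + (x - p) ^+ 2)^-1.
have mq : measurable_fun setT q.
  apply: continuous_measurable_fun => x; apply: cvgV; first by rewrite gt_eqF.
  apply: cvgD; first exact: cvg_cst.
  rewrite expr2; under eq_fun do rewrite expr2.
  by apply: cvgM; (apply: cvgB; [exact: cvg_id|exact: cvg_cst]).
have q0 x : 0 <= q x by rewrite invr_ge0 ltW.
have iq : mu.-integrable setT (EFin \o q).
  apply/integrableP; split; first exact/measurable_EFinP.
  under eq_integral do rewrite /= ger0_norm //.
  by apply: le_lt_trans (cauchy_density_integral p m0) _; exact: ltry.
have sf : square_integrable setT f.
  apply: (@square_integrable_le _ _ measurableT _ (fun x => A * q x)) => //.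
  have := integrableZl measurableT A iq; apply: eq_integrable => // x _ /=.
split => //; have [_ _ i3] := sf.
apply: le_trans (_ : (\int[mu]_x (A * q x))%R <= _).
  apply: le_Rintegral => //.
  have := integrableZl measurableT A iq; apply: eq_integrable => // x _ /=.
rewrite RintegralZl // ler_wpM2l // -lee_fin /Rintegral.
by rewrite fineK ?integrable_fin_num // cauchy_density_integral.
Qed.

Lemma sqn_setT_ge (f : R -> C) (c x1 x2 : R) : square_integrable setT f ->
  x1 <= x2 -> 0 <= c -> (forall x, x1 <= x <= x2 -> c <= normc (f x)) ->
  c ^+ 2 * (x2 - x1) <= sqn setT f.
Proof.
move=> [_ _ i3] x12 c0 le.
have mD : measurable (`[x1, x2] : set (measurableTypeR R)) by [].
have i4 : mu.-integrable `[x1, x2] (fun t => (normc (f t) ^+ 2)%:E).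
  exact: integrableS i3.
apply: le_trans (_ : sqn `[x1, x2] f <= _); last first.
  rewrite -lee_fin /sqn /Rintegral !fineK ?integrable_fin_num //.
  by apply: ge0_subset_integral => //; [exact: measurable_int i3|
    move=> x _; rewrite lee_fin sqr_ge0].
have c2 : c ^+ 2 * (x2 - x1) = (\int[mu]_(t in `[x1, x2]) c ^+ 2)%R.
  rewrite Rintegral_cst //; have := lebesgue_measure_itv `[x1, x2].
  rewrite /= lte_fin => ->; case: ltgtP x12 => // -> _.
  by rewrite subrr mulr0.
rewrite c2; apply: le_Rintegral => //.
  exact: (integrable_cst_bounded mD (@itv_bounded R x1 x2) (c ^+ 2)).
by move=> x; rewrite /= in_itv /= => /le cle; rewrite ler_sqr // nnegrE ?normc_ge0.
Qed.

End KernelNorms.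

Section KernelNormBounds.
Context {R : realType}.
Local Notation C := R[i].
Local Notation mu := (@lebesgue_measure R).
Implicit Types (S : set R) (l z : C).

Lemma pi_le4 : pi <= 4 :> R.
Proof. by have /andP[_ p] := @pihalf_02 R; move: p; lra. Qed.

(** Stated for the real part so that the bounds for two intervals can be added. With |x - Re l| <=
    1/8 and |t| <= pi <= 4 the phase is at most 1/2, hence the cosine at least 1/2. *)
Lemma kernel_pointwise_lower (c d : R) l (x : R) :
  - pi <= c -> c <= d -> d <= pi -> `|x - Re l| <= 1 / 8 ->
  expR (- (pi * `|Im l|)) / 2 * (d - c) <= Re (kappa `[c, d] l x%:C).
Proof.
move=> cp cd dp; rewrite kappaE kernel_arg.
set u := x - Re l; set y := Im l; set w := u +i* y => u8.
have mD : measurable (`[c, d] : set (measurableTypeR R)) by [].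
have bd := itv_le_pi cp dp.
set k := expR _ / 2.
have -> : k * (d - c) = (\int[mu]_(t in `[c, d]) k)%R.
  rewrite Rintegral_cst //; have := lebesgue_measure_itv `[c, d].
  rewrite /= lte_fin => ->; case: ltgtP cd => // -> _.
  by rewrite subrr mulr0.
apply: le_Rintegral => //.
- exact: (integrable_cst_bounded mD bd k).
- by have [] := cintegrable_cexpi mD bd w.
move=> t /bd tp; rewrite cexpiE /= /k; apply: ler_pM => //.
- by rewrite ler_expR lerNl mulNr opprK (le_trans (ler_norm _)) // normrM mulrC ler_wpM2r.
have := normc_cexpi_sub1_le u%:C t; rewrite normc_real [Im _]/= normr0 mul0r expR0 mulr1.
move=> le; have := le_trans (Re_le_normc _) le.
rewrite ReB (_ : Re (cexpi u%:C t) = cos (u * t)); last first.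
  by rewrite cexpiE /= oppr0 mul0r expR0 mul1r.
move=> /ler_normlP[le1 _].
have : `|u| * `|t| <= 1 / 8 * 4 by apply: ler_pM => //; rewrite (le_trans tp) // pi_le4.
by move: le1; rewrite [Re 1]/=; lra.
Qed.

Lemma square_integrable_kappa (c d : R) l : - pi <= c -> c <= d -> d <= pi ->
  square_integrable setT (fun x : R => kappa `[c, d] l x%:C) /\
  sqn setT (fun x : R => kappa `[c, d] l x%:C) <=
  2 * (4 * pi ^+ 2 + 4) * expR (2 * pi * `|Im l|) * (pi / (1 + `|Im l|)).
Proof.
move=> cp cd dp.
have [m1 m2] := measurable_kappa l (measurable_itv `[c, d]) (itv_le_pi cp dp).
apply: (kernel_integral_upper _ m1 m2) => [|x]; first by rewrite ltr_wpDr.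
exact: kernel_pointwise_upper.
Qed.

Lemma kernel_norm_lower : exists2 k : R, 0 < k & forall l,
  k * expR (2 * pi * `|Im l|) / (1 + `|Im l|) <= pw_norm (kappa `[- pi, pi] l) ^+ 2.
Proof.
have pi0 := pi_gt0 R.
have pp : - pi <= pi :> R by lra.
(* Case |Im l| <= 1: the pointwise bound squared, times the window length 1/4, times e^{-2 pi} to
   offset e^{2 pi |Im l|}. *)
pose k1 : R := (expR (- pi) / 2 * (2 * pi)) ^+ 2 / 4 * expR (- (2 * pi)).
(* Case |Im l| > 1: on the window |x - Re l| <= |y| the modulus is at least e^{pi |y|} / (4 |y|),
   and its square times the length 2 |y| is e^{2 pi |y|} / (8 |y|). *)
pose k2 : R := 1 / 8.
have k10 : 0 < k1.
  by rewrite mulr_gt0 ?expR_gt0 // divr_gt0 // exprn_gt0 // mulr_gt0 ?divr_gt0 ?expR_gt0 ?mulr_gt0.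
pose k := Num.min k1 k2.
have k0 : 0 < k by rewrite lt_min k10 /k2 divr_gt0.
exists ((2 * pi)^-1 * k); first by rewrite mulr_gt0 // invr_gt0 mulr_gt0.
move=> l; have [sk _] := square_integrable_kappa l (lexx _) pp (lexx _).
rewrite pw_normE sqr_sqrtr; last by rewrite mulr_ge0 ?sqn_ge0 // invr_ge0 mulr_ge0 // ltW.
rewrite -!mulrA ler_pM2l ?invr_gt0 ?mulr_gt0 // mulrA.
set y := Im l; set E := expR (2 * (pi * `|y|)).
have y1 : 0 < 1 + `|y| by rewrite ltr_wpDr.
have E0 : 0 < E by exact: expR_gt0.
have [yl|yg] := leP `|y| 1.
  have lo x : Re l - 1 / 8 <= x <= Re l + 1 / 8 ->
      expR (- pi) / 2 * (2 * pi) <= normc (kappa `[- pi, pi] l x%:C).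
    move=> /andP[x1 x2].
    have u8 : `|x - Re l| <= 1 / 8 by rewrite ler_distl x1 x2.
    have := kernel_pointwise_lower (lexx _) pp (lexx _) u8.
    move=> /le_trans /(_ (le_trans (ler_norm _) (Re_le_normc _))); apply: le_trans.
    have -> : pi - - pi = 2 * pi :> R by ring.
    rewrite ler_pM2r ?mulr_gt0 // ler_pM2r ?invr_gt0 // ler_expR lerN2.
    by rewrite -[leRHS]mulr1 ler_pM2l.
  have := sqn_setT_ge sk (_ : Re l - 1 / 8 <= Re l + 1 / 8) _ lo.
  have -> : Re l + 1 / 8 - (Re l - 1 / 8) = 4^-1 by field.
  move=> H; apply: le_trans (H _ _); last 2 first.
  - lra.
  - by rewrite mulr_ge0 ?mulr_ge0 ?expR_ge0 ?invr_ge0 // ltW.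
  rewrite ler_pdivrMr //; apply: le_trans (_ : k1 * E <= _).
    by apply: ler_wpM2r; [exact: ltW|rewrite /k ge_min lexx].
  have EE : E <= expR (2 * pi).
    by rewrite ler_expR ler_pM2l // -[leRHS]mulr1 ler_pM2l.
  rewrite /k1 -mulrA; set A := _ / 4; have A0 : 0 <= A.
    by rewrite /A divr_ge0 ?sqr_ge0.
  rewrite ler_wpM2l //; apply: le_trans (_ : 1 <= _); last by rewrite lerDl.
  by rewrite expRN mulrC ler_pdivrMr ?expR_gt0 // mul1r.
have y0 : 0 < `|y| by apply: lt_trans yg.
pose e := expR (pi * `|y|).
have e0 : 0 < e by exact: expR_gt0.
have Ee : E = e ^+ 2 by rewrite /E /e -expRM_natl.
have e2 : 2 <= e.
  apply: le_trans (expR_ge1Dx _); have := pi_ge2 R.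
  have : pi * 1 <= pi * `|y| by rewrite ler_pM2l // ltW.
  by lra.
have lo x : Re l - `|y| <= x <= Re l + `|y| ->
    e / 2 / (2 * `|y|) <= normc (kappa `[- pi, pi] l x%:C).
  move=> /andP[x1 x2]; rewrite kappaE kernel_arg -/y.
  set u := x - Re l; set w := u +i* y.
  have uy : `|u| <= `|y| by rewrite ler_norml /u; apply/andP; split; lra.
  have wn : normc w <= 2 * `|y|.
    have -> : w = u%:C + 'i * y%:C by apply: complexP; rewrite ?ReD ?ImD ?ReM ?ImM /=; ring.
    apply: le_trans (normcD _ _) _; rewrite normcM !normc_real (_ : normc 'i = 1); last first.
      by rewrite /= expr0n expr1n add0r sqrtr1.
    lra.
  have w0 : w != 0.
    apply/eqP => /(congr1 (@complex.Im R)) /= yz.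
    by rewrite yz normr0 ltxx in y0.
  have iw0 : 'i * w != 0 by rewrite mulf_neq0 // eq_complex /= oner_eq0 andbF.
  rewrite cintegral_cexpi // normcM normcV (normcM 'i) (_ : normc 'i = 1); last first.
    by rewrite /= expr0n expr1n add0r sqrtr1.
  rewrite mul1r; have nw : 0 < normc w by rewrite lt0r normc_eq0 w0 normc_ge0.
  apply: ler_pM => //.
  + by rewrite divr_ge0 // ltW.
  (* The sign of y decides which endpoint carries e^{pi |y|}; the other term has modulus at most
     1. *)
  + have : e - 1 <= normc (cexpi w pi - cexpi w (- pi)).
      have en : expR (- (pi * `|y|)) <= 1 by rewrite expR_le1 oppr_le0 mulr_ge0 // ltW.
      have [yn|yp] := leP 0 y.
        have := normc_le_addB (cexpi w (- pi)) (cexpi w pi).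
        rewrite -[normc (cexpi w (- pi) - _)]normcN opprB !normc_cexpi /=.
        by rewrite mulrNN mulNr [y * pi]mulrC -(ger0_norm yn) -/e; lra.
      have := normc_le_addB (cexpi w pi) (cexpi w (- pi)).
      rewrite !normc_cexpi /= mulrNN [y * pi]mulrC -mulNr.
      have yE : y = - `|y| by rewrite ltr0_norm // opprK.
      rewrite {1 2}yE opprK mulrN [`|y| * pi]mulrC -/e; lra.
    by move: e2; lra.
  + by rewrite lef_pV2 ?posrE // mulr_gt0.
have := sqn_setT_ge sk (_ : Re l - `|y| <= Re l + `|y|) _ lo.
have -> : Re l + `|y| - (Re l - `|y|) = 2 * `|y| by ring.
move=> H; apply: le_trans (H _ _); last 2 first.
- lra.
- by rewrite !divr_ge0 ?mulr_ge0 // ltW.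
have -> : (e / 2 / (2 * `|y|)) ^+ 2 * (2 * `|y|) = k2 * E / `|y|.
  by rewrite Ee /k2; field; rewrite gt_eqF.
apply: ler_pM; rewrite ?mulr_ge0 ?invr_ge0 ?(ltW k0) ?(ltW E0) ?(ltW y1) //.
  by apply: ler_wpM2r; [exact: ltW|rewrite /k ge_min lexx orbT].
by rewrite lef_pV2 ?posrE ?mulr_gt0 //; lra.
Qed.

End KernelNormBounds.

Section KernelNormRelations.
Context {R : realType}.
Local Notation C := R[i].
Local Notation mu := (@lebesgue_measure R).
Implicit Types (S : set R) (l z : C).

Lemma cintegral_setU S T (h : R -> C) :
  measurable (S : set (measurableTypeR R)) ->
  measurable (T : set (measurableTypeR R)) -> [disjoint S & T] ->
  cintegrable (S `|` T) h ->
  cintegral (S `|` T) h = cintegral S h + cintegral T h.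
Proof.
move=> mS mT dis [h1 h2].
by apply: complexP => /=; rewrite -Rintegral_setU.
Qed.

Lemma disjoint_itv (a b c d : R) : b < c -> [disjoint `[a, b] & `[c, d]].
Proof.
move=> bc; apply/disj_setPS => t [] /=; rewrite !in_itv /= => /andP[_ tb] /andP[ct _].
by have := lt_le_trans bc (le_trans ct tb); rewrite ltxx.
Qed.

(** With [kernel_norm_lower] this bounds the ratio of the kernel norms of E and [-pi, pi]. For
    positivity: near x = Re l the kernels of the two intervals both have positive real part and
    cannot cancel. *)
Lemma kernel_norm_union (a b : R) : - pi < a -> a < b -> b < pi ->
  exists2 K : R, 0 < K & forall l,
    0 < pw_norm (kappa (`[- pi, a] `|` `[b, pi]) l) /\
    pw_norm (kappa (`[- pi, a] `|` `[b, pi]) l) ^+ 2 <=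
      K * expR (2 * pi * `|Im l|) / (1 + `|Im l|).
Proof.
move=> pa ab bp; have pi0 := pi_gt0 R.
have ap : a <= pi by rewrite ltW // (lt_trans ab).
have pb : - pi <= b by rewrite ltW // (lt_trans pa).
have m1 : measurable (`[- pi, a] : set (measurableTypeR R)) by [].
have m2 : measurable (`[b, pi] : set (measurableTypeR R)) by [].
have bd t : (`[- pi, a] `|` `[b, pi])%classic t -> `|t| <= pi.
  by case=> [/(itv_le_pi (lexx _) ap)|/(itv_le_pi pb (lexx _))].
have kE l (x : R) : kappa (`[- pi, a] `|` `[b, pi]) l x%:C =
    kappa `[- pi, a] l x%:C + kappa `[b, pi] l x%:C.
  rewrite !kappaE cintegral_setU //; first exact: disjoint_itv.
  by apply: (cintegrable_cexpi _ bd); exact: measurableU.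
pose A : R := 2 * (4 * pi ^+ 2 + 4).
exists (4 * A); first by rewrite !mulr_gt0 // ltr_wpDl // mulr_ge0 // sqr_ge0.
move=> l.
have [s1 b1] := square_integrable_kappa l (lexx _) (ltW pa) ap.
have [s2 b2] := square_integrable_kappa l pb (ltW bp) (lexx _).
have sE : sqn setT (fun x : R => kappa (`[- pi, a] `|` `[b, pi]) l x%:C) =
    sqn setT (fun x : R => kappa `[- pi, a] l x%:C + kappa `[b, pi] l x%:C).
  by apply: eq_sqn => x _; exact: kE.
rewrite pw_normE sE; split.
  rewrite sqrtr_gt0 mulr_gt0 ?invr_gt0 ?mulr_gt0 //.
  pose c : R := expR (- (pi * `|Im l|)) / 2 * (a - - pi) + expR (- (pi * `|Im l|)) / 2 * (pi - b).
  have c0 : 0 < c.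
    by rewrite addr_gt0 // mulr_gt0 ?divr_gt0 ?expR_gt0 // subr_gt0.
  have lo x : Re l - 1 / 8 <= x <= Re l + 1 / 8 ->
      c <= normc (kappa `[- pi, a] l x%:C + kappa `[b, pi] l x%:C).
    move=> /andP[x1 x2].
    have u8 : `|x - Re l| <= 1 / 8 by rewrite ler_distl x1 x2.
    apply: le_trans (le_trans (ler_norm _) (Re_le_normc _)); rewrite ReD.
    by apply: lerD; apply: kernel_pointwise_lower => //; exact: ltW.
  have sD := square_integrableD measurableT s1 s2.
  have l8 : Re l - 1 / 8 < Re l + 1 / 8 by rewrite ltrD2l gtrN // divr_gt0.
  apply: lt_le_trans (sqn_setT_ge sD (ltW l8) (ltW c0) lo).
  by rewrite mulr_gt0 ?exprn_gt0 // subr_gt0.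
rewrite sqr_sqrtr; last by rewrite mulr_ge0 ?sqn_ge0 // invr_ge0 mulr_ge0 // ltW.
have := parallelogram measurableT s1 s2.
have := sqn_ge0 setT (fun x : R => kappa `[- pi, a] l x%:C - kappa `[b, pi] l x%:C).
move: (sqn _ _) (sqn _ _) (sqn _ _) (sqn _ _) b1 b2 => x0 x1 x2 x3.
have y1 : 0 < 1 + `|Im l| by rewrite ltr_wpDr.
rewrite -/A; set E := expR _ => b1 b2 x00 par; clear -b1 b2 x00 par y1 pi0.
rewrite mulrC ler_pdivrMr ?mulr_gt0 //.
have : x0 <= 4 * (A * E * (pi / (1 + `|Im l|))) by lra.
move=> /le_trans; apply.
have E0 : 0 < E by exact: expR_gt0.
have A0 : 0 <= A by rewrite mulr_ge0 // addr_ge0 // mulr_ge0 // sqr_ge0.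
have p0 : 0 <= A * E * (pi / (1 + `|Im l|)).
  exact: (mulr_ge0 (mulr_ge0 A0 (ltW E0)) (divr_ge0 (ltW pi0) (ltW y1))).
rewrite (_ : 4 * A * E / _ * _ = 8 * (A * E * (pi / (1 + `|Im l|)))); first by lra.
by ring.
Qed.

(** Reflecting the spectral variable gives, at real x, the kernel at conj t as e^{i(x-t)(a+b)} times
    the conjugate of the kernel at t. This identifies the norm in (iii) with the weight that the
    reflection produces. *)
Lemma pw_norm_kappa_conj (a b : R) (t : C) : - pi <= a -> a <= b -> b <= pi ->
  pw_norm (kappa `[a, b] (conjc t)) =
  expR (Im t * (a + b)) * pw_norm (kappa `[a, b] t).
Proof.
move=> pa ab bp; have mS : measurable (`[a, b] : set (measurableTypeR R)) by [].
have bd := @itv_bounded R a b.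
rewrite !pw_normE.
have ptw (x : R) : normc (kappa `[a, b] (conjc t) x%:C) =
    expR (Im t * (a + b)) * normc (kappa `[a, b] t x%:C).
  rewrite !kappaE conjcK.
  have -> : cintegral `[a, b] (cexpi (x%:C - t)) =
      cexpi (x%:C - t) (a + b) * conjc (cintegral `[a, b] (cexpi (x%:C - conjc t))).
    rewrite -(cintegral_reflect (cintegrable_cexpi mS bd _)).
    rewrite -(cintegral_conj mS (cintegrable_cexpi mS bd _)).
    rewrite -cintegralZ; [|exact: mS|]; last first.
      rewrite (_ : (fun s => conjc _) = cexpi (t - x%:C)); first exact: cintegrable_cexpi mS bd _.
      apply: funext => s; rewrite /cexpi -cexp_conj; congr cexp.
      by case: (t) => u v; apply: complexP => /=; ring.
    apply: eq_cintegral => s _; rewrite /cexpi -cexp_conj -cexpD; congr cexp.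
    by case: (t) => u v; apply: complexP => /=; ring.
  rewrite normcM normc_conj normc_cexpi; congr (expR _ * _).
  by case: (t) => u v /=; ring.
have [sk _] := square_integrable_kappa t pa ab bp.
have -> : sqn setT (fun x : R => kappa `[a, b] (conjc t) x%:C) =
    sqn setT (fun x : R => (expR (Im t * (a + b)))%:C * kappa `[a, b] t x%:C).
  apply: eq_Rintegral => x _; rewrite ptw normcM normc_real ger0_norm ?expR_ge0 //.
rewrite (sqnZ measurableT _ sk) normc_real real_normK ?num_real // mulrCA.
by rewrite sqrtrM ?sqr_ge0 // sqrtr_sqr ger0_norm ?expR_ge0.
Qed.

End KernelNormRelations.

(** * Restriction and extension by zero of spectra *)

Section Restriction.
Context {R : realType}.
Local Notation C := R[i].
Local Notation mu := (@lebesgue_measure R).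

Definition cut (S : set R) (phi : R -> C) (t : R) : C := if t \in S then phi t else 0.

Variables (S T : set R).
Hypothesis mS : measurable (S : set (measurableTypeR R)).
Hypothesis mT : measurable (T : set (measurableTypeR R)).
Hypothesis ST : S `<=` T.
Implicit Types (phi : R -> C).

Lemma square_integrable_subset phi : square_integrable T phi -> square_integrable S phi.
Proof.
move=> [mr mi i]; split; [exact: measurable_funS mT ST mr|exact: measurable_funS mT ST mi|].
exact: integrableS mT mS ST i.
Qed.

Lemma nrm_subset phi : square_integrable T phi -> nrm S phi <= nrm T phi.
Proof.
move=> st; have [_ _ i2] := square_integrable_subset st; have [_ _ i1] := st.
rewrite /nrm ler_wsqrtr // /sqn /Rintegral fine_le //; [exact: integrable_fin_num..|].
apply: ge0_subset_integral => //; first exact: measurable_int i1.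
by move=> t _; rewrite lee_fin sqr_ge0.
Qed.

Lemma cut_mul phi (h : R -> C) t : cut S phi t * h t = cut S (fun t => phi t * h t) t.
Proof. by rewrite /cut; case: ifP; rewrite ?mul0r. Qed.

Lemma Re_cut phi : (fun t => Re (cut S phi t)) = (fun t => Re (phi t)) \_ S.
Proof. by apply/funext => t; rewrite /cut /patch; case: ifP. Qed.

Lemma Im_cut phi : (fun t => Im (cut S phi t)) = (fun t => Im (phi t)) \_ S.
Proof. by apply/funext => t; rewrite /cut /patch; case: ifP. Qed.

Lemma cintegral_cut phi : cintegral T (cut S phi) = cintegral S phi.
Proof.
have TS : T `&` S = S by apply/setIidPr.
by apply: complexP => /=; rewrite ?Re_cut ?Im_cut -Rintegral_mkcondr TS.
Qed.

Lemma square_integrable_cut phi : square_integrable S phi -> square_integrable T (cut S phi).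
Proof.
move=> [mr mi i]; have TS : T `&` S = S by apply/setIidPr.
split.
- by rewrite Re_cut; apply/(measurable_restrict _ mS mT); rewrite TS.
- by rewrite Im_cut; apply/(measurable_restrict _ mS mT); rewrite TS.
have -> : (fun t => (normc (cut S phi t) ^+ 2)%:E) = (fun t => (normc (phi t) ^+ 2)%:E) \_ S.
  by apply/funext => t; rewrite /cut /patch; case: ifP => // _; rewrite normc0 expr0n.
by apply/(integrable_restrict _ mS mT); rewrite TS.
Qed.

End Restriction.

(** * Division by z - t on the spectral side *)

Section TriangleFubini.
Context {R : realType}.
Local Notation C := R[i].
Local Notation mu := (@lebesgue_measure R).
Variables c d : R.
Let I : set R := `[c, d].
Let mI : measurable (I : set (measurableTypeR R)). Proof. exact: measurable_itv. Qed.

(** Both sides integrate B(s) A(u) over the triangle c <= s <= u <= d. Integrability of the two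
    products belongs to the conclusion, since nothing is known beforehand about the measurability of
    [H] and [K]. *)
Lemma triangle_fubini (A B : R -> R) :
  mu.-integrable I (EFin \o A) -> mu.-integrable I (EFin \o B) ->
  let H s := (\int[mu]_(u in `[s, d]) A u)%R in
  let K u := (\int[mu]_(s in `[c, u]) B s)%R in
  [/\ mu.-integrable I (EFin \o (fun s => B s * H s)),
      mu.-integrable I (EFin \o (fun u => A u * K u)),
      (\int[mu]_(s in I) (B s * H s) = \int[mu]_(u in I) (A u * K u))%R &
      measurable_fun I (fun s => B s * H s)].
Proof.
move=> iA iB H K.
have iA' : mu.-integrable setT (EFin \o (A \_ I)).
  by rewrite -restrict_EFin; apply/(integrable_mkcond _ mI).
have iB' : mu.-integrable setT (EFin \o (B \_ I)).
  by rewrite -restrict_EFin; apply/(integrable_mkcond _ mI).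
have /measurable_int/measurable_EFinP mA' := iA'.
have /measurable_int/measurable_EFinP mB' := iB'.
pose T := measurableTypeR R.
pose le (z : T * T) : R := if z.1 <= z.2 :> R then 1 else 0.
have mle : measurable_fun setT le.
  apply: measurable_fun_ifT => //.
  by apply: (@measurable_fun_ler _ _ R _ fst snd).
pose f (z : T * T) : \bar R := ((B \_ I) z.1 * ((A \_ I) z.2 * le z))%:E.
have mf : measurable_fun setT f.
  apply/measurable_EFinP; apply: measurable_funM.
    exact: measurableT_comp mB' _.
  apply: measurable_funM => //.
  exact: measurableT_comp mA' _.
have le01 z : `|le z| <= 1 by rewrite /le; case: ifP; rewrite ?normr1 ?normr0.
have imf : (mu \x mu)%E.-integrable setT f.
  apply/integrable12ltyP => //.
  have /integrableP[_ MA] := iA'; have /integrableP[_ MB] := iB'.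
  set a := (\int[mu]_x `|(EFin \o (A \_ I)) x|)%E in MA.
  have mabsA : measurable_fun setT (fun x => `|(EFin \o (A \_ I)) x|)%E.
    by apply: measurableT_comp => //; exact/measurable_EFinP.
  have mabsB : measurable_fun setT (fun x => `|(EFin \o (B \_ I)) x|)%E.
    by apply: measurableT_comp => //; exact/measurable_EFinP.
  have a0 : (0 <= a)%E by exact: integral_ge0.
  have af : a \is a fin_num by rewrite ge0_fin_numE.
  apply: (@le_lt_trans _ _ (\int[mu]_x (a * `|(EFin \o (B \_ I)) x|))%E); last first.
    rewrite ge0_integralZl //.
    by rewrite lte_mul_pinfty.
  apply: ge0_le_integral => //.
  - by move=> x _; exact: integral_ge0.
  - apply: (@measurable_fun_fubini_tonelli_F _ _ _ _ R mu (abse \o f));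
      [exact: measurableT_comp | by move=> x; exact: abse_ge0].
  - exact: measurable_funeM.
  move=> x _; rewrite /a -ge0_integralZr //.
  apply: ge0_le_integral => //.
  - by apply: measurableT_comp => //; exact: measurableT_comp mf _.
  - exact: emeasurable_funM.
  move=> y _; rewrite /f /= -EFinM lee_fin !normrM mulrC ler_wpM2r //.
  by rewrite -[leRHS]mulr1 ler_wpM2l.
have iH s : I s -> (\int[mu]_(u in `[s, d]) (A u)%:E)%E = (H s)%:E.
  move=> Is; rewrite /H /Rintegral fineK //; apply: integrable_fin_num => //.
  apply: integrableS iA => //; apply: subset_itv; rewrite bnd_simp //.
  by move: Is; rewrite /I /= in_itv /= => /andP[].
have iK u : I u -> (\int[mu]_(s in `[c, u]) (B s)%:E)%E = (K u)%:E.
  move=> Iu; rewrite /K /Rintegral fineK //; apply: integrable_fin_num => //.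
  apply: integrableS iB => //; apply: subset_itv; rewrite bnd_simp //.
  by move: Iu; rewrite /I /= in_itv /= => /andP[].
have F1 s : (\int[mu]_u f (s, u) = (((fun s => B s * H s) \_ I) s)%:E)%E.
  rewrite patchE; case: ifPn => [/set_mem Is|sI]; last first.
    rewrite /f /= patchE (negbTE sI).
    by under eq_integral do rewrite mul0r; rewrite integral0.
  have e u : f (s, u) = ((B s)%:E * (EFin \o A \_ `[s, d]) u)%E.
    rewrite /f /= patchE mem_set // -EFinM; congr (_ * _)%:E.
    rewrite /le !patchE /=; move: Is; rewrite /I /= in_itv /= => /andP[cs sd].
    rewrite !mem_setE !in_itv /=; case: (leP s u) => su; rewrite ?mulr1 ?mulr0 //.
    by rewrite (le_trans cs su).
  under eq_integral do rewrite e.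
  rewrite integralZl //; last first.
    have mJ : measurable (`[s, d] : set (measurableTypeR R)) by exact: measurable_itv.
    rewrite -restrict_EFin; apply/(integrable_mkcond _ mJ).
    apply: integrableS iA => //; apply: subset_itv; rewrite bnd_simp //.
    by move: Is; rewrite /I /= in_itv /= => /andP[].
  by rewrite EFinM -iH // [in RHS]integral_mkcond restrict_EFin.
have F2 u : (\int[mu]_s f (s, u) = (((fun u => A u * K u) \_ I) u)%:E)%E.
  rewrite patchE; case: ifPn => [/set_mem Iu|uI]; last first.
    under eq_integral do rewrite /f /= [(A \_ I) _]patchE (negbTE uI) mul0r mulr0.
    by rewrite integral0.
  have e s : f (s, u) = ((A u)%:E * (EFin \o B \_ `[c, u]) s)%E.
    rewrite /f /= [(A \_ I) _]patchE mem_set // -EFinM mulrCA; congr (_ * _)%:E.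
    rewrite /le !patchE /=; move: Iu; rewrite /I /= in_itv /= => /andP[cu ud].
    rewrite !mem_setE !in_itv /=; case: (leP s u) => su; rewrite ?mulr1 ?mulr0 ?andbT ?andbF //.
    by rewrite (le_trans su ud) andbT.
  under eq_integral do rewrite e.
  rewrite integralZl //; last first.
    have mJ : measurable (`[c, u] : set (measurableTypeR R)) by exact: measurable_itv.
    rewrite -restrict_EFin; apply/(integrable_mkcond _ mJ).
    apply: integrableS iB => //; apply: subset_itv; rewrite bnd_simp //.
    by move: Iu; rewrite /I /= in_itv /= => /andP[].
  by rewrite EFinM -iK // [in RHS]integral_mkcond restrict_EFin.
have i1 : mu.-integrable I (EFin \o (fun s => B s * H s)).
  apply/(integrable_mkcond _ mI); rewrite restrict_EFin.
  have := integrable_fubini_F imf; apply: eq_integrable => // s _.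
  by rewrite /fubini_F F1.
have i2 : mu.-integrable I (EFin \o (fun u => A u * K u)).
  apply/(integrable_mkcond _ mI); rewrite restrict_EFin.
  have : mu.-integrable setT (fubini_G mu f).
    apply/integrableP; split; first exact: (measurable_fubini_G imf).
    apply: le_lt_trans ((@integrable21ltyP _ _ _ _ R mu mu f mf).1 imf).
    apply: ge0_le_integral => //.
    - by apply: measurableT_comp => //; exact: (measurable_fubini_G imf).
    - apply: (@measurable_fun_fubini_tonelli_G _ _ _ _ R mu (abse \o f));
      [exact: measurableT_comp | by move=> x; exact: abse_ge0].
    move=> u _; apply: le_abse_integral => //.
    exact: measurableT_comp mf _.
  apply: eq_integrable => // u _.
  by rewrite /fubini_G F2.
have mi1 : measurable_fun I (fun s => B s * H s).
  by apply/measurable_EFinP; exact: measurable_int i1.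
split; [exact: i1|exact: i2| |exact: mi1].
congr fine; rewrite integral_mkcond [RHS]integral_mkcond !restrict_EFin.
transitivity (\int[mu]_s \int[mu]_u f (s, u))%E.
  by apply: eq_integral => s _; rewrite F1.
by rewrite Fubini //; apply: eq_integral => u _; rewrite F2.
Qed.

Lemma ctriangle_fubini (A B : R -> C) : cintegrable I A -> cintegrable I B ->
  let H s := cintegral `[s, d] A in
  let K u := cintegral `[c, u] B in
  [/\ cintegrable I (fun s => B s * H s), cintegrable I (fun u => A u * K u) &
      cintegral I (fun s => B s * H s) = cintegral I (fun u => A u * K u)].
Proof.
move=> [rA iA] [rB iB] H K.
have [i11 j11 e11 _] := triangle_fubini rA rB.
have [i12 j12 e12 _] := triangle_fubini rA iB.
have [i21 j21 e21 _] := triangle_fubini iA rB.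
have [i22 j22 e22 _] := triangle_fubini iA iB.
have eB h1 h2 : mu.-integrable I (EFin \o h1) -> mu.-integrable I (EFin \o h2) ->
    mu.-integrable I (EFin \o (fun t => h1 t - h2 t)).
  by move=> x1 x2; exact: (integrableB mI x1 x2).
have eD h1 h2 : mu.-integrable I (EFin \o h1) -> mu.-integrable I (EFin \o h2) ->
    mu.-integrable I (EFin \o (fun t => h1 t + h2 t)).
  by move=> x1 x2; exact: (integrableD mI x1 x2).
have rE (U V : R -> C) : (fun t => Re (U t * V t)) =
    (fun t => Re (U t) * Re (V t) - Im (U t) * Im (V t)) by apply/funext => t; rewrite ReM.
have iE (U V : R -> C) : (fun t => Im (U t * V t)) =
    (fun t => Re (U t) * Im (V t) + Im (U t) * Re (V t)) by apply/funext => t; rewrite ImM.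
split.
- by split; rewrite ?rE ?iE; [exact: eB i11 i22|exact: eD i21 i12].
- by split; rewrite ?rE ?iE; [exact: eB j11 j22|exact: eD j12 j21].
apply: complexP; rewrite /cintegral /= ?rE ?iE /=.
  by rewrite (RintegralB mI i11 i22) (RintegralB mI j11 j22) e11 e22.
by rewrite (RintegralD mI i21 i12) (RintegralD mI j12 j21) e21 e12 addrC.
Qed.

Lemma cintegral_tail_bounded (phi psi : R -> C) s : I s ->
  square_integrable I phi -> square_integrable I psi ->
  normc (cintegral `[s, d] (fun t => phi t * psi t)) <= nrm I phi * nrm I psi.
Proof.
move=> Is sf sg; have /andP[cs sd] : c <= s <= d by move: Is; rewrite /I /= in_itv.
have mJ : measurable (`[s, d] : set (measurableTypeR R)) by exact: measurable_itv.
have sub : `[s, d] `<=` I by apply: subset_itv; rewrite bnd_simp.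
apply: le_trans (normc_pairing_le mJ _ _) _;
  [exact: square_integrable_subset mJ mI sub _ _..|].
by apply: ler_pM; rewrite ?nrm_ge0 //; exact: nrm_subset.
Qed.

(* With [F = f + z g] and [F t = 0], one has [F z / (z - t) = g z + (f + t g) z / (z - t)],
   and dividing by [z - t] amounts to taking a primitive of the spectrum. *)
Lemma quotient_spectrum (phi gam : R -> C) (t : C) : c <= d ->
  square_integrable I phi -> square_integrable I gam ->
  let A u := (phi u + t * gam u) * cexpi t u in
  let psi s := gam s + 'i * (cexpi (- t) s * cintegral `[s, d] A) in
  cintegral I A = 0 ->
  square_integrable I psi /\
  forall z, (z - t) * cintegral I (fun s => psi s * cexpi z s) =
    cintegral I (fun s => phi s * cexpi z s) + z * cintegral I (fun s => gam s * cexpi z s).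
Proof.
move=> cd sphi sgam A psi A0.
have sE z : square_integrable I (cexpi z) := square_integrable_cexpi mI (@itv_bounded _ c d) z.
have iE z : cintegrable I (cexpi z) := cintegrable_cexpi mI (@itv_bounded _ c d) z.
have schi : square_integrable I (fun u => phi u + t * gam u).
  by apply: square_integrableD => //; exact: square_integrableZ.
have iA : cintegrable I A by exact: cintegrableM.
have sH : square_integrable I (fun s => cexpi (- t) s * cintegral `[s, d] A).
  (* Measurability of the tail integral times e^{-its} is read off from the triangle lemma. *)
  have [[mr mi] _ _] := ctriangle_fubini iA (iE (- t)).
  have k0 s : I s -> normc (cexpi (- t) s) <= expR (`|Im t| * (`|c| + `|d|)).
    move=> /itv_bounded Is; rewrite normc_cexpi ler_expR ImN opprK.
    by apply: le_trans (ler_norm _) _; rewrite normrM ler_wpM2l.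
  apply: (square_integrable_bounded mI (@itv_bounded _ c d)
    (k := expR (`|Im t| * (`|c| + `|d|)) *
       (nrm I (fun u => phi u + t * gam u) * nrm I (cexpi t)))).
  - by apply/measurable_EFinP; exact: measurable_int mr.
  - by apply/measurable_EFinP; exact: measurable_int mi.
  move=> s Is; rewrite normcM ler_pM ?normc_ge0 //; first exact: k0.
  exact: cintegral_tail_bounded.
have siH : square_integrable I (fun s => 'i * (cexpi (- t) s * cintegral `[s, d] A)).
  exact: square_integrableZ.
split=> [|z]; first exact: square_integrableD.
have sHz : cintegrable I (fun s => cexpi (z - t) s * cintegral `[s, d] A).
  by have [] := ctriangle_fubini iA (iE (z - t)).
have -> : cintegral I (fun s => psi s * cexpi z s) =
    cintegral I (fun s => gam s * cexpi z s) +
    'i * cintegral I (fun s => cexpi (z - t) s * cintegral `[s, d] A).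
  rewrite -cintegralZ // -cintegralD //; last first.
  - exact: cintegrableZ.
  - exact: cintegrableM.
  apply: eq_cintegral => s _; rewrite /psi mulrDl cexpiD.
  by rewrite -!mulrA [cexpi z s * _]mulrCA [cexpi z s * _]mulrC.
have [_ _ ->] := ctriangle_fubini iA (iE (z - t)).
have -> : cintegral I (fun s => phi s * cexpi z s) =
    cintegral I (fun s => (phi s + t * gam s) * cexpi z s)
    - t * cintegral I (fun s => gam s * cexpi z s).
  rewrite -[in X in _ - X]cintegralZ //; last exact: cintegrableM.
  rewrite -[- cintegral _ _]mulN1r -cintegralZ -?cintegralD //.
  - by apply: eq_cintegral => s _; ring.
  - exact: cintegrableM.
  - by do 2 apply: cintegrableZ => //; exact: cintegrableM.
  - by apply: cintegrableZ => //; exact: cintegrableM.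
have [->|zt] := eqVneq z t.
  have -> : cintegral I (fun s => (phi s + t * gam s) * cexpi t s) = 0 := A0.
  by rewrite subrr mul0r; ring.
have ziN0 : 'i * (z - t) != 0 by rewrite mulf_neq0 ?subr_eq0 // neq0Ci.
(* The inner integral is (e^{i(z-t)u} - e^{i(z-t)c}) / (i(z-t)); its constant part multiplies the
   integral of [A], which is zero. *)
have -> : cintegral I (fun u => A u * cintegral `[c, u] (cexpi (z - t))) =
    cintegral I (fun s => (phi s + t * gam s) * cexpi z s) / ('i * (z - t)).
  rewrite [RHS]mulrC.
  have <- : cintegral I (fun s => (phi s + t * gam s) * cexpi z s)
      - cexpi (z - t) c * cintegral I A =
    cintegral I (fun s => (phi s + t * gam s) * cexpi z s) by rewrite A0 mulr0 subr0.
  rewrite -mulNr -cintegralZ // -cintegralD //; last first.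
  - exact: cintegrableZ.
  - exact: cintegrableM.
  rewrite -cintegralZ //; last first.
    by apply: cintegrableD => //; [exact: cintegrableM|exact: cintegrableZ].
  apply: eq_cintegral => u; rewrite /I /= in_itv /= => /andP[cu ud].
  rewrite cintegral_cexpi //; last by rewrite subr_eq0.
  rewrite /A [in RHS](_ : cexpi z u = cexpi (z - t) u * cexpi t u); last first.
    by rewrite -cexpiD subrK.
  by move: ('i * (z - t))^-1 => v; ring.
rewrite mulrDr [X in _ + X]mulrA [X in _ + X * _]mulrC [X in _ + X]mulrC divfK //.
by ring.
Qed.
End TriangleFubini.

(** * The quotients F(z) / (F'(t) (z - t)) *)

Section GeneratingFunction.
Context {R : realType}.
Local Notation C := R[i].
Implicit Types (F : C -> C) (phi gam : R -> C).

Lemma lt0_complexE (e : C) : 0 < e -> exists2 r : R, 0 < r & e = r%:C.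
Proof. by case: e => r i; rewrite ltcE /= => /andP[/eqP -> r0]; exists r. Qed.

(** Since F(t) = 0, the difference quotient of [F] at t with increment h is f(t + h) itself, so that
    continuity of [f] at t gives the limit. *)
Lemma cderiv_of_quotient F (f : C -> C) (t : C) (K : R) : 0 <= K ->
  (forall z, (z - t) * f z = F z) ->
  (forall h, normc h <= 1 -> normc (f (t + h) - f t) <= K * normc h) ->
  cderiv F t = f t.
Proof.
move=> K0 Ff lip; rewrite /cderiv /derive1.
have Ft : F t = 0 by rewrite -Ff subrr mul0r.
apply: (@cvg_lim C^o (@norm_hausdorff _ C^o)); apply/cvgrPdist_lt => _ /lt0_complexE[e e0 ->].
have d0 : 0 < Num.min 1 (e / (K + 1)) by rewrite lt_min ltr01 divr_gt0 // ltr_wpDl.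
near=> h.
have h0 : h != 0 by near: h; exact: nbhs_dnbhs_neq.
have hd : normc h < Num.min 1 (e / (K + 1)).
  rewrite -ltcR -[(normc h)%:C]/(`|h|); near: h.
  by apply: dnbhs0_lt; rewrite ltcR.
move: hd; rewrite lt_min => /andP[h1 he].
have -> : h^-1 *: (F (h + t) - F t) = f (t + h) :> C^o.
  by rewrite Ft subr0 -Ff addrK [h + t]addrC; rewrite /GRing.scale /= mulKf.
rewrite -normrN opprB -[`|_|]/((normc (f (t + h) - f t))%:C) ltcR.
apply: le_lt_trans (lip _ (ltW h1)) _.
rewrite ltr_pdivlMr // in he; last by rewrite ltr_wpDl.
by apply: le_lt_trans he; rewrite mulrC ler_wpM2l ?normc_ge0 // lerDl.
Unshelve. all: by end_near.
Qed.

(** The spectra of the two parts are extended by zero and added. The last clause holds because, from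
    a point s of the gap on, only the spectrum of F^+ remains. *)
Lemma PW_plus_decomposition (a b : R) (Fm Fp : C -> C) : - pi < a -> a < b -> b < pi ->
  PW_plus_zPW `[- pi, a] Fm -> PW_plus_zPW `[b, pi] Fp ->
  exists phi gam, [/\ square_integrable `[- pi, pi] phi, square_integrable `[- pi, pi] gam,
   (forall z, Fm z + Fp z = cintegral `[- pi, pi] (fun s => phi s * cexpi z s) +
      z * cintegral `[- pi, pi] (fun s => gam s * cexpi z s)),
   (forall s, a < s -> s < b -> gam s = 0) &
   (forall s t, a < s -> s < b ->
     cintegral `[s, pi] (fun u => (phi u + t * gam u) * cexpi t u) = Fp t)].
Proof.
move=> pa ab bp [f1 [g1 [[fm sfm fmE] [gm sgm gmE] FmE]]] [f2 [g2 [[fp sfp fpE] [gp sgp gpE] FpE]]].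
have mI : measurable (`[- pi, pi] : set (measurableTypeR R)) by exact: measurable_itv.
have mm : measurable (`[- pi, a] : set (measurableTypeR R)) by exact: measurable_itv.
have mp : measurable (`[b, pi] : set (measurableTypeR R)) by exact: measurable_itv.
have subm : `[- pi, a] `<=` `[- pi, pi].
  by apply: subset_itv; rewrite bnd_simp ?(ltW (lt_trans ab bp)).
have subp : `[b, pi] `<=` `[- pi, pi].
  by apply: subset_itv; rewrite bnd_simp ?(ltW (lt_trans pa ab)).
have sE := square_integrable_cexpi mI (@itv_bounded _ (- pi) pi).
have scm phi : square_integrable `[- pi, a] phi ->
    square_integrable `[- pi, pi] (cut `[- pi, a] phi).
  exact: square_integrable_cut.
have scp phi : square_integrable `[b, pi] phi ->
    square_integrable `[- pi, pi] (cut `[b, pi] phi).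
  exact: square_integrable_cut.
have intE phi psi z : square_integrable `[- pi, a] phi -> square_integrable `[b, pi] psi ->
    cintegral `[- pi, pi] (fun s => (cut `[- pi, a] phi s + cut `[b, pi] psi s) * cexpi z s) =
    cintegral `[- pi, a] (fun s => phi s * cexpi z s) +
    cintegral `[b, pi] (fun s => psi s * cexpi z s).
  move=> s1 s2; rewrite -(cintegral_cut subm) -(cintegral_cut subp) -cintegralD //.
  - by apply: eq_cintegral => s _; rewrite mulrDl !cut_mul.
  - have : cintegrable `[- pi, pi] (fun s => cut `[- pi, a] phi s * cexpi z s).
      by apply: cintegrableM => //; exact: scm.
    by under [X in cintegrable _ X -> _]eq_fun do rewrite cut_mul.
  - have : cintegrable `[- pi, pi] (fun s => cut `[b, pi] psi s * cexpi z s).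
      by apply: cintegrableM => //; exact: scp.
    by under [X in cintegrable _ X -> _]eq_fun do rewrite cut_mul.
have cut_out (x y : R) phi s : (s < x) || (y < s) -> cut `[x, y] phi s = 0.
  move=> xy; rewrite /cut ifF //; apply/negbTE; apply/negP; rewrite inE /= in_itv /=.
  by move=> /andP[xs sy]; move: xy; rewrite ltNge xs ltNge sy.
exists (fun s => cut `[- pi, a] fm s + cut `[b, pi] fp s),
       (fun s => cut `[- pi, a] gm s + cut `[b, pi] gp s); split.
- by apply: square_integrableD => //; [exact: scm|exact: scp].
- by apply: square_integrableD => //; [exact: scm|exact: scp].
- move=> z; rewrite !intE // FmE FpE fmE gmE fpE gpE; ring.
- by move=> s as_ sb; rewrite !cut_out ?as_ ?sb ?orbT // addr0.
move=> s t as_ sb.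
have subs : `[b, pi] `<=` `[s, pi] by apply: subset_itv; rewrite bnd_simp ?(ltW sb).
have mJ : measurable (`[s, pi] : set (measurableTypeR R)) by exact: measurable_itv.
have sEp := square_integrable_cexpi mp (@itv_bounded _ b pi).
transitivity (cintegral `[b, pi] (fun u => (fp u + t * gp u) * cexpi t u)).
  rewrite -(cintegral_cut subs); apply: eq_cintegral => u; rewrite /= in_itv /= => /andP[su _].
  by rewrite !(cut_out (- pi) a) ?(lt_le_trans as_ su) ?orbT // !add0r -cut_mul /cut;
    case: ifP; rewrite ?mulr0 ?add0r ?mul0r.
rewrite FpE fpE gpE -cintegralZ -?cintegralD //.
- by apply: eq_cintegral => u _; rewrite /cexpi; ring.
- exact: (cintegrableM mp sfp (sEp t)).
- by apply: cintegrableZ => //; exact: (cintegrableM mp sgp (sEp t)).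
- exact: (cintegrableM mp sgp (sEp t)).
Qed.

Lemma generating_quotient (a b : R) F (Fm Fp : C -> C) (t : C) :
  - pi < a -> a < b -> b < pi ->
  PW_plus_zPW `[- pi, a] Fm -> PW_plus_zPW `[b, pi] Fp ->
  (forall z, F z = Fm z + Fp z) -> F t = 0 -> cderiv F t <> 0 ->
  exists g, [/\ square_integrable `[- pi, pi] g,
    cintegral `[- pi, pi] (fun s => g s * cexpi t s) = 1,
    (forall z, F z = 0 -> z != t -> cintegral `[- pi, pi] (fun s => g s * cexpi z s) = 0) &
    (forall s, a < s -> s < b -> g s = 'i * (Fp t / cderiv F t) * cexpi (- t) s)].
Proof.
move=> pa ab bp PWm PWp FE Ft0 F't.
have [phi [gam [sphi sgam FI gam0 tailE]]] := PW_plus_decomposition pa ab bp PWm PWp.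
have mI : measurable (`[- pi, pi] : set (measurableTypeR R)) by exact: measurable_itv.
have sE := square_integrable_cexpi mI (@itv_bounded _ (- pi) pi).
have pipi : - pi <= pi :> R by rewrite (le_trans (ltW pa)) // (le_trans (ltW ab)) // ltW.
have A0 : cintegral `[- pi, pi] (fun u => (phi u + t * gam u) * cexpi t u) = 0.
  rewrite -Ft0 FE FI -cintegralZ -?cintegralD //.
  - by apply: eq_cintegral => u _; ring.
  - exact: (cintegrableM mI sphi (sE t)).
  - by apply: cintegrableZ => //; exact: cintegrableM.
  - exact: (cintegrableM mI sgam (sE t)).
have [spsi psiE] := quotient_spectrum pipi sphi sgam A0.
move: spsi psiE; set psi := (fun s => gam s + _) => spsi psiE.
have [K K0 lip] := paley_wiener_lipschitz t mI (@itv_bounded _ (- pi) pi) spsi.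
(* F'(t) is the value at t of the quotient with spectrum [psi]; dividing [psi] by it makes that
   value 1. *)
have dE : cderiv F t = cintegral `[- pi, pi] (fun s => psi s * cexpi t s).
  apply: (@cderiv_of_quotient F (fun z => cintegral _ (fun s => psi s * cexpi z s)) t K) => // z.
  by rewrite psiE -FI FE.
have gE z : cintegral `[- pi, pi] (fun s => (cderiv F t)^-1 * psi s * cexpi z s) =
    (cderiv F t)^-1 * cintegral `[- pi, pi] (fun s => psi s * cexpi z s).
  rewrite -cintegralZ //; last exact: cintegrableM.
  by apply: eq_cintegral => s _; rewrite mulrA.
exists (fun s => (cderiv F t)^-1 * psi s); split.
- exact: square_integrableZ.
- by rewrite gE -dE mulVf //; exact/eqP.
- move=> z Fz zt; rewrite gE; have := psiE z; rewrite -FI -FE Fz => /eqP.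
  by rewrite mulf_eq0 subr_eq0 (negbTE zt) /= => /eqP ->; rewrite mulr0.
move=> s as_ sb; rewrite /psi gam0 // tailE // add0r.
by move: (cderiv F t)^-1 => v; ring.
Qed.

End GeneratingFunction.

(** * Complete interpolation as existence plus totality *)

Section CompleteInterpolating.
Context {R : realType}.
Local Notation C := R[i].
Implicit Types (G : set C) (a : C -> C).

Lemma ell2_indicator G (l : C) : ell2 G (fun z => if z == l then 1 else 0).
Proof.
apply: (@ell2_of_bounded _ _ _ 1) => s us _.
have [ls|ls] := boolP (l \in s).
  rewrite (bigD1_seq l) //= eqxx normc_real normr1 expr1n big1 ?addr0 // => z /negbTE ->.
  by rewrite normc0 expr0n.
rewrite big_seq big1 // => z zs; case: eqP => [zl|_]; first by rewrite -zl zs in ls.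
by rewrite normc0 expr0n.
Qed.

Lemma ell2_normc_le G (a a' : C -> C) (k : R) : 0 <= k -> ell2 G a' ->
  (forall l, G l -> normc (a l) <= k * normc (a' l)) -> ell2 G a.
Proof.
move=> k0 /bounded_of_ell2[K K0 hK] le.
apply: (@ell2_of_bounded _ _ _ (k ^+ 2 * K)) => s us sG.
apply: (@le_trans _ _ (k ^+ 2 * \sum_(l <- s) normc (a' l) ^+ 2)).
  rewrite mulr_sumr big_seq [leRHS]big_seq ler_sum // => l ls.
  by rewrite -exprMn ler_sqr ?nnegrE ?mulr_ge0 ?normc_ge0 // le //; exact: sG.
by rewrite ler_wpM2l ?sqr_ge0 // hK.
Qed.

Variables (S : set R) (M : R).
Hypothesis mS : measurable (S : set (measurableTypeR R)).
Hypothesis SM : forall t, S t -> `|t| <= M.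
Variable G : set C.
Hypothesis cis : complete_interpolating S G.

(** Division by zero gives zero, so with a zero weight the data equal to 1 at l would have no
    interpolant. *)
Lemma complete_interpolating_weight_gt0 l : G l -> 0 < pw_norm (kappa S l).
Proof.
move=> Gl; rewrite lt_def sqrtr_ge0 andbT; apply/eqP => w0.
have [f [[_ fl] _]] := cis (ell2_indicator G l).
by have := fl l Gl; rewrite w0 eqxx invr0 mulr0 => /eqP; rewrite eq_sym oner_eq0.
Qed.

Lemma complete_interpolating_interpolating :
  interpolating S G (fun l => pw_norm (kappa S l)).
Proof.
move=> a a2; have [f [[[phi sphi fE] fl] _]] := cis a2.
exists phi => // l Gl; have w0 := complete_interpolating_weight_gt0 Gl.
rewrite -(fl l Gl) divfK; last by rewrite fmorph_eq0 gt_eqF.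
by rewrite fE.
Qed.

(** Uniqueness for zero data makes the function with spectrum [psi] zero, and the Fourier transform
    is injective. *)
Lemma complete_interpolating_total : total S G.
Proof.
move=> psi spsi psi0.
have z2 : ell2 G (fun=> 0 : C).
  apply: (@ell2_normc_le _ _ _ 0 _ (ell2_indicator G 0)) => // l _.
  by rewrite mul0r normc0.
have [f [_ uf]] := cis z2.
apply: (fourier_injective mS SM) => // z.
have e1 : f = (fun z => cintegral S (fun t => psi t * cexpi z t)).
  by apply: uf; split; [exists psi|move=> l Gl; rewrite psi0 // mul0r].
have e2 : f = (fun=> 0).
  apply: uf; split; last by move=> l _; rewrite mul0r.
  exists (fun=> 0); first exact: square_integrable0.
  by move=> y; rewrite -[LHS](cintegral0 S); apply: eq_cintegral => t _; rewrite mul0r.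
by rewrite -[LHS]/((fun z => cintegral S (fun t => psi t * cexpi z t)) z) -e1 e2.
Qed.

End CompleteInterpolating.

Section CompleteInterpolatingIntro.
Context {R : realType}.
Local Notation C := R[i].

(** Uniqueness is asked of the function rather than of its spectrum, which avoids statements modulo
    null sets. *)
Lemma complete_interpolating_intro (S : set R) (G : set C) :
  measurable (S : set (measurableTypeR R)) ->
  (exists M : R, forall t, S t -> `|t| <= M) ->
  (forall l, G l -> 0 < pw_norm (kappa S l)) ->
  interpolating S G (fun l => pw_norm (kappa S l)) ->
  (forall phi, square_integrable S phi ->
    (forall l, G l -> cintegral S (fun t => phi t * cexpi l t) = 0) ->
    forall z, cintegral S (fun t => phi t * cexpi z t) = 0) ->
  complete_interpolating S G.
Proof.
move=> mS [M SM] w0 int uniq a a2; have [phi sphi phiE] := int a a2.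
have sE := square_integrable_cexpi mS SM.
exists (fun z => cintegral S (fun t => phi t * cexpi z t)); split.
  split; first by exists phi.
  by move=> l Gl; rewrite phiE // mulfK // fmorph_eq0 gt_eqF // w0.
move=> f [[psi spsi fE] fl]; apply/funext => z; rewrite fE.
apply/eqP; rewrite -subr_eq0; apply/eqP.
have dE y : cintegral S (fun t => (phi t - psi t) * cexpi y t) =
    cintegral S (fun t => phi t * cexpi y t) - cintegral S (fun t => psi t * cexpi y t).
  have i1 : cintegrable S (fun t => phi t * cexpi y t) by exact: cintegrableM.
  have i2 : cintegrable S (fun t => psi t * cexpi y t) by exact: cintegrableM.
  rewrite -mulN1r -cintegralZ // -cintegralD //; last exact: cintegrableZ.
  by apply: eq_cintegral => t _; ring.
rewrite -[LHS]dE; apply: uniq => [|l Gl]; first exact: square_integrableB.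
rewrite dE phiE // -(fl l Gl) divfK ?fmorph_eq0 ?gt_eqF ?w0 // fE.
by rewrite subrr.
Qed.

Lemma cintegral_reflect_cexpi (a b : R) (phi : R -> C) (z : C) :
  square_integrable `[a, b] phi ->
  cintegral `[a, b] (fun u => phi (a + b - u) * cexpi (- z) u) =
  cexpi (- z) (a + b) * cintegral `[a, b] (fun u => phi u * cexpi z u).
Proof.
move=> sphi; have mI : measurable (`[a, b] : set (measurableTypeR R)) by exact: measurable_itv.
have sE := square_integrable_cexpi mI (@itv_bounded _ a b).
have i1 : cintegrable `[a, b] (fun u => phi u * cexpi z u) by exact: cintegrableM.
rewrite -cintegralZ // -[RHS]cintegral_reflect; last exact: cintegrableZ.
apply: eq_cintegral => u _; rewrite mulrCA; congr (_ * _).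
rewrite /cexpi -cexpD; congr cexp.
by rewrite !rmorphB !rmorphD /=; ring.
Qed.

(** The reflected spectrum takes at l the value at -l times e^{il(a+b)}; the modulus of this factor
    goes into the weight, its phase into the data [c']. *)
Lemma interpolating_reflect (a b : R) (G : set C) (w : C -> R) :
  interpolating `[a, b] G w ->
  interpolating `[a, b] [set l | G (- l)] (fun l => expR (- Im l * (a + b)) * w (- l)).
Proof.
move=> int c c2.
pose c' l : C := c (- l) * ((expR (Im l * (a + b)))%:C / cexpi (- l) (a + b)).
have nc' l : normc (c' l) = normc (c (- l)).
  rewrite /c' normcM normcM normcV normc_cexpi ImN opprK normc_real ger0_norm ?expR_ge0 //.
  by rewrite divff ?mulr1 // gt_eqF // expR_gt0.
have c'2 : ell2 G c'.
  have [K K0 hK] := bounded_of_ell2 c2.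
  apply: (@ell2_of_bounded _ _ _ K) => s us sG.
  have := hK [seq - l | l <- s]; rewrite map_inj_uniq; last exact: oppr_inj.
  rewrite big_map; under eq_bigr do rewrite -nc'; apply => //.
  by move=> l /mapP[y ys ->] /=; rewrite opprK; exact: sG.
have [phi sphi phiE] := int _ c'2.
exists (fun t => phi (a + b - t)); first exact: square_integrable_reflect.
move=> l /= Gl; rewrite -[l]opprK cintegral_reflect_cexpi // opprK phiE //.
rewrite /c' !opprK ImN rmorphM /=; have := cexp_neq0 ('i * l * (a + b)%:C).
by rewrite -/(cexpi l (a + b)); move: (cexpi _ _) (expR _)%:C => x y x0; field.
Qed.

Lemma total_reflect (a b : R) (G : set C) :
  total `[a, b] G -> total `[a, b] [set l | G (- l)].
Proof.
move=> tot psi spsi psi0; rewrite -sqn_reflect //; apply: tot.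
  exact: square_integrable_reflect.
move=> l Gl; rewrite -[l in LHS]opprK cintegral_reflect_cexpi // psi0 ?mulr0 //=.
by rewrite opprK.
Qed.

End CompleteInterpolatingIntro.

(** * Finite sums over the frequencies *)

Section FiniteSums.
Context {R : realType}.
Local Notation C := R[i].

Lemma big_mem_uniq (V : nmodType) (s s' : seq C) (x : C -> V) : uniq s -> uniq s' ->
  \sum_(z <- s') (if z \in s then x z else 0) = \sum_(z <- s) (if z \in s' then x z else 0).
Proof.
move=> us us'; rewrite -!big_mkcond -big_filter -[RHS]big_filter.
apply: perm_big; apply: uniq_perm; rewrite ?filter_uniq // => z.
by rewrite !mem_filter andbC.
Qed.

Lemma sum_mem_subset (V : nmodType) (s s' : seq C) (x : C -> V) : uniq s -> uniq s' ->
  {subset s <= s'} -> \sum_(z <- s') (if z \in s then x z else 0) = \sum_(z <- s) x z.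
Proof.
move=> us us' ss'; rewrite big_mem_uniq // big_seq [RHS]big_seq.
by apply: eq_bigr => z /ss' ->.
Qed.

Lemma sum_mem_le (s s' : seq C) (x : C -> R) : uniq s -> uniq s' -> (forall z, 0 <= x z) ->
  \sum_(z <- s') (if z \in s then x z else 0) <= \sum_(z <- s) x z.
Proof. by move=> us us' x0; rewrite big_mem_uniq // ler_sum // => z _; case: ifP. Qed.

(** [A] nearly attains the supremum of the finite sums, which stands in for the convergence of an
    infinite series. *)
Lemma finite_tail (T : set C) (x : C -> R) (B e : R) : 0 < e -> (forall z, 0 <= x z) ->
  (forall s, uniq s -> (forall z, z \in s -> T z) -> \sum_(z <- s) x z <= B) ->
  exists A, [/\ uniq A, (forall z, z \in A -> T z) &
    forall s, uniq s -> (forall z, z \in s -> T z) -> \sum_(z <- s | z \notin A) x z <= e].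
Proof.
move=> e0 x0 hB.
pose X := [set r | exists s : seq C,
  [/\ uniq s, (forall z, z \in s -> T z) & r = \sum_(z <- s) x z]].
have supX : has_sup X.
  split; first by exists 0, [::]; split; rewrite ?big_nil.
  by exists B => _ [s [us sT ->]]; exact: hB.
have [_ [A [uA AT ->]] hA] := sup_adherent e0 supX.
exists A; split => // s us sT.
have : \sum_(z <- [seq z <- s | z \notin A] ++ A) x z <= sup X.
  apply: sup_upper_bound => //; exists ([seq z <- s | z \notin A] ++ A); split => //.
    rewrite cat_uniq filter_uniq // uA andbT /=; apply/hasPn => z zA.
    by rewrite mem_filter zA.
  by move=> z; rewrite mem_cat mem_filter => /orP[/andP[_ /sT]|/AT].
rewrite big_cat big_filter /=; move: hA.
move: (\sum_(z <- A) _) (\sum_(z <- s | _) _) (sup X) => p q r; clear; lra.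
Qed.

Lemma normci : normc ('i : C) = 1.
Proof. by rewrite /normc /= expr0n expr1n add0r sqrtr1. Qed.

End FiniteSums.

(** The spectra of the quotients are known on the open gap only; the endpoints have measure zero. *)
Lemma eq_nrm_oo (R : realType) (a b : R) (phi psi : R -> R[i]) :
  square_integrable `[a, b] phi -> square_integrable `[a, b] psi ->
  (forall s, a < s -> s < b -> phi s = psi s) -> nrm `[a, b] phi = nrm `[a, b] psi.
Proof.
move=> s1 s2 e; have sqn_oo f : square_integrable `[a, b] f -> sqn `[a, b] f = sqn `]a, b[ f.
  move=> [_ _ i]; rewrite /sqn.
  rewrite -Rintegral_itv_obnd_cbnd -?Rintegral_itv_bndo_bndc //.
  - by apply: integrableS i => //; apply: subset_itv; rewrite bnd_simp.
  - by apply: integrableS i => //; apply: subset_itv; rewrite bnd_simp.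
rewrite /nrm !sqn_oo //; congr Num.sqrt; apply: eq_sqn => t.
by rewrite /= in_itv /= => /andP[]; exact: e.
Qed.

(** * Synthesis from the quotients: uniqueness on T and extension from the gap *)

Section Synthesis.
Context {R : realType}.
Local Notation C := R[i].
Local Notation mu := (@lebesgue_measure R).
(** In the application [rho t] is F^+(t) / F'(t), [w] is the kernel norm for [-pi, pi], [v t] is the
    kernel norm of the gap at conj t, and [low] is (iii). The constants [K1] and [K2] are those of
    the lower and the Bessel bound from (i), [K3] that of the Riesz bound from (ii). *)
Variables (a b r : R) (L T : set C) (g : C -> R -> C) (rho : C -> C) (w v : C -> R).
Variables (K1 K2 K3 delta : R).
Let I : set R := `[- r, r].
Let J : set R := `[a, b].
Let coef (phi : R -> C) z := cintegral I (fun s => phi s * cexpi z s).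
Let negsum (s : seq C) (c : C -> C) u := \sum_(t <- s) c t * cexpi (- t) u.
Let syn (s : seq C) (c : C -> C) u := \sum_(t <- s) c t * g t u.
Let data_bound (phi : R -> C) (B : R) := forall s, uniq s ->
  (forall l, l \in s -> (L `|` T) l) -> \sum_(l <- s) (normc (coef phi l) / w l) ^+ 2 <= B.

Hypothesis JI : J `<=` I.
Hypothesis disjLT : forall t, T t -> ~ L t.
Hypothesis w0 : forall l, (L `|` T) l -> 0 < w l.
Hypothesis K10 : 0 < K1.
Hypothesis lower : forall phi B, square_integrable I phi -> 0 <= B ->
  data_bound phi (B ^+ 2) -> nrm I phi <= K1 * B.
Hypothesis upper : forall phi, square_integrable I phi -> data_bound phi (K2 * sqn I phi).
Hypothesis K30 : 0 < K3.
Hypothesis rf : forall s c, uniq s -> (forall t, t \in s -> T t) ->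
  \sum_(t <- s) (normc (c t) * v t) ^+ 2 <= K3 * sqn J (negsum s c).
Hypothesis dense : forall h, square_integrable J h -> forall e : R, 0 < e ->
  exists s c, [/\ uniq s, (forall t, t \in s -> T t) & nrm J (fun u => h u - negsum s c u) <= e].
Hypothesis sg : forall t, square_integrable I (g t).
Hypothesis g1 : forall t, T t -> coef (g t) t = 1.
Hypothesis g0 : forall t z, T t -> (L `|` T) z -> z != t -> coef (g t) z = 0.
Hypothesis gJ : forall t s, T t -> a < s -> s < b -> g t s = 'i * rho t * cexpi (- t) s.
Hypothesis delta0 : 0 < delta.
Hypothesis v0 : forall t, 0 <= v t.
Hypothesis low : forall t, T t -> delta <= normc (rho t) * w t * v t.

Let mI : measurable (I : set (measurableTypeR R)). Proof. exact: measurable_itv. Qed.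
Let mJ : measurable (J : set (measurableTypeR R)). Proof. exact: measurable_itv. Qed.
Let sE := square_integrable_cexpi mI (@itv_bounded _ (- r) r).
Let sEJ := square_integrable_cexpi mJ (@itv_bounded _ a b).

Lemma square_integrable_syn s c : square_integrable I (syn s c).
Proof. by apply: square_integrable_sum => // t; exact: square_integrableZ. Qed.

Lemma square_integrable_negsum s c : square_integrable J (negsum s c).
Proof. by apply: square_integrable_sum => // t; exact: square_integrableZ. Qed.

Lemma coefB phi psi z : square_integrable I phi -> square_integrable I psi ->
  coef (fun u => phi u - psi u) z = coef phi z - coef psi z.
Proof.
move=> s1 s2; rewrite /coef.
have i1 : cintegrable I (fun t => phi t * cexpi z t) by exact: cintegrableM.
have i2 : cintegrable I (fun t => psi t * cexpi z t) by exact: cintegrableM.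
rewrite -mulN1r -cintegralZ // -cintegralD //; last exact: cintegrableZ.
by apply: eq_cintegral => t _; ring.
Qed.

Lemma coef_syn s c z : uniq s -> (forall t, t \in s -> T t) -> (L `|` T) z ->
  coef (syn s c) z = if z \in s then c z else 0.
Proof.
move=> us sT Gz; rewrite /coef /syn.
have -> : cintegral I (fun u => (\sum_(t <- s) c t * g t u) * cexpi z u) =
    \sum_(t <- s) c t * coef (g t) z.
  transitivity (\sum_(t <- s) cintegral I (fun u => c t * (g t u * cexpi z u))); last first.
    by apply: eq_bigr => t _; rewrite cintegralZ //; exact: cintegrableM.
  rewrite -cintegral_sum //; last first.
    by move=> t; apply: cintegrableZ => //; exact: cintegrableM.
  apply: eq_cintegral => u _; rewrite mulr_suml.
  by apply: eq_bigr => t _; rewrite mulrA.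
case: ifPn => zs.
  rewrite (bigD1_seq z) //= g1 ?mulr1; last exact: sT.
  rewrite big_seq_cond big1 ?addr0 // => t /andP[ts tz].
  by rewrite g0 ?mulr0 //; [exact: sT|rewrite eq_sym].
rewrite big_seq big1 // => t ts; rewrite g0 ?mulr0 //; first exact: sT.
by apply: contraNneq zs => ->.
Qed.

Lemma nrm_syn s c : uniq s -> (forall t, t \in s -> T t) ->
  nrm J (syn s c) = nrm J (negsum s (fun t => 'i * rho t * c t)).
Proof.
move=> us sT; apply: eq_nrm_oo.
- exact: (square_integrable_subset mJ mI JI (square_integrable_syn s c)).
- exact: square_integrable_negsum.
move=> u au ub; rewrite /syn /negsum big_seq [RHS]big_seq.
by apply: eq_bigr => t /sT Tt; rewrite gJ //; ring.
Qed.

(** The Bessel bound makes the values on T square summable, so a finite part of the expansion leaves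
    a remainder with small data, hence of small norm by (i). As [phi] vanishes on the gap, the
    finite part is small there, and the Riesz bound makes its coefficient at [t0] small. *)
Lemma orthogonal_on_T phi t0 : square_integrable I phi ->
  (forall s, a < s -> s < b -> phi s = 0) ->
  (forall l, L l -> coef phi l = 0) -> T t0 -> coef phi t0 = 0.
Proof.
move=> sphi phi0 phiL Tt0; apply/eqP; rewrite -normc_eq0; apply/eqP.
pose y := normc (rho t0) * normc (coef phi t0) * v t0.
suff y0 : y = 0.
  have := low Tt0; move/eqP: y0; rewrite /y !mulf_eq0 => /orP[/orP[]|] /eqP -> //;
    rewrite ?mul0r ?mulr0 => d0; by have := lt_le_trans delta0 d0; rewrite ltxx.
apply/eqP; apply/negPn/negP => y0.
have ygt0 : 0 < y by rewrite lt_def y0 !mulr_ge0 ?normc_ge0.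
(* Chosen so that K1 e = y / (K3 + 1); then y^2 <= K3 (K1 e)^2 would require (K3 + 1)^2 <= K3. *)
pose e := y / (K1 * (K3 + 1)).
have e0 : 0 < e by rewrite divr_gt0 // mulr_gt0 // addr_gt0.
pose x z := (normc (coef phi z) / w z) ^+ 2.
have [A [uA AT tail]] : exists A, [/\ uniq A, (forall z, z \in A -> T z) &
    forall s, uniq s -> (forall z, z \in s -> T z) -> \sum_(z <- s | z \notin A) x z <= e ^+ 2].
  apply: (@finite_tail _ _ _ (K2 * sqn I phi)) => [|z|s us sT]; rewrite ?exprn_gt0 ?sqr_ge0 //.
  by apply: upper => // l /sT; right.
pose A' := undup (t0 :: A).
have uA' : uniq A' := undup_uniq _.
have A'T z : z \in A' -> T z by rewrite mem_undup inE => /predU1P[->|/AT].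
have sS := square_integrable_syn A' (coef phi).
pose d u := phi u - syn A' (coef phi) u.
have sd : square_integrable I d by exact: square_integrableB.
have dI : nrm I d <= K1 * e.
  apply: lower => //; first exact: ltW.
  move=> s us sG; apply: le_trans (tail [seq l <- s | l \in T] _ _); rewrite ?filter_uniq //;
    last by move=> z; rewrite mem_filter => /andP[/set_mem].
  rewrite big_filter_cond [leRHS]big_mkcond [leLHS]big_seq [leRHS]big_seq.
  apply: ler_sum => l ls; have Gl := sG _ ls; rewrite coefB // coef_syn //=.
  rewrite mem_undup inE; case: ifPn => lA; last first.
    rewrite subr0; move: lA; rewrite negb_or => /andP[_ lA]; rewrite lA.
    case: ifPn => // lT; case: Gl => [/phiL ->|Tl]; first by rewrite normc0 mul0r expr0n.
    by rewrite mem_set in lT.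
  by rewrite subrr normc0 mul0r expr0n /=; case: ifP => // _; exact: sqr_ge0.
have dJ : nrm J (negsum A' (fun t => 'i * rho t * coef phi t)) <= K1 * e.
  rewrite -nrm_syn //; apply: le_trans dI; apply: le_trans (nrm_subset mJ mI JI sd).
  rewrite /d nrmBC (@eq_nrm_oo _ a b (syn A' (coef phi))
    (fun u => syn A' (coef phi) u - phi u)) //.
  - exact: (square_integrable_subset mJ mI JI sS).
  - by apply: (square_integrable_subset mJ mI JI); exact: square_integrableB.
  - by move=> s as_ sb; rewrite phi0 // subr0.
have := rf (fun t => 'i * rho t * coef phi t) uA' A'T.
rewrite (bigD1_seq t0) //=; last by rewrite mem_undup mem_head.
have -> : normc ('i * rho t0 * coef phi t0) * v t0 = y.
  by rewrite !normcM normci mul1r.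
move=> le; have : y ^+ 2 <= K3 * (K1 * e) ^+ 2.
  apply: le_trans (_ : _ <= K3 * sqn J (negsum A' (fun t => 'i * rho t * coef phi t))) _.
    by apply: le_trans le; rewrite lerDl sumr_ge0 // => z _; exact: sqr_ge0.
  by rewrite -nrm2 ler_wpM2l ?(ltW K30) // ler_sqr ?nnegrE ?nrm_ge0 // (le_trans (nrm_ge0 _ _) dJ).
have -> : K1 * e = y / (K3 + 1) by rewrite /e; field; rewrite !gt_eqF ?addr_gt0.
rewrite expr_div_n mulrCA -ler_pdivrMl ?exprn_gt0 // mulVf ?expf_neq0 //.
rewrite ler_pdivlMr ?exprn_gt0 ?addr_gt0 // mul1r.
have K3K : K3 < (K3 + 1) ^+ 2.
  rewrite sqrrD1 mulr2n ltr_pwDr // addrA ler_wpDl // addr_ge0 ?sqr_ge0 //.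
  exact: ltW.
by rewrite leNgt K3K.
Qed.

(* This is where hypothesis (iii) of the theorem is used, through [low]. *)
Lemma nrm_syn_le s c : uniq s -> (forall t, t \in s -> T t) ->
  nrm I (syn s c) <= K1 * (Num.sqrt K3 / delta) * nrm J (syn s c).
Proof.
move=> us sT; rewrite -mulrA; apply: lower; first exact: square_integrable_syn.
  by rewrite !mulr_ge0 ?nrm_ge0 ?invr_ge0 ?sqrtr_ge0 // ltW.
move=> s' us' sG; rewrite nrm_syn // exprMn expr_div_n sqr_sqrtr ?(ltW K30) // nrm2.
rewrite mulrAC ler_pdivlMr ?exprn_gt0 //.
apply: le_trans (rf (fun t => 'i * rho t * c t) us sT).
apply: (@le_trans _ _ (\sum_(z <- s) (normc (c z) / w z) ^+ 2 * delta ^+ 2)).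
  rewrite -mulr_suml ler_wpM2r ?sqr_ge0 //.
  apply: le_trans (sum_mem_le us us' _); last by move=> z; exact: sqr_ge0.
  rewrite big_seq [leRHS]big_seq ler_sum // => z zs; rewrite coef_syn //; last exact: sG.
  by case: ifP => // _; rewrite normc0 mul0r expr0n.
rewrite big_seq [leRHS]big_seq ler_sum // => z /sT Tz.
have wz : 0 < w z by apply: w0; right.
rewrite -exprMn ler_sqr ?nnegrE ?mulr_ge0 ?normc_ge0 ?invr_ge0 ?(ltW delta0) ?(ltW wz) //.
rewrite mulrAC ler_pdivrMr // !normcM normci mul1r.
have := ler_wpM2l (normc_ge0 (c z)) (low Tz); congr (_ <= _); ring.
Qed.

(** Exponential sums approximating [h] on the gap are the gap spectra of sums [syn], which vanish on
    L. By [nrm_syn_le], being Cauchy on the gap forces being Cauchy on the whole interval, and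
    vanishing on L passes to the limit. *)
Lemma extension h : square_integrable J h -> exists phi,
  [/\ square_integrable I phi, (forall l, L l -> coef phi l = 0) &
      nrm J (fun u => h u - phi u) = 0].
Proof.
move=> sh.
have rho0 t : T t -> 'i * rho t != 0.
  move=> Tt; rewrite mulf_neq0 ?neq0Ci // -normc_eq0; apply/eqP => r0.
  by have := low Tt; rewrite r0 !mul0r => /(lt_le_trans delta0); rewrite ltxx.
have /choice[p hp] : forall n : nat, exists p : seq C * (C -> C),
    [/\ uniq p.1, (forall t, t \in p.1 -> T t) &
        nrm J (fun u => h u - syn p.1 p.2 u) <= n.+1%:R^-1].
  move=> n.
  have n0 : 0 < n.+1%:R^-1 :> R by rewrite invr_gt0 ltr0n.
  have [s [c [us sT le]]] := dense sh n0.
  exists (s, fun t => c t / ('i * rho t)); split => //=; apply: le_trans le.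
  rewrite (@eq_nrm_oo _ a b _ (fun u => h u - negsum s c u)) //.
  - apply: square_integrableB => //.
    exact: (square_integrable_subset mJ mI JI (square_integrable_syn _ _)).
  - by apply: square_integrableB => //; exact: square_integrable_negsum.
  move=> u au ub; congr (_ - _); rewrite /syn /negsum big_seq [RHS]big_seq.
  apply: eq_bigr => t /sT Tt; rewrite gJ // mulrA divfK //; exact: rho0.
pose Phi n := syn (p n).1 (p n).2.
have sPhi n : square_integrable I (Phi n) by exact: square_integrable_syn.
have sPhiJ n : square_integrable J (Phi n) by exact: (square_integrable_subset mJ mI JI _).
have hPhi n : nrm J (fun u => h u - Phi n u) <= n.+1%:R^-1 by have [] := hp n.
pose K := K1 * (Num.sqrt K3 / delta).
have K0 : 0 <= K by rewrite /K !mulr_ge0 ?invr_ge0 ?sqrtr_ge0 // ltW.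
have dPhi m n : nrm I (fun u => Phi m u - Phi n u) <= K * (m.+1%:R^-1 + n.+1%:R^-1).
  have [um mT _] := hp m; have [un nT _] := hp n.
  pose s := undup ((p m).1 ++ (p n).1).
  have us : uniq s := undup_uniq _.
  have sT t : t \in s -> T t by rewrite mem_undup mem_cat => /orP[/mT|/nT].
  pose c t := (if t \in (p m).1 then (p m).2 t else 0) - (if t \in (p n).1 then (p n).2 t else 0).
  have E : (fun u => Phi m u - Phi n u) = syn s c.
    apply/funext => u; rewrite /syn /Phi /syn.
    rewrite -(sum_mem_subset _ um us); last by move=> t tm; rewrite mem_undup mem_cat tm.
    rewrite -(sum_mem_subset _ un us); last by move=> t tn; rewrite mem_undup mem_cat tn orbT.
    rewrite -sumrB; apply: eq_bigr => t _; rewrite /c mulrBl.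
    by congr (_ - _); case: ifP; rewrite ?mul0r.
  rewrite E; apply: le_trans (nrm_syn_le c us sT) _; rewrite -E ler_wpM2l //.
  apply: le_trans (nrm_triangle mJ (sPhiJ m) (sPhiJ n) sh) _.
  by rewrite nrmBC lerD.
have natinv e : 0 < e -> exists N : nat, forall n, (N <= n)%N -> n.+1%:R^-1 <= e :> R.
  move=> e0; have [N _ hN] := near_infty_natSinv_lt (PosNum e0).
  by exists N => n Nn; rewrite ltW // hN.
have [|phi sphi lim] := L2_complete mI sPhi.
  move=> e e0; have e2 : 0 < e / 2 / (K + 1) by rewrite !divr_gt0 // ltr_wpDl.
  have [N hN] := natinv _ e2; exists N => m n Nm Nn.
  apply: le_trans (dPhi m n) _.
  have K1' : 0 < K + 1 by rewrite ltr_wpDl.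
  have /(ler_wpM2l (ltW K1')) := lerD (hN _ Nm) (hN _ Nn).
  have -> : (K + 1) * (e / 2 / (K + 1) + e / 2 / (K + 1)) = e by field; rewrite gt_eqF.
  by apply: le_trans; rewrite ler_wpM2r ?addr_ge0 ?invr_ge0 ?ler0n // lerDl.
exists phi; split => // [l Ll|].
  apply/eqP; rewrite -normc_eq0 eq_le normc_ge0 andbT; apply/ler_addgt0Pr => e e0.
  rewrite add0r; pose k := nrm I (cexpi l).
  have k0 : 0 <= k by exact: nrm_ge0.
  have e1 : 0 < e / (k + 1) by rewrite divr_gt0 // ltr_wpDl.
  have [N /(_ N (leqnn N)) hN] := lim _ e1.
  have [uN NT _] := hp N.
  have PhiL : coef (Phi N) l = 0.
    rewrite /Phi coef_syn //; last by left.
    by case: ifPn => // /NT /disjLT.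
  have -> : normc (coef phi l) = normc (coef (fun u => Phi N u - phi u) l).
    by rewrite coefB // PhiL sub0r normcN.
  apply: le_trans (normc_pairing_le mI _ (sE l)) _; first exact: square_integrableB.
  apply: le_trans (ler_wpM2r k0 hN) _.
  by rewrite mulrAC ler_pdivrMr ?ltr_wpDl // ler_wpM2l ?(ltW e0) // lerDl.
apply/eqP; rewrite eq_le nrm_ge0 andbT; apply/ler_addgt0Pr => e e0; rewrite add0r.
have e2 : 0 < e / 2 by rewrite divr_gt0.
have [N hN] := lim _ e2; have [N' hN'] := natinv _ e2.
have sphiJ : square_integrable J phi by exact: (square_integrable_subset mJ mI JI _).
apply: le_trans (nrm_triangle mJ sh sphiJ (sPhiJ (maxn N N'))) _.
rewrite [leRHS](splitr e) lerD //.
  by apply: le_trans (hPhi _) _; apply: hN'; exact: leq_maxr.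
apply: le_trans (hN (maxn N N') (leq_maxl _ _)).
by apply: nrm_subset => //; exact: square_integrableB.
Qed.

End Synthesis.

(** * Assembling the hypotheses *)

Lemma ereal_inf_image_gt0 (R : realType) (A : Type) (T : set A) (x : A -> R) :
  (0 < ereal_inf [set (x t)%:E | t in T])%E ->
  exists2 delta, 0 < delta & forall t, T t -> delta <= x t.
Proof.
move=> inf0; have lb t : T t -> (ereal_inf [set (x t)%:E | t in T] <= (x t)%:E)%E.
  by move=> Tt; apply: ereal_inf_lbound; exists t.
move: inf0 lb; case: (ereal_inf _) => [d|_|//]; first by exists d.
(* The infimum is +oo only for empty [T], where any constant serves. *)
by move=> lb; exists 1 => // t /lb; rewrite leye_eq.
Qed.

Lemma expsum_opp_seq (R : realType) (s : seq R[i]) (c : R[i] -> R[i]) (u : R) :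
  expsum [seq - t | t <- s] (fun l => c (- l)) u = \sum_(t <- s) c t * cexpi (- t) u.
Proof. by rewrite /expsum big_map; apply: eq_bigr => t _; rewrite opprK. Qed.

(** E and the open gap partition [-pi, pi], and Cauchy-Schwarz makes the contribution of the gap
    zero. *)
Lemma cintegral_gap (R : realType) (a b : R) (phi : R -> R[i]) (z : R[i]) :
  - pi < a -> a < b -> b < pi -> square_integrable `[- pi, pi] phi ->
  nrm `[a, b] phi = 0 ->
  cintegral (`[- pi, a] `|` `[b, pi]) (fun t => phi t * cexpi z t) =
  cintegral `[- pi, pi] (fun t => phi t * cexpi z t).
Proof.
move=> pa ab bp sphi n0; set E := _ `|` _; pose O : set R := `]a, b[%classic.
have mI : measurable (`[- pi, pi] : set (measurableTypeR R)) by exact: measurable_itv.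
have mJ : measurable (`[a, b] : set (measurableTypeR R)) by exact: measurable_itv.
have mO : measurable (O : set (measurableTypeR R)) by exact: measurable_itv.
have mE : measurable (E : set (measurableTypeR R)) by apply: measurableU; exact: measurable_itv.
have sE := square_integrable_cexpi mI (@itv_bounded _ (- pi) pi) z.
have OJ : O `<=` `[a, b] by apply: subset_itv; rewrite bnd_simp.
have JI : `[a, b] `<=` `[- pi, pi] by apply: subset_itv; rewrite bnd_simp ltW.
have EO : E `|` O = `[- pi, pi]%classic.
  apply/seteqP; split => t.
    move=> [[]|] /=; rewrite !in_itv /= => /andP[t1 t2]; apply/andP; split => //.
    - exact: le_trans t2 (ltW (lt_trans ab bp)).
    - exact: le_trans (ltW (lt_trans pa ab)) t1.
    - exact: ltW (lt_trans pa t1).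
    - exact: ltW (lt_trans t2 bp).
  rewrite /= in_itv /= => /andP[t1 t2]; case: (leP t a) => ta.
    by left; left; rewrite /= in_itv /= t1.
  case: (leP b t) => bt; first by left; right; rewrite /= in_itv /= bt.
  by right; rewrite /O /= in_itv /= ta.
have disj : [disjoint E & O].
  apply/disj_setPS => t [[]] /=; rewrite !in_itv /= => /andP[t1 t2] /andP[t3 t4].
    by move: t3; rewrite bnd_simp ltNge t2.
  by move: t4; rewrite bnd_simp ltNge t1.
rewrite -EO (cintegral_setU mE mO) //; last by rewrite EO; exact: cintegrableM.
apply/esym/eqP; rewrite -subr_eq0 addrC addKr -normc_eq0 eq_le normc_ge0 andbT.
have sJ := square_integrable_subset mJ mI JI sphi.
apply: le_trans (normc_pairing_le mO _ _) _.
- exact: (square_integrable_subset mO mJ OJ sJ).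
- exact: (square_integrable_subset mO mJ OJ (square_integrable_subset mJ mI JI sE)).
rewrite -[leRHS](mul0r (nrm O (cexpi z))) ler_wpM2r ?nrm_ge0 // -n0.
exact: nrm_subset.
Qed.

Section Assembly.
Context {R : realType}.
Local Notation C := R[i].
Variables (a b : R) (T : set C).
Hypothesis ab : a < b.
Let J : set R := `[a, b].
Let mJ : measurable (J : set (measurableTypeR R)). Proof. exact: measurable_itv. Qed.
Hypothesis cisT : complete_interpolating J T.
Let v t : R := expR (Im t * (a + b)) * pw_norm (kappa J t).

(** The quotients have gap spectra e^{-itu}, whereas (ii) concerns e^{itu}; the reflection of the
    interval passes from one to the other and produces the weight [v]. *)
Lemma conjugate_riesz_fischer : exists2 K, 0 < K & forall s c, uniq s ->
  (forall t, t \in s -> T t) ->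
  \sum_(t <- s) (normc (c t) * v t) ^+ 2 <= K * sqn J (fun u => \sum_(t <- s) c t * cexpi (- t) u).
Proof.
have w0 := complete_interpolating_weight_gt0 cisT.
have int := interpolating_reflect (complete_interpolating_interpolating cisT).
have [|K K0 hK] := riesz_fischer mJ (@itv_bounded _ a b) _ int.
  by move=> l Tl; rewrite mulr_gt0 ?expR_gt0 // w0.
exists K => // s c us sT.
have us' : uniq [seq - t | t <- s] by rewrite map_inj_uniq; last exact: oppr_inj.
have sT' l : l \in [seq - t | t <- s] -> [set l | T (- l)] l.
  by move=> /mapP[t ts ->] /=; rewrite (opprK t); exact: sT.
have := hK [seq - t | t <- s] (fun l => c (- l)) us' sT'; rewrite big_map.
have -> : expsum [seq - t | t <- s] (fun l => c (- l)) =
    (fun u => \sum_(t <- s) c t * cexpi (- t) u).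
  by apply/funext => u; exact: expsum_opp_seq.
apply: le_trans; apply: ler_sum => t _.
by rewrite (opprK t) ImN (opprK (Im t)).
Qed.

Lemma conjugate_dense h : square_integrable J h -> forall e : R, 0 < e ->
  exists s c, [/\ uniq s, (forall t, t \in s -> T t) &
    nrm J (fun u => h u - \sum_(t <- s) c t * cexpi (- t) u) <= e].
Proof.
move=> sh e e0.
have tot := total_reflect (complete_interpolating_total mJ (@itv_bounded _ a b) cisT).
have [s [c [us sT le]]] := expsum_dense mJ (@itv_bounded _ a b) tot sh e0.
exists [seq - l | l <- s], (fun t => c (- t)); split.
- by rewrite map_inj_uniq //; exact: (@oppr_inj C).
- by move=> t /mapP[l /sT /= Tl ->].
apply: le_trans le; rewrite le_eqVlt; apply/orP; left; apply/eqP; congr nrm; apply/funext => u.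
by rewrite /expsum big_map; congr (_ - _); apply: eq_bigr => l _; rewrite !opprK.
Qed.

End Assembly.

Theorem theorem1 (R : realType) (a b : R) (ha : - pi < a) (hab : a < b)
  (hb : b < pi)
  (L : set R[i]) (F Fm Fp : R[i] -> R[i])
  (hF : generating_function (`[- pi, a] `|` `[b, pi]) L F)
  (hFm : PW_plus_zPW `[- pi, a] Fm)
  (hFp : PW_plus_zPW `[b, pi] Fp)
  (hdec : forall z, F z = Fm z + Fp z)
  (hsimple : forall z, F z = 0 -> cderiv F z <> 0)
  (T : set R[i]) (hT : T = [set z | F z = 0] `\` L)
  (h1 : complete_interpolating `[- pi, pi] (L `|` T))
  (h2 : complete_interpolating `[a, b] T)
  (h3 : (0 < ereal_inf [set (normc (Fp t / cderiv F t)
                             * pw_norm (kappa `[- pi, pi] t)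
                             * pw_norm (kappa `[a, b] t^*))%:E | t in T])%E) :
  complete_interpolating (`[- pi, a] `|` `[b, pi]) L.
Proof.
have pi0 := pi_gt0 R; have [_ _ _ FL] := hF.
pose I : set R := `[- pi, pi]%classic; pose J : set R := `[a, b]%classic.
pose E : set R := `[- pi, a] `|` `[b, pi].
have mI : measurable (I : set (measurableTypeR R)) by exact: measurable_itv.
have mJ : measurable (J : set (measurableTypeR R)) by exact: measurable_itv.
have mE : measurable (E : set (measurableTypeR R)).
  by apply: measurableU; exact: measurable_itv.
have JI : J `<=` I by apply: subset_itv; rewrite bnd_simp ltW.
have EI : E `<=` I.
  by move=> t [] /=; rewrite !in_itv /= => /andP[t1 t2]; apply/andP; split => //;
    [exact: le_trans t2 (ltW (lt_trans hab hb))|exact: le_trans (ltW (lt_trans ha hab)) t1].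
have TF t : T t -> F t = 0 by rewrite hT => -[].
have LTF z : (L `|` T) z -> F z = 0 by move=> [/FL|/TF].
have disj t : T t -> ~ L t by rewrite hT => -[].
have sE := square_integrable_cexpi mI (@itv_bounded _ (- pi) pi).
pose w l := pw_norm (kappa I l).
pose v t := expR (Im t * (a + b)) * pw_norm (kappa J t).
have w0 l : (L `|` T) l -> 0 < w l := complete_interpolating_weight_gt0 h1 (l:=l).
have intI := complete_interpolating_interpolating h1.
have totI := complete_interpolating_total mI (@itv_bounded _ (- pi) pi) h1.
have [K1 K10 lower] := frame_lower_bound mI (@itv_bounded _ (- pi) pi) w0 intI totI.
have [K0 K00 rfI] := riesz_fischer mI (@itv_bounded _ (- pi) pi) w0 intI.
have [k k0 hk] := @kernel_norm_lower R.
have [K2 K20 upper] := bessel pi0 K00 k0 rfI (fun l _ => hk l) w0.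
have [K3 K30 rf] := conjugate_riesz_fischer h2.
have dense := conjugate_dense h2.
have [delta delta0 low] := ereal_inf_image_gt0 h3.
have /choice[g gP] : forall t, exists g, square_integrable I g /\ (T t ->
   [/\ cintegral I (fun s => g s * cexpi t s) = 1,
    (forall z, F z = 0 -> z != t -> cintegral I (fun s => g s * cexpi z s) = 0) &
    (forall s, a < s -> s < b -> g s = 'i * (Fp t / cderiv F t) * cexpi (- t) s)]).
  move=> t; have [Tt|nT] := pselect (T t); last first.
    by exists (fun=> 0); split => //; exact: square_integrable0.
  have [g [g1 g2 g3 g4]] :=
    generating_quotient ha hab hb hFm hFp hdec (TF t Tt) (hsimple t (TF t Tt)).
  by exists g; split => // _; split.
have sg t : square_integrable I (g t) by have [] := gP t.
have g1 t : T t -> cintegral I (fun s => g t s * cexpi t s) = 1.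
  by move=> Tt; have [_ /(_ Tt)[]] := gP t.
have g0 t z : T t -> (L `|` T) z -> z != t -> cintegral I (fun s => g t s * cexpi z s) = 0.
  by move=> Tt /LTF Fz zt; have [_ /(_ Tt)[_ + _]] := gP t; apply.
have gJ t s : T t -> a < s -> s < b -> g t s = 'i * (Fp t / cderiv F t) * cexpi (- t) s.
  by move=> Tt; have [_ /(_ Tt)[_ _]] := gP t; apply.
have v0 t : 0 <= v t by rewrite mulr_ge0 ?expR_ge0 ?sqrtr_ge0.
(* Here the norm at the conjugate point in (iii) becomes the weight [v]. *)
have lowv t : T t -> delta <= normc (Fp t / cderiv F t) * w t * v t.
  move=> Tt; rewrite /v -pw_norm_kappa_conj ?(ltW ha) ?(ltW hab) ?(ltW hb) //; exact: low.
have upper' phi : square_integrable I phi -> forall s, uniq s ->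
    (forall l, l \in s -> (L `|` T) l) ->
    \sum_(l <- s) (normc (cintegral I (fun t => phi t * cexpi l t)) / w l) ^+ 2 <= K2 * sqn I phi.
  by move=> sphi s us sG; exact: upper.
have orth phi t : square_integrable I phi -> (forall s, a < s -> s < b -> phi s = 0) ->
    (forall l, L l -> cintegral I (fun s => phi s * cexpi l s) = 0) -> T t ->
    cintegral I (fun s => phi s * cexpi t s) = 0.
  exact: (orthogonal_on_T JI K10 lower upper' K30 rf sg g1 g0 gJ delta0 v0 lowv).
have ext h : square_integrable J h -> exists phi, [/\ square_integrable I phi,
    (forall l, L l -> cintegral I (fun s => phi s * cexpi l s) = 0) &
    nrm J (fun u => h u - phi u) = 0].
  exact: (extension JI disj w0 K10 lower K30 rf dense sg g1 g0 gJ delta0 v0 lowv).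
have [KE KE0 wE] := kernel_norm_union ha hab hb.
have Ebd t : E t -> `|t| <= pi.
  by move=> /EI; rewrite /I /= in_itv /= => /andP[t1 t2]; rewrite ler_norml t1 t2.
apply: (complete_interpolating_intro mE).
- by exists pi.
- by move=> l _; have [] := wE l.
(* [q] converts data normalised for E into data normalised for [-pi, pi]; it is bounded because the
   upper bound for one norm and the lower bound for the other have the same growth in Im l. *)
- move=> c c2; pose q l := pw_norm (kappa E l) / w l.
  have q2 l : (L `|` T) l -> q l ^+ 2 <= KE / k.
    move=> Gl; have wl := w0 l Gl; have [_ wEl] := wE l.
    rewrite /q expr_div_n ler_pdivrMr ?exprn_gt0 //; apply: le_trans wEl _.
    rewrite -(ler_pM2l k0); have := ler_wpM2l (ltW KE0) (hk l); rewrite -/(w l).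
    move: (expR _) (1 + _)^-1 (w l ^+ 2) => x y z.
    have -> : k * (KE / k * z) = KE * z by field; rewrite gt_eqF.
    by congr (_ <= _); ring.
  (* The values on T are free at this stage; zero keeps the data square summable. *)
  pose c' l : R[i] := if l \in L then c l * (q l)%:C else 0.
  have c'2 : ell2 (L `|` T) c'.
    have [K K0' hK] := bounded_of_ell2 c2.
    apply: (@ell2_of_bounded _ _ _ (KE / k * K)) => s us sG.
    apply: (@le_trans _ _ (KE / k * \sum_(l <- [seq l <- s | l \in L]) normc (c l) ^+ 2)).
      rewrite big_filter [X in _ * X]big_mkcond mulr_sumr [leLHS]big_seq [leRHS]big_seq.
      apply: ler_sum => l ls.
      rewrite /c'; case: ifP => _; last by rewrite normc0 expr0n mulr0.
      rewrite normcM normc_real exprMn real_normK ?num_real // mulrC ler_wpM2r ?sqr_ge0 //.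
      by apply: q2; exact: sG.
    rewrite ler_wpM2l ?divr_ge0 ?(ltW KE0) ?(ltW k0) //; apply: hK; first exact: filter_uniq.
    by move=> l; rewrite mem_filter => /andP[/set_mem].
  have [phi0 sphi0 phi0E] := intI c' c'2.
  have [phi1 [sphi1 phi1L phi1J]] := ext phi0 (square_integrable_subset mJ mI JI sphi0).
  (* [phi1] has the gap spectrum of [phi0] and vanishes on L: subtracting it empties the gap and
     keeps the values on L. *)
  pose d u := phi0 u - phi1 u.
  have sd : square_integrable I d by exact: square_integrableB.
  exists d; first exact: (square_integrable_subset mE mI EI sd).
  move=> l Ll; rewrite (cintegral_gap l ha hab hb sd phi1J).
  have dE : cintegral I (fun t => d t * cexpi l t) =
      cintegral I (fun t => phi0 t * cexpi l t) - cintegral I (fun t => phi1 t * cexpi l t).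
    exact: coefB.
  rewrite [LHS]dE phi1L // subr0 phi0E; last by left.
  have qw : q l * w l = pw_norm (kappa E l).
    by rewrite /q divfK // gt_eqF //; apply: w0; left.
  by rewrite /c' (mem_set Ll) -mulrA -rmorphM qw.
(* Extended by zero, [phi] is a spectrum on [-pi, pi] with empty gap; [orth] gives zero values on T
   as well, and totality of (i) concludes. *)
- move=> phi sphi phiL z.
  have scut : square_integrable I (cut E phi) by exact: square_integrable_cut.
  have cutE y : cintegral I (fun t => cut E phi t * cexpi y t) =
      cintegral E (fun t => phi t * cexpi y t).
    by rewrite -(cintegral_cut EI); apply: eq_cintegral => t _; exact: cut_mul.
  have cut0 s : a < s -> s < b -> cut E phi s = 0.
    move=> as_ sb; rewrite /cut ifF //; apply/negbTE/negP => /set_mem[] /=; rewrite in_itv /=.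
      by move=> /andP[_]; rewrite leNgt as_.
    by move=> /andP[]; rewrite leNgt sb.
  have cutG l : (L `|` T) l -> cintegral I (fun t => cut E phi t * cexpi l t) = 0.
    by move=> [Ll|Tl]; [rewrite cutE phiL|apply: orth => // y Ly; rewrite cutE phiL].
  have n0 : nrm I (cut E phi) = 0 by rewrite /nrm totI // sqrtr0.
  rewrite -cutE; apply/eqP; rewrite -normc_eq0 eq_le normc_ge0 andbT.
  by apply: le_trans (normc_pairing_le mI scut (sE z)) _; rewrite n0 mul0r.
Qed.
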